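(* Let $n\ge 2$, let $\Omega\subset\mathbb{R}^n$ be a bounded open set, let $p>1$ and $q\in(p,n)$. Let $0\le h\in L^{q/p}(\Omega)$, and let $a_i:\Omega\times\mathbb{R}^n\to\mathbb{R}$, $i=1,\dots,n$, be Carathéodory functions for which there are constants $c_1>0$ and $\tilde\nu\in(0,+\infty)$ such that, for almost every $x\in\Omega$ and all $z,\tilde z\in\mathbb{R}^n$, $$|a_i(x,z)|\le c_1\Big(h(x)+\sum_{j=1}^n|z_j|^{p}\Big)^{1-1/p}\quad (i=1,\dots,n),$$ $$\tilde\nu\sum_{i=1}^n|z_i-\tilde z_i|^{p}\le\sum_{i=1}^n\big(a_i(x,z)-a_i(x,\tilde z)\big)(z_i-\tilde z_i).$$ Let $\theta\in W^{1,q}(\Omega)$ and suppose $f^i\in L^{q/(p-1)}(\Omega)$ for $i=1,\dots,n$. Then every solution $u\in\theta+W_0^{1,p}(\Omega)$ to the boundary value problem $$\sum_{i=1}^nD_i(a_i(x,Du(x)))=\sum_{i=1}^nD_if^i(x)\ \text{ in }\Omega,\qquad u=\theta\ \text{ on }\partial\Omega,$$ satisfies $$u\in\theta+L^t_{weak}(\Omega),\qquad\text{where}\quad t=\frac{nq}{n-q}.$$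
   Context: $D_k v=\partial v/\partial x_k$ denotes the weak partial derivative and $Du=(D_1u,\dots,D_nu)$. For $r>1$, $W^{1,r}(\Omega)=\{v\in W^{1,1}(\Omega): D_kv\in L^{r}(\Omega)\text{ for every }k=1,\dots,n\}$ and $W_0^{1,r}(\Omega)=\{v\in W_0^{1,1}(\Omega): D_kv\in L^{r}(\Omega)\text{ for every }k=1,\dots,n\}$. For $t>0$, the weak Lebesgue (Marcinkiewicz) space $L^t_{weak}(\Omega)$ consists of all measurable functions $f$ on $\Omega$ for which there is a positive constant $k=k(f)$ with $|\{x\in\Omega:|f(x)|>\tau\}|\le k/\tau^t$ for every $\tau>0$, where $|E|$ is the $n$-dimensional Lebesgue measure of $E$. A function $u\in\theta+W_0^{1,p}(\Omega)$ is called a solution to the boundary value problem $$\sum_{i=1}^nD_i(a_i(x,Du(x)))=\sum_{i=1}^nD_if^i(x)\ \text{ in }\Omega,\qquad u=\theta\ \text{ on }\partial\Omega,$$ if $$\int_\Omega\sum_{i=1}^na_i(x,Du(x))D_i\varphi(x)\,dx=\int_\Omega\sum_{i=1}^nf^i(x)D_i\varphi(x)\,dx$$ for every $\varphi\in W_0^{1,p}(\Omega)$. *)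

(* Defs.v *)
From HB Require Import structures.
From mathcomp Require Import all_boot all_order all_algebra.
From mathcomp Require Import all_classical all_reals all_analysis.

Set Implicit Arguments.
Unset Strict Implicit.
Unset Printing Implicit Defensive.

Import Order.TTheory GRing.Theory Num.Theory.
Import numFieldNormedType.Exports.

Local Open Scope classical_set_scope.
Local Open Scope ring_scope.

(** * Lebesgue measure on R^n

   The n-fold product of the Borel-Lebesgue measure is built by recursion on
   [n.-tuple R] (where the library provides the product sigma-algebra), then
   completed by Caratheodory's construction and transported to ['rV[R]_n].  In
   particular the measurable sets of ['rV[R]_n] are all the Lebesgue measurable
   sets, not only the Borel ones. *)

Section tuple_lebesgue.
Context {R : realType}.

Definition consT n (x : R * n.-tuple R) : n.+1.-tuple R :=
  [the n.+1.-tuple R of x.1 :: x.2].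

Definition unconsT n (t : n.+1.-tuple R) : R * n.-tuple R :=
  (thead t, [tuple of behead t]).

Lemma measurable_consT n : measurable_fun setT (@consT n).
Proof.
by apply: measurable_cons; [exact: measurable_fst|exact: measurable_snd].
Qed.

Lemma measurable_unconsT n : measurable_fun setT (@unconsT n).
Proof.
apply/measurable_fun_pairP; split; first exact: (measurable_tnth ord0).
apply/measurable_fun_tnthP => i.
rewrite (_ : _ \o _ = @tnth _ _ ^~ (lift ord0 i)); first exact: measurable_tnth.
by apply/funext => t /=; rewrite [in RHS](tuple_eta t) tnthS.
Qed.

Lemma consTK n : cancel (@consT n) (@unconsT n).
Proof. by move=> [x t]; congr pair; apply/val_inj. Qed.

Lemma unconsTK n : cancel (@unconsT n) (@consT n).
Proof. by move=> t; rewrite [RHS]tuple_eta; apply/val_inj. Qed.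

Section step.
Variables (n : nat) (mu : {sigma_finite_measure set (n.-tuple R) -> \bar R}).

Definition tuple_lebesgue_step : set (n.+1.-tuple R) -> \bar R :=
  pushforward (lebesgue_measure \x mu)%E (@consT n).

Let stepM :=
  measure_function_pushforward__canonical__measure_function_Measure
    (lebesgue_measure \x mu)%E (@measurable_consT n).

Let step0 : tuple_lebesgue_step set0 = 0%E.
Proof. exact: (measure0 stepM). Qed.

Let step_ge0 A : (0 <= tuple_lebesgue_step A)%E.
Proof. exact: (measure_ge0 stepM). Qed.

Let step_sigma_additive : semi_sigma_additive tuple_lebesgue_step.
Proof. exact: (@measure_semi_sigma_additive _ _ _ stepM). Qed.

HB.instance Definition _ := isMeasure.Build _ _ _ tuple_lebesgue_step
  step0 step_ge0 step_sigma_additive.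

Let step_sigma_finite : sigma_finite setT tuple_lebesgue_step.
Proof.
have /sigma_finiteP[F [TF ndF Foo]] := sigma_finiteT (@lebesgue_measure R).
have /sigma_finiteP[G [TG ndG Goo]] := sigma_finiteT mu.
exists (fun k => @unconsT n @^-1` (F k `*` G k)) => [|k].
  rewrite -preimage_bigcup (_ : \bigcup_i _ = setT) ?preimage_setT//.
  apply/seteqP; split => // -[x t] _.
  have [i _ Fix] : (\bigcup_i F i) x by rewrite -TF.
  have [j _ Gjt] : (\bigcup_i G i) t by rewrite -TG.
  exists (maxn i j) => //; split.
    by move: x Fix; exact/subsetPset/ndF/leq_maxl.
  by move: t Gjt; exact/subsetPset/ndG/leq_maxr.
have [mF Fk] := Foo k; have [mG Gk] := Goo k; split.
  rewrite -[X in measurable X]setTI; apply: measurable_unconsT => //.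
  exact: measurableX.
rewrite /tuple_lebesgue_step /pushforward -comp_preimage.
rewrite (_ : @unconsT n \o _ = id); last by apply/funext => x /=; rewrite consTK.
rewrite preimage_id product_measure1E//.
by rewrite lte_mul_pinfty// ge0_fin_numE.
Qed.

HB.instance Definition _ := Measure_isSigmaFinite.Build _ _ _
  tuple_lebesgue_step step_sigma_finite.

End step.

Fixpoint tuple_lebesgue n : {sigma_finite_measure set (n.-tuple R) -> \bar R} :=
  match n with
  | 0 => [the {sigma_finite_measure set (0.-tuple R) -> \bar R} of
            \d_ ([tuple] : 0.-tuple R)]
  | n'.+1 => [the {sigma_finite_measure set (n'.+1.-tuple R) -> \bar R} of
            tuple_lebesgue_step (tuple_lebesgue n')]
  end.

End tuple_lebesgue.

Section rV_lebesgue.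
Context {R : realType} {n : nat}.

Let T := caratheodory_type (mu_ext (@tuple_lebesgue R n)).

Definition rV_of_tuple (t : T) : 'rV[R]_n := \row_i tnth (t : n.-tuple R) i.

Definition rV_measurable : set (set 'rV[R]_n) :=
  [set A | measurable (rV_of_tuple @^-1` A)].

Let rV_measurable0 : rV_measurable set0.
Proof. by rewrite /rV_measurable /= preimage_set0. Qed.

Let rV_measurableC A : rV_measurable A -> rV_measurable (~` A).
Proof. by rewrite /rV_measurable /= preimage_setC; exact: measurableC. Qed.

Let rV_measurable_bigcup (F : (set 'rV[R]_n)^nat) :
  (forall i, rV_measurable (F i)) -> rV_measurable (\bigcup_i (F i)).
Proof.
by move=> mF; rewrite /rV_measurable /= preimage_bigcup; exact: bigcupT_measurable.
Qed.

HB.instance Definition _ := @isMeasurable.Build default_measure_display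
  'rV[R]_n rV_measurable rV_measurable0 rV_measurableC rV_measurable_bigcup.

Lemma measurable_rV_of_tuple : measurable_fun setT rV_of_tuple.
Proof. by move=> _ A mA; rewrite setTI. Qed.

Definition rV_lebesgue : set 'rV[R]_n -> \bar R :=
  pushforward (@completed_measure_extension _ _ _ (@tuple_lebesgue R n)) rV_of_tuple.

Let rV_lebesgueM :=
  measure_function_pushforward__canonical__measure_function_Measure
    (@completed_measure_extension _ _ _ (@tuple_lebesgue R n)) measurable_rV_of_tuple.

Let rV_lebesgue0 : rV_lebesgue set0 = 0%E.
Proof. exact: (measure0 rV_lebesgueM). Qed.

Let rV_lebesgue_ge0 A : (0 <= rV_lebesgue A)%E.
Proof. exact: (measure_ge0 rV_lebesgueM). Qed.

Let rV_lebesgue_sigma_additive : semi_sigma_additive rV_lebesgue.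
Proof. exact: (@measure_semi_sigma_additive _ _ _ rV_lebesgueM). Qed.

HB.instance Definition _ := isMeasure.Build _ _ _ rV_lebesgue
  rV_lebesgue0 rV_lebesgue_ge0 rV_lebesgue_sigma_additive.

End rV_lebesgue.

(** Sanity check on [rV_lebesgue]: boxes have the expected volume. *)

Lemma measurable_tuple_box {R : realType} n (A : 'I_n -> set R) :
  (forall i, measurable (A i)) ->
  measurable [set t : n.-tuple R | forall i, A i (tnth t i)].
Proof.
move=> mA; rewrite (_ : [set _ | _] =
    \big[setI/setT]_(i < n) ((fun t : n.-tuple R => tnth t i) @^-1` A i)).
  apply: bigsetI_measurable => i _; rewrite -[X in measurable X]setTI.
  by apply: measurable_tnth => //; exact: mA.
apply/seteqP; split => [t /= h|t]; first by rewrite -bigcap_seq => i _; exact: h.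
by rewrite -bigcap_seq => h i; apply: h => /=; rewrite mem_index_enum.
Qed.

Lemma tuple_lebesgue_box {R : realType} n (A : 'I_n -> set R) :
  (forall i, measurable (A i)) ->
  tuple_lebesgue n [set t : n.-tuple R | forall i, A i (tnth t i)] =
  (\prod_(i < n) lebesgue_measure (A i : set (measurableTypeR R)))%E.
Proof.
elim: n A => [|n IH] A mA.
  by rewrite big_ord0 /= diracE mem_set //= => -[].
rewrite /= /tuple_lebesgue_step /pushforward (_ : _ @^-1` _ =
  A ord0 `*` [set t : n.-tuple R | forall i, A (lift ord0 i) (tnth t i)]).
  have mA' : measurable
      [set t : n.-tuple R | forall i, A (lift ord0 i) (tnth t i)].
    exact: (measurable_tuple_box (A := fun i => A (lift ord0 i))).
  rewrite product_measure1E //; last exact: mA.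
  rewrite big_ord_recl /=; congr (_ * _)%E.
  exact: (IH (fun i => A (lift ord0 i))).
apply/seteqP; split => [[x t] /= h|[x t] [/= h0 h] i].
  split => [|i /=]; first exact: (h ord0).
  by have := h (lift ord0 i); rewrite tnthS.
by case: (unliftP ord0 i) => [j ->|->] //=; rewrite tnthS.
Qed.

Lemma rV_lebesgue_box {R : realType} n (A : 'I_n -> set R) :
  (forall i, measurable (A i)) ->
  measurable [set v : 'rV[R]_n | forall i, A i (v ord0 i)] /\
  rV_lebesgue [set v : 'rV[R]_n | forall i, A i (v ord0 i)] =
  (\prod_(i < n) lebesgue_measure (A i : set (measurableTypeR R)))%E.
Proof.
move=> mA; have mB := measurable_tuple_box mA.
have P : rV_of_tuple @^-1` [set v : 'rV[R]_n | forall i, A i (v ord0 i)] =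
    [set t : n.-tuple R | forall i, A i (tnth t i)].
  by apply/seteqP; split => t /= h i; have := h i; rewrite mxE.
split.
  rewrite /measurable /= /rV_measurable /= P.
  exact: caratheodory_measurable_mu_ext.
rewrite /rV_lebesgue /pushforward P /completed_measure_extension.
by rewrite measurable_mu_extE //; exact: tuple_lebesgue_box.
Qed.

(** * Function spaces on an open set

   A function on [Om] is represented by a total function ['rV[R]_n -> R] whose
   values outside [Om] are irrelevant. *)

Section function_spaces.
Context {R : realType} {n : nat}.
Implicit Types (Om : set 'rV[R]_n) (f g v phi : 'rV[R]_n -> R).

Definition Lp Om (r : R) f : Prop :=
  measurable_fun Om f /\ finite_norm rV_lebesgue r%:E (f \_ Om).

Definition weakLp Om (t : R) f : Prop :=
  measurable_fun Om f /\
  exists2 k : R, 0 < k & forall tau : R, 0 < tau ->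
    (rV_lebesgue [set x | Om x /\ (tau < `|f x|)%R] <= (k / tau `^ t)%:E)%E.

Definition L1loc Om f : Prop :=
  measurable_fun Om f /\
  forall K, compact K -> K `<=` Om ->
    (\int[rV_lebesgue]_(x in K) `|f x|%:E < +oo)%E.

Definition partial (k : 'I_n) f : 'rV[R]_n -> R :=
  fun x => 'D_(delta_mx 0 k) f x.

Definition iter_partial (s : seq 'I_n) f : 'rV[R]_n -> R := foldr partial f s.

Definition smooth f : Prop :=
  forall s : seq 'I_n, continuous (iter_partial s f) /\
    forall k x, derivable (iter_partial s f) x (delta_mx 0 k).

Definition support_of f : set 'rV[R]_n := closure [set x | f x != 0].

Definition test_fun Om phi : Prop :=
  [/\ smooth phi, compact (support_of phi) & support_of phi `<=` Om].

Definition is_weak_partial Om (k : 'I_n) v g : Prop :=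
  L1loc Om g /\
  forall phi, test_fun Om phi ->
    \int[rV_lebesgue]_(x in Om) (v x * partial k phi x) =
    - \int[rV_lebesgue]_(x in Om) (g x * phi x).

(* A representative of the weak derivative, which is unique up to a null set;
   it is only meaningful when a weak derivative exists, as ensured by [W11]. *)
Definition weakD Om (k : 'I_n) v : 'rV[R]_n -> R :=
  xget (fun=> 0) [set g | is_weak_partial Om k v g].

Definition weak_grad Om v (x : 'rV[R]_n) : 'rV[R]_n := \row_k weakD Om k v x.

Definition W11 Om v : Prop :=
  Lp Om 1 v /\
  forall k, (exists g, is_weak_partial Om k v g) /\ Lp Om 1 (weakD Om k v).

(* The closure of the test functions in the norm of [W11]. *)
Definition W11_0 Om v : Prop :=
  W11 Om v /\
  exists phi : nat -> 'rV[R]_n -> R,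
    [/\ forall j, test_fun Om (phi j),
        (\int[rV_lebesgue]_(x in Om) `|phi j x - v x|%:E)%E
          @[j --> \oo] --> 0%E &
        forall k, (\int[rV_lebesgue]_(x in Om)
          `|partial k (phi j) x - weakD Om k v x|%:E)%E @[j --> \oo] --> 0%E].

(* Only the derivatives, not the function, are required to be in [L^r]. *)
Definition W1 Om (r : R) v : Prop :=
  W11 Om v /\ forall k, Lp Om r (weakD Om k v).

Definition W1_0 Om (r : R) v : Prop :=
  W11_0 Om v /\ forall k, Lp Om r (weakD Om k v).

Definition caratheodory_fun Om (b : 'rV[R]_n -> 'rV[R]_n -> R) : Prop :=
  (forall z, measurable_fun Om (b ^~ z)) /\
  {ae rV_lebesgue, forall x, Om x -> continuous (b x)}.

Definition is_solution Om (p : R) (a : 'I_n -> 'rV[R]_n -> 'rV[R]_n -> R)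
    (f : 'I_n -> 'rV[R]_n -> R) (theta u : 'rV[R]_n -> R) : Prop :=
  W1_0 Om p (u \- theta) /\
  forall phi, W1_0 Om p phi ->
    \int[rV_lebesgue]_(x in Om)
      (\sum_i a i x (weak_grad Om u x) * weakD Om i phi x) =
    \int[rV_lebesgue]_(x in Om) (\sum_i f i x * weakD Om i phi x).

End function_spaces.

(* Main.v *)
Require Import Defs.
From mathcomp Require Import all_boot all_order all_algebra.
From mathcomp Require Import all_classical all_reals all_analysis.
From mathcomp Require Import measurable_realfun.
From mathcomp Require Import ring lra.

Set Implicit Arguments.
Unset Strict Implicit.
Unset Printing Implicit Defensive.

Import Order.TTheory GRing.Theory Num.Theory.
Import numFieldNormedType.Exports.

Local Open Scope classical_set_scope.
Local Open Scope ring_scope.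

(** Put [v = u - theta] and let [alpha L] be the measure of the part of [Om]
    where [|v| > L].  The claim is that [alpha L] is at most a constant times
    [L ^ -t], and it follows from three estimates.

    Energy.  The equation is tested with [excess L v], where [excess L] is a
    smooth function which vanishes on [[-L, L]] and whose derivative
    [dexcess L] is nonnegative and bounded independently of [L].  With
    [gam = dexcess L v], monotonicity, growth and the Young inequality give
    pointwise
    [nu / 2 * gam * sum |D_i v|^p <= P - Q + C * gam * X], where [P] and [Q]
    are the integrands of the two sides of the equation and
    [X = |h| + sum |D_i theta|^p + sum |f^i|^(p/(p-1))] is in [L^(q/p)].  As
    [gam] lives on the set where [|v| > L], integrating and distributing the
    powers at the height [K = alpha L ^ (-1/q)] yields
    [int gam |D_k v| <= C * alpha L ^ (1 - 1/q)] ([excess_energy]).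

    Sobolev.  Only the weak-type inequality for exponent 1 is used.  If a test
    function is at least [lam] in absolute value at a point, then its [i]-th
    partial derivative has absolute integral at least [lam] on the line through
    that point in direction [i].  A set all of whose points have this property
    in all [n] directions is small: this is a Loomis-Whitney inequality, proved
    by induction on the dimension with Tonelli and the inequality of arithmetic
    and geometric means ([weak_loomis_whitney], [weak_sobolev]).  Where
    [|v| >= 2 L] one has [|excess L v| >= L / e]; approximating [excess L v] by
    test functions and inserting the energy estimate gives
    [alpha (2 L) <= C * (alpha L ^ (1 - 1/q) / L) ^ (n/(n-1))]
    ([truncated_sobolev]).

    Iteration.  The exponent [b = (1 - 1/q) * n/(n-1)] is less than 1 because
    [q < n], and [t * (1 - b) = n/(n-1)], so that the last inequality says that
    [L ^ t * alpha L] stays bounded when [L] is doubled ([stampacchia]).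

    The rest is the calculus of weak derivatives needed to use [excess L v] as
    a test function: weak derivatives are unique almost everywhere
    ([test_orthogonal_ae0]) and the chain rule holds in the closure of the test
    functions ([chain_rule_weakD]). *)

(** * Flat functions of one variable *)

Section flat.
Context {R : realType}.
Implicit Types (P : {poly R}) (x y : R).

(** The functions [P(1/x) exp(-1/x)], extended by 0: a family of bounded functions
    which is closed under differentiation and contains the usual building block
    of bump functions (for [P = 1]).  Smoothness of everything built from it is
    thereby reduced to first derivatives. *)
Definition flat P (x : R) : R := if 0 < x then P.[x^-1] * expR (- x^-1) else 0.

Lemma flat_pos P x : 0 < x -> flat P x = P.[x^-1] * expR (- x^-1).
Proof. by rewrite /flat => ->. Qed.

Lemma flat_npos P x : x <= 0 -> flat P x = 0.
Proof. by rewrite /flat leNgt => /negbTE ->. Qed.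

(** The power series of the exponential dominates every monomial. *)
Lemma flat_bounded P : exists2 C : R, 0 < C & forall x, `|flat P x| <= C.
Proof.
suff [C C0 CP] : exists2 C : R, 0 < C &
    forall y, 0 < y -> `|P.[y] * expR (- y)| <= C.
  exists C => // x; have [x0|x0] := ltP 0 x; last by rewrite flat_npos// normr0 ltW.
  by rewrite flat_pos// CP// invr_gt0.
(* Since [y ^ i <= i! * exp y <= (i + 1)! * exp y]. *)
exists (1 + \sum_(i < size P) `|P`_i| * i.+1`!%:R) => [|y y0].
  by rewrite ltr_pwDl// sumr_ge0// => i _; rewrite mulr_ge0.
rewrite horner_coef big_distrl/= (le_trans (ler_norm_sum _ _ _))//.
rewrite -[leLHS]add0r lerD// ler_sum// => i _.
rewrite -mulrA normrM ler_wpM2l//.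
rewrite ger0_norm ?mulr_ge0 ?exprn_ge0 ?expR_ge0 ?(ltW y0)//.
rewrite expRN ler_pdivrMr ?expR_gt0//.
case: (nat_of_ord i) => [|k].
  rewrite expr0 mul1r; apply: le_trans (expR_ge1Dx _); rewrite lerDl ltW//.
have := expR_ge1Dxn k (ltW y0).
rewrite -(ler_pM2l (_ : 0 < k.+2`!%:R :> R)) ?ltr0n ?fact_gt0//.
apply: le_trans.
rewrite mulrDr mulr1 -[leLHS]add0r lerD// mulrCA.
rewrite -[leLHS]mulr1 ler_wpM2l ?exprn_ge0 ?(ltW y0)//.
by rewrite ler_pdivlMr ?ltr0n ?fact_gt0// mul1r ler_nat factS leq_pmull.
Qed.

(** By the chain rule at [1/x], [flat P] has derivative [flat (flatD P)]. *)
Definition flatD P : {poly R} := (P - P^`()) * 'X^2.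

(** The only delicate point is 0: there [flat P h = h ^ 2 * flat (P * 'X^2) h],
    and the last factor is bounded. *)
Lemma is_derive_flat P x : is_derive x 1 (flat P) (flat (flatD P) x).
Proof.
have [x0|x0|->] := ltgtP x 0.
- rewrite flat_npos 1?ltW//.
  apply: (@near_eq_is_derive _ _ _ (cst 0)).
  near=> y; rewrite flat_npos// ltW//; near: y; exact: lt_nbhsl.
- apply: (@near_eq_is_derive _ _ _ (fun x => P.[x^-1] * expR (- x^-1))).
  + near=> y; rewrite flat_pos//; near: y; exact: lt_nbhsr.
  have xn0 : x != 0 by rewrite gt_eqF.
  have dV : is_derive x (1 : R) (fun y : R => y^-1) (- x^-2).
    by apply: is_derive_eq; first exact: is_deriveV; rewrite /GRing.scale /= mulr1.
  have dP : is_derive x (1 : R) (fun y => P.[y^-1]) (P^`().[x^-1] * - x^-2).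
    by have := @is_derive1_comp _ (horner P) (fun y => y^-1) x _ _ (is_derive_poly _ _) dV.
  have dE : is_derive x (1 : R) (fun y => expR (- y^-1)) (expR (- x^-1) * x^-2).
    have := @is_derive1_comp _ expR (fun y => - y^-1) x _ _ (is_derive_expR _) (is_deriveN dV).
    by rewrite opprK.
  apply: (@is_derive_eq _ _ _ _ _ _ _ _ (is_deriveM dP dE)).
  rewrite flat_pos// /flatD !hornerE /GRing.scale /= -exprVn.
  by ring.
- rewrite flat_npos//; have [C C0 CP] := flat_bounded (P * 'X^2).
  have lim : h^-1 *: (flat P (h + 0) - flat P 0) @[h --> (0:R)^'] --> (0 : R).
    apply/cvgr0Pnorm_le => e e0; near=> h.
    rewrite addr0 (@flat_npos P 0)// subr0.
    have [h0|h0] := ltP 0 h; last by rewrite flat_npos// scaler0 normr0 ltW.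
    have -> : flat P h = h ^+ 2 * flat (P * 'X^2) h.
      rewrite !flat_pos// !hornerE.
      have h0' : h != 0 by rewrite gt_eqF.
      move: (P.[h^-1]) (expR _) => u w /=.
      by field.
    rewrite /GRing.scale /= (expr2 h) -mulrA mulKf ?gt_eqF// normrM.
    have : `|h| < e / C by near: h; apply: dnbhs0_lt; rewrite divr_gt0.
    rewrite ltr_pdivlMr// => /ltW; apply: le_trans.
    by rewrite ler_wpM2l.
  have lim' : h^-1 *: (flat P (h *: 1 + 0) - flat P 0) @[h --> (0:R)^'] --> (0 : R).
    by move: lim; under eq_fun do rewrite -[X in flat P (X + 0)]mulr1.
  apply: DeriveDef; last exact/cvg_lim.
  by apply/cvg_ex; exists 0.
Unshelve. all: by end_near. Qed.

Lemma flat_lipschitz P : exists2 C : R, 0 < C &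
  forall x y, `|flat P x - flat P y| <= C * `|x - y|.
Proof.
have [C C0 CP] := flat_bounded (flatD P); exists C => // x y.
wlog : x y / x <= y => [H|].
  by have [/H//|/ltW/H] := leP x y; rewrite distrC (distrC y).
rewrite le_eqVlt => /predU1P[->|xy]; first by rewrite !subrr normr0 mulr0.
have cf : {within `[x, y], continuous (flat P)}.
  apply: continuous_subspaceT => z; apply: differentiable_continuous.
  by apply/derivable1_diffP; have [] := is_derive_flat P z.
have [z _] := MVT xy (fun z _ => is_derive_flat P z) cf.
by rewrite distrC (distrC x) => ->; rewrite normrM ler_wpM2r.
Qed.

End flat.

(** * Smooth functions *)

Section lines.
Context {R : realType} {V : normedModType R}.

(** Directional derivatives are derivatives along lines; in this form the
    one-variable chain rule and fundamental theorem apply to them. *)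
Lemma is_derive_line (f : V -> R) (x v : V) (t d : R) :
  is_derive (t *: v + x) v f d -> is_derive t 1 (fun h => f (h *: v + x)) d.
Proof.
have E h : h^-1 *: (f (h *: v + (t *: v + x)) - f (t *: v + x)) =
    h^-1 *: ((fun h => f (h *: v + x)) (h *: 1 + t) - (fun h => f (h *: v + x)) t).
  by rewrite addrA -scalerDl /GRing.scale /= mulr1.
move=> [dfx Dfx]; apply: DeriveDef.
  by rewrite /derivable; under eq_fun do rewrite -E.
by rewrite -Dfx /derive; under eq_fun do rewrite -E.
Qed.

Lemma line_is_derive (f : V -> R) (x v : V) (d : R) :
  is_derive (0 : R) 1 (fun h => f (h *: v + x)) d -> is_derive x v f d.
Proof.
have E h : h^-1 *: (f (h *: v + x) - f x) =
    h^-1 *: ((fun h => f (h *: v + x)) (h *: 1 + 0) - (fun h => f (h *: v + x)) 0).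
  by rewrite scale0r add0r /GRing.scale /= mulr1 addr0.
move=> [dfx Dfx]; apply: DeriveDef.
  by rewrite /derivable; under eq_fun do rewrite E.
by rewrite -Dfx /derive; under eq_fun do rewrite E.
Qed.

Lemma is_derive_comp1 (g : R -> R) (f : V -> R) (x v : V) (dg df : R) :
  is_derive (f x) 1 g dg -> is_derive x v f df ->
  is_derive x v (fun y => g (f y)) (dg * df).
Proof.
move=> Dg Df; apply: line_is_derive.
have Dl : is_derive (0 : R) 1 (fun h => f (h *: v + x)) df.
  by apply: is_derive_line; rewrite scale0r add0r.
have Dg' : is_derive (f (0 *: v + x)) 1 g dg by rewrite scale0r add0r.
exact: (is_derive1_comp Dg' Dl).
Qed.

End lines.

Section smooth_calculus.
Context {R : realType} {n : nat}.
Local Notation V := 'rV[R]_n.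
Implicit Types (f g : V -> R) (k : nat) (i j : 'I_n).

Local Notation "''e_' i" := (delta_mx 0 i : 'rV[R]_n) (at level 8, i at level 2).

(** [smooth] quantifies over lists of directions, which is awkward for products and
    compositions; the recursion on the order of differentiation makes both
    inductions straightforward, see [smoothP]. *)
Fixpoint Ck k f : Prop :=
  if k is k'.+1 then
    continuous f /\
    forall i, (forall x, derivable f x 'e_i) /\ Ck k' (partial i f)
  else continuous f.

Lemma iter_partial_rcons s i f :
  iter_partial (rcons s i) f = iter_partial s (partial i f).
Proof. exact: foldr_rcons. Qed.

Lemma smooth_partial i f : smooth f -> smooth (partial i f).
Proof. by move=> sf s; rewrite -iter_partial_rcons; exact: sf. Qed.

Lemma smoothP f : smooth f <-> forall k, Ck k f.
Proof.
split=> [sf k|Cf s].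
  elim: k f sf => [|k IH] f sf /=; first by have [] := sf [::].
  split=> [|i]; first by have [] := sf [::].
  split=> [x|]; first by have [_] := sf [::]; exact.
  exact/IH/smooth_partial.
elim/last_ind: s f Cf => [|s i IH] f Cf /=.
  by split; [exact: (Cf 0%N)|move=> k x; have [_ /(_ k)[]] := Cf 1%N].
rewrite iter_partial_rcons; apply: IH => k.
by have [_ /(_ i)[]] := Cf k.+1.
Qed.

Lemma CkW k f : Ck k.+1 f -> Ck k f.
Proof.
elim: k f => [|k IH] f /=; first by case.
move=> [cf Df]; split=> // i; have [dfi Cfi] := Df i.
by split=> //; exact: IH.
Qed.

Lemma Ck_cst k (c : R) : Ck k (fun=> c).
Proof.
elim: k c => [|k IH] c /=; first exact: cst_continuous.
split=> [|i]; first exact: cst_continuous.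
split=> [x|]; first exact: derivable_cst.
rewrite (_ : partial i _ = fun=> 0); first exact: IH.
by apply/funext => x; rewrite /partial derive_cst.
Qed.

Lemma CkD k f g : Ck k f -> Ck k g -> Ck k (fun x => f x + g x).
Proof.
elim: k f g => [|k IH] f g /=.
  by move=> cf cg x; exact: (@continuousD _ _ _ f g x (cf x) (cg x)).
move=> [cf Df] [cg Dg]; split=> [x|i]; first exact: (@continuousD _ _ _ f g x (cf x) (cg x)).
have [dfi Cfi] := Df i; have [dgi Cgi] := Dg i.
split=> [x|]; first exact: (derivableD (dfi x) (dgi x)).
rewrite (_ : partial i _ = fun x => partial i f x + partial i g x); first exact: IH.
by apply/funext => x; exact: (deriveD (dfi x) (dgi x)).
Qed.

Lemma CkM k f g : Ck k f -> Ck k g -> Ck k (fun x => f x * g x).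
Proof.
elim: k f g => [|k IH] f g.
  by move=> /= cf cg x; exact: (@continuousM _ _ f g x (cf x) (cg x)).
move=> Cf Cg; have [/= cf Df] := Cf; have [cg Dg] := Cg.
split=> [x|i]; first exact: (@continuousM _ _ f g x (cf x) (cg x)).
have [dfi Cfi] := Df i; have [dgi Cgi] := Dg i.
split=> [x|]; first exact: (derivableM (dfi x) (dgi x)).
rewrite (_ : partial i _ = fun x => f x * partial i g x + g x * partial i f x).
  apply: CkD; apply: IH => //; exact: CkW.
by apply/funext => x; exact: (deriveM (dfi x) (dgi x)).
Qed.

Lemma partialM i f g x : derivable f x 'e_i -> derivable g x 'e_i ->
  partial i (fun x => f x * g x) x = f x * partial i g x + g x * partial i f x.
Proof. by move=> df dg; exact: (deriveM df dg). Qed.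

(** A set of functions closed under differentiation consists of smooth functions;
    the set is carried along as it is the invariant of the induction in
    [Ck_comp]. *)
Definition smooth_class (S : set (R -> R)) := forall g : R -> R, S g ->
  exists2 g', S g' & forall x : R, is_derive x 1 g (g' x).

Lemma smooth_class_cont S (g : R -> R) : smooth_class S -> S g -> continuous g.
Proof.
move=> HS /HS[g' _ Dg] x; apply: differentiable_continuous.
by apply/derivable1_diffP; have [] := Dg x.
Qed.

Lemma Ck_comp S k (g : R -> R) f : smooth_class S -> S g -> Ck k f ->
  Ck k (fun x => g (f x)).
Proof.
move=> HS; elim: k g f => [|k IH] g f Sg.
  by move=> cf x; apply: continuous_comp; [exact: cf|exact: (smooth_class_cont HS Sg)].
move=> Cf; have [/= cf Df] := Cf; have [g' Sg' Dg] := HS _ Sg.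
split=> [x|i].
  by apply: continuous_comp; [exact: cf|exact: (smooth_class_cont HS Sg)].
have [dfi Cfi] := Df i.
have D x := is_derive_comp1 (Dg (f x)) (derivableP (dfi x)).
split=> [x|]; first by have [] := D x.
rewrite (_ : partial i _ = fun x => g' (f x) * partial i f x).
  by apply: CkM => //; apply: IH => //; exact: CkW.
by apply/funext => x; have [_] := D x.
Qed.

Lemma smooth_comp S (g : R -> R) f : smooth_class S -> S g -> smooth f ->
  smooth (fun x => g (f x)).
Proof. by move=> HS Sg /smoothP Cf; apply/smoothP => k; exact: (Ck_comp HS Sg). Qed.

Lemma smoothM f g : smooth f -> smooth g -> smooth (fun x => f x * g x).
Proof. by move=> /smoothP Cf /smoothP Cg; apply/smoothP => k; exact: CkM (Cf k) (Cg k). Qed.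

Lemma smooth_cst (c : R) : smooth (fun _ : V => c).
Proof. by apply/smoothP => k; exact: Ck_cst. Qed.

Lemma smooth_prod (I : Type) (s : seq I) (F : I -> V -> R) :
  (forall l, smooth (F l)) -> smooth (fun x => \prod_(l <- s) F l x).
Proof.
move=> sF; elim: s => [|l s IH].
  by under eq_fun do rewrite big_nil; exact: smooth_cst.
by under eq_fun do rewrite big_cons; exact: smoothM.
Qed.

Lemma is_derive_coord i j x : is_derive x 'e_i (fun y : V => y 0 j) ((i == j)%:R).
Proof.
apply: line_is_derive.
rewrite (_ : (fun h => _) = (fun h : R => h * (i == j)%:R + x 0 j)); last first.
  by apply/funext => h; rewrite !mxE eqxx eq_sym.
apply: (@is_derive_eq _ _ _ _ _ _ _ _ (is_deriveD (is_deriveM (is_derive_id _ _) (is_derive_cst _ _ _)) (is_derive_cst _ _ _))).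
by rewrite /GRing.scale /= mulr0 mulr1 add0r addr0.
Qed.

Lemma smooth_coord j : smooth (fun y : V => y 0 j).
Proof.
apply/smoothP => -[|k] /=; first exact: coord_continuous.
split=> [|i]; first exact: coord_continuous.
split=> [x|]; first by have [] := is_derive_coord i j x.
rewrite (_ : partial i _ = fun=> (i == j)%:R); first exact: Ck_cst.
by apply/funext => x; have [_] := is_derive_coord i j x.
Qed.

Lemma smooth_cont f : smooth f -> continuous f.
Proof. by move=> /(_ [::])[]. Qed.

Lemma smooth_derivable f i x : smooth f -> derivable f x 'e_i.
Proof. by move=> /(_ [::])[_]; exact. Qed.

Lemma smooth_partial_cont f i : smooth f -> continuous (partial i f).
Proof. by move=> /smooth_partial/smooth_cont; exact. Qed.

Lemma support_out f x : ~ support_of f x -> f x = 0.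
Proof. by move=> nfx; apply: contra_notP nfx => /eqP fx; exact: subset_closure. Qed.

Lemma support_le f g : (forall x, g x = 0 -> f x = 0) ->
  support_of f `<=` support_of g.
Proof.
move=> fg; apply: closure_subset => x /= fx; apply: contraNN fx => /eqP/fg ->.
by rewrite eqxx.
Qed.

(** The form in which all test functions below arise: smoothness is checked
    globally and compact support is inherited from a known test function. *)
Lemma test_fun_le Om f g : smooth f -> test_fun Om g ->
  (forall x, g x = 0 -> f x = 0) -> test_fun Om f.
Proof.
move=> sf [sg cg sub] fg; split => //.
  apply: subclosed_compact cg _; [exact: closed_closure|exact: support_le].
exact: subset_trans (support_le fg) sub.
Qed.

Lemma test_funM Om f g : smooth f -> test_fun Om g ->
  test_fun Om (fun x => f x * g x).
Proof.
move=> sf tg; apply: test_fun_le (tg) _ => [|x ->]; last by rewrite mulr0.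
by apply: smoothM => //; case: tg.
Qed.

Lemma partial_out f i x : ~ support_of f x -> partial i f x = 0.
Proof.
move=> nfx; rewrite /partial.
rewrite (@near_eq_derive _ _ _ f (cst 0)) ?derive_cst//.
have : open (~` support_of f) by apply: closed_openC; exact: closed_closure.
rewrite openE => /(_ _ nfx); apply: filterS => y; exact: support_out.
Qed.

End smooth_calculus.

(** * The truncation functions and bump functions on boxes *)

Section flat_class.
Context {R : realType}.

(** Combinations of two rescaled flat functions: enough for [excess] and for the
    factors of [box_bump], and closed under differentiation. *)
Definition flat_class : set (R -> R) := [set g |
  exists c P a b c' P' a' b',
    g = fun x => c * flat P (a * x + b) + c' * flat P' (a' * x + b')].

Lemma is_derive_flat_affine (c : R) P (a b x : R) :
  is_derive x 1 (fun x => c * flat P (a * x + b)) ((c * a) * flat (flatD P) (a * x + b)).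
Proof.
have Da : is_derive x (1:R) (fun x => a * x + b) a.
  apply: (@is_derive_eq _ _ _ _ _ _ _ _
    (is_deriveD (is_deriveM (is_derive_cst a _ _) (is_derive_id _ _)) (is_derive_cst b _ _))).
  by rewrite /GRing.scale /= mulr0 mulr1 !addr0.
have Dc : is_derive x (1 : R) (fun x => flat P (a * x + b)) (flat (flatD P) (a * x + b) * a) :=
  (@is_derive1_comp _ (flat P) (fun x => a * x + b) x _ _ (is_derive_flat P (a * x + b)) Da).
have := is_deriveM (is_derive_cst c x 1) Dc.
rewrite /GRing.scale /= mulr0 addr0 (mulrC _ a) mulrA; exact.
Qed.

Lemma smooth_flat_class : smooth_class flat_class.
Proof.
move=> _ [c [P [a [b [c' [P' [a' [b' ->]]]]]]]].
exists (fun x => (c * a) * flat (flatD P) (a * x + b) +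
   (c' * a') * flat (flatD P') (a' * x + b')).
  by do 8 eexists; reflexivity.
by move=> x; exact: (is_deriveD (is_derive_flat_affine _ _ _ _ _) (is_derive_flat_affine _ _ _ _ _)).
Qed.

Lemma flat_class_bounded g : flat_class g ->
  exists2 C, 0 < C & forall x, `|g x| <= C.
Proof.
move=> [c [P [a [b [c' [P' [a' [b' ->]]]]]]]].
have [C C0 CP] := flat_bounded P; have [C' C'0 CP'] := flat_bounded P'.
exists (`|c| * C + `|c'| * C' + 1) => [|x]; first by rewrite ltr_wpDl// addr_ge0// mulr_ge0// ltW.
rewrite (le_trans (ler_normD _ _))// -[leLHS]addr0 !normrM lerD//.
by rewrite lerD// ler_wpM2l.
Qed.

Lemma flat_class_lipschitz g : flat_class g ->
  exists2 C, 0 < C & forall x y, `|g x - g y| <= C * `|x - y|.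
Proof.
move=> [c [P [a [b [c' [P' [a' [b' ->]]]]]]]].
have [C C0 CP] := flat_lipschitz P; have [C' C'0 CP'] := flat_lipschitz P'.
exists (`|c| * C * `|a| + `|c'| * C' * `|a'| + 1) => [|x y].
  by rewrite ltr_wpDl// addr_ge0// !mulr_ge0// ltW.
rewrite opprD addrACA -!mulrBr (le_trans (ler_normD _ _))// mulrDl mul1r.
rewrite -[leLHS]addr0 lerD// mulrDl !normrM lerD// -!mulrA ler_wpM2l// -normrM.
  rewrite (_ : a * (x - y) = (a * x + b) - (a * y + b)); first exact: CP.
  by rewrite mulrBr opprD addrACA subrr addr0.
rewrite (_ : a' * (x - y) = (a' * x + b') - (a' * y + b')); first exact: CP'.
by rewrite mulrBr opprD addrACA subrr addr0.
Qed.

(** A smooth substitute for the function sending [s] to the part of [s] beyond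
    [[-L, L]]; scaling by [L] makes the bounds on the derivative independent of
    [L].  A smooth truncation, unlike the piecewise linear one, maps test
    functions to test functions. *)
Definition excess (L : R) : R -> R := fun s =>
  L * flat 1 (L^-1 * s + -1) + (- L) * flat 1 (- L^-1 * s + -1).

Definition dexcess (L : R) : R -> R := fun s =>
  flat (flatD 1) (L^-1 * s + -1) + flat (flatD 1) (- L^-1 * s + -1).

Lemma excess_class L : flat_class (excess L).
Proof. by do 8 eexists; reflexivity. Qed.

Lemma dexcess_class L : flat_class (dexcess L).
Proof.
rewrite (_ : dexcess L = fun s => 1 * flat (flatD 1) (L^-1 * s + -1) +
  1 * flat (flatD 1) (- L^-1 * s + -1)); first by do 8 eexists; reflexivity.
by apply/funext => s; rewrite !mul1r.
Qed.

Lemma is_derive_excess L (s : R) : L != 0 -> is_derive s 1 (excess L) (dexcess L s).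
Proof.
move=> L0; apply: (@is_derive_eq _ _ _ _ _ _ _ _ (is_deriveD (is_derive_flat_affine _ _ _ _ _)
  (is_derive_flat_affine _ _ _ _ _))).
by rewrite mulrNN divff// !mul1r.
Qed.

Lemma excess0 L : excess L 0 = 0.
Proof. by rewrite /excess !mulr0 !flat_npos ?add0r ?lerN10// !mulr0 addr0. Qed.

Lemma flatD1_ge0 (x : R) : 0 <= flat (flatD 1) x.
Proof.
rewrite /flat; case: ifP => // x0; rewrite mulr_ge0 ?expR_ge0//.
by rewrite /flatD derivC subr0 mul1r hornerXn exprn_ge0// invr_ge0 ltW.
Qed.

Lemma dexcess_ge0 L s : 0 <= dexcess L s.
Proof. by rewrite addr_ge0// flatD1_ge0. Qed.

Lemma dexcess_bounded : exists2 M : R, 0 < M & forall L s, dexcess L s <= M.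
Proof.
have [C C0 CP] := flat_bounded (flatD (1 : {poly R})).
exists (C + C) => [|L s]; first by rewrite addr_gt0.
by rewrite lerD// (le_trans (ler_norm _))// CP.
Qed.

Lemma dexcess_small L s : 0 < L -> `|s| <= L -> dexcess L s = 0.
Proof.
move=> L0; rewrite ler_norml => /andP[sL Ls].
rewrite /dexcess !flat_npos ?addr0// subr_le0 mulrC.
  by rewrite mulrN -mulNr ler_pdivrMr// mul1r lerNl.
by rewrite ler_pdivrMr// mul1r.
Qed.

Lemma flat1_ge (x : R) : 1 <= x -> expR (-1) <= flat 1 x.
Proof.
move=> x1; have x0 : 0 < x by rewrite (lt_le_trans ltr01).
by rewrite flat_pos// hornerC mul1r ler_expR lerN2 invf_le1.
Qed.

(** Beyond [2 L] one of the two flat functions is taken at a point not below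
    1, the other at a negative one. *)
Lemma excess_large L s : 0 < L -> 2 * L <= `|s| -> L * expR (-1) <= `|excess L s|.
Proof.
move=> L0; rewrite ler_normr.
have aux (z : R) : 2 * L <= z -> L * expR (-1) <= L * flat 1 (L^-1 * z + -1) /\
    flat 1 (- L^-1 * z + -1) = 0.
  move=> z2; split.
    by rewrite ler_pM2l// flat1_ge// lerBrDr mulrC ler_pdivlMr.
  rewrite flat_npos// mulNr -opprD oppr_le0 addr_ge0// mulr_ge0 ?invr_ge0 ?ltW//.
  by rewrite (lt_le_trans _ z2)// mulr_gt0.
move=> /orP[/aux[h1 h2]|/aux[]].
  by rewrite /excess h2 mulr0 addr0 (le_trans h1)// ler_norm.
move=> h1 h2; rewrite mulrNN in h2; rewrite mulrN -mulNr in h1.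
by rewrite /excess h2 mulr0 add0r mulNr normrN (le_trans h1)// ler_norm.
Qed.

End flat_class.

Section box_bump.
Context {R : realType} {n : nat}.
Local Notation V := 'rV[R]_n.
Implicit Types (a b x : V).

Definition obox a b : set V := [set x | forall i, `]a 0 i, b 0 i[%classic (x 0 i)].
Definition cbox a b : set V := [set x | forall i, `[a 0 i, b 0 i]%classic (x 0 i)].

Lemma cbox_compact a b : compact (cbox a b).
Proof.
by apply: (rV_compact (A := fun i => `[a 0 i, b 0 i]%classic)) => i; exact: segment_compact.
Qed.

(** A sequence of smooth functions increasing to the indicator function of the
    open box: the only test functions needed to identify a locally integrable
    function. *)
Definition box_bump a b (m : nat) : V -> R := fun x =>
  \prod_i (flat 1 (m.+1%:R * (x 0 i - a 0 i)) * flat 1 (m.+1%:R * (b 0 i - x 0 i))).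

Lemma smooth_box_bump a b m : smooth (box_bump a b m).
Proof.
apply: smooth_prod => i.
have key (c d : R) : smooth (fun x : V => flat 1 (c * x 0 i + d)).
  apply: (smooth_comp smooth_flat_class (g := fun y => flat 1 (c * y + d)) _ (smooth_coord i)).
  exists 1, 1, c, d, 0, 0, 0, 0; apply/funext => y.
  by rewrite mul1r mul0r addr0.
apply: smoothM.
  have := key m.+1%:R (- (m.+1%:R * a 0 i)).
  by under eq_fun do rewrite -mulrBr.
have := key (- m.+1%:R) (m.+1%:R * b 0 i).
by under eq_fun do rewrite mulNr addrC -mulrBr.
Qed.

Lemma flat1_ge0 (x : R) : 0 <= flat 1 x.
Proof. by rewrite /flat; case: ifP => // _; rewrite hornerC mul1r expR_ge0. Qed.

Lemma flat1_le1 (x : R) : flat 1 x <= 1.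
Proof.
rewrite /flat; case: ifP => // x0.
by rewrite hornerC mul1r expR_le1 oppr_le0 invr_ge0 ltW.
Qed.

Lemma box_bump_ge0 a b m x : 0 <= box_bump a b m x.
Proof. by apply: prodr_ge0 => i _; rewrite mulr_ge0// flat1_ge0. Qed.

Lemma box_bump_le1 a b m x : box_bump a b m x <= 1.
Proof.
apply: prodr_ile1 => i _.
by rewrite mulr_ge0 ?flat1_ge0//= mulr_ile1 ?flat1_ge0 ?flat1_le1.
Qed.

Lemma box_bump_out a b m x : ~ obox a b x -> box_bump a b m x = 0.
Proof.
move=> /existsNP[i]; rewrite /= in_itv/= => /negP; rewrite negb_and -!leNgt => xi.
rewrite /box_bump (bigD1 i)//=; case/orP: xi => xi.
  by rewrite (flat_npos _ (_ : m.+1%:R * (x 0 i - a 0 i) <= 0)) ?mul0r// mulr_ge0_le0// subr_le0.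
by rewrite (flat_npos _ (_ : m.+1%:R * (b 0 i - x 0 i) <= 0)) ?mulr0 ?mul0r// mulr_ge0_le0// subr_le0.
Qed.

Lemma cvg_flat1 (c : R) : 0 < c -> flat 1 (m.+1%:R * c) @[m --> \oo] --> (1 : R).
Proof.
move=> c0.
under eq_fun do rewrite flat_pos ?mulr_gt0// hornerC mul1r invfM.
suff : expR (- (m.+1%:R^-1 * c^-1)) @[m --> \oo] --> expR (- (0 * c^-1)).
  by rewrite mul0r oppr0 expR0.
have H : - (m.+1%:R^-1 * c^-1) @[m --> \oo] --> - (0 * c^-1 : R).
  by apply: cvgN; apply: cvgMl; exact: cvg_harmonic.
apply: cvg_comp; [exact: H|exact: continuous_expR].
Qed.

Lemma cvg_box_bump a b x : obox a b x -> box_bump a b m x @[m --> \oo] --> (1 : R).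
Proof.
move=> xab; rewrite /box_bump; elim: (index_enum _) => [|i s IH].
  by under eq_fun do rewrite big_nil; exact: cvg_cst.
under eq_fun do rewrite big_cons.
have := xab i; rewrite /= in_itv/= => /andP[ax xb].
have xa0 : 0 < x 0 i - a 0 i by rewrite subr_gt0.
have bx0 : 0 < b 0 i - x 0 i by rewrite subr_gt0.
by have := cvgM (cvgM (cvg_flat1 xa0) (cvg_flat1 bx0)) IH; rewrite !mulr1; exact.
Qed.

Lemma closed_cbox a b : closed (cbox a b).
Proof. by apply: compact_closed; [exact: norm_hausdorff|exact: cbox_compact]. Qed.

Lemma obox_sub_cbox a b : obox a b `<=` cbox a b.
Proof. by move=> x xab i; apply: subset_itv_oo_cc; exact: xab. Qed.

Lemma test_fun_box_bump Om a b m : cbox a b `<=` Om -> test_fun Om (box_bump a b m).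
Proof.
move=> abOm; have sup : support_of (box_bump a b m) `<=` cbox a b.
  rewrite /support_of closureE; apply: smallest_sub; first exact: closed_cbox.
  move=> x /= bx; apply: obox_sub_cbox; apply: contraPP bx => nx; apply/negP.
  by rewrite negbK box_bump_out.
split; first exact: smooth_box_bump.
  by apply: (@subclosed_compact _ _ (cbox a b)); [exact: closed_closure|exact: cbox_compact|].
exact: subset_trans sup abOm.
Qed.

End box_bump.

(** * Lebesgue measure on row vectors *)

Lemma open_itvoy {R : realType} (x : R) : open `]x, +oo[%classic.
Proof. by rewrite set_itvE; exact: open_gt. Qed.

Section rV_measure.
Context {R : realType} {n : nat}.
Local Notation V := 'rV[R]_n.
Local Notation mu := (@rV_lebesgue R n).
Local Notation tmu := (tuple_lebesgue n : set (n.-tuple R) -> \bar R).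

(** Integrals over row vectors are computed on tuples, where Tonelli is available.
    The measurable sets of row vectors are the completion of those of tuples:
    measurability on the tuple side is the stronger (Borel) notion. *)
Definition rV_tuple (t : n.-tuple R) : V := rV_of_tuple t.

Definition tuple_rV (x : V) : n.-tuple R := [tuple x 0 i | i < n].

Lemma rV_tupleE t i : rV_tuple t 0 i = tnth t i.
Proof. by rewrite mxE. Qed.

Lemma tuple_rVK : cancel tuple_rV rV_tuple.
Proof. by move=> x; apply/rowP => i; rewrite mxE tnth_mktuple. Qed.

Lemma rV_tupleK : cancel rV_tuple tuple_rV.
Proof. by move=> t; apply/eq_from_tnth => i; rewrite tnth_mktuple mxE. Qed.

Lemma rV_ball (x : V) e : ball x e = [set y | 0 < e /\ forall i, `|x 0 i - y 0 i| < e].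
Proof.
apply/seteqP; split => y.
  case=> e0 xy; split => // i; exact: xy.
by case=> e0 xy; split => // i j; rewrite ord1; exact: xy.
Qed.

(** The cubes with rational centre and radius [1 / (m + 1)] whose closure lies in
    [U] cover [U] by density of the rationals; the enumeration of centres and
    radii is the one of a countable type. *)
Lemma open_bigcup_boxes (U : set V) : open U -> exists (D : set nat) (a b : nat -> V),
  U = \bigcup_(k in D) obox (a k) (b k) /\ forall k, D k -> cbox (a k) (b k) `<=` U.
Proof.
move=> oU.
pose c (k : nat) : V := if @unpickle ('rV[rat]_n * nat)%type k is Some (c, m) then map_mx ratr c else 0.
pose r (k : nat) : R := if @unpickle ('rV[rat]_n * nat)%type k is Some (_, m) then m.+1%:R^-1 else 0.
pose a k : V := \row_i (c k 0 i - r k); pose b k : V := \row_i (c k 0 i + r k).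
exists [set k | cbox (a k) (b k) `<=` U], a, b; split => //.
apply/seteqP; split => [x Ux|x [k abU abx]]; last exact/abU/obox_sub_cbox.
have : nbhs x U by rewrite openE in oU; exact: oU.
rewrite -nbhs_ballE => -[e /= e0 xeU].
have [m m_e] : exists m, (m.+1%:R : R)^-1 < e / 2.
  have e20 : 0 < e / 2 by rewrite divr_gt0.
  by have /cvgrPdist_lt/(_ _ e20)[m _ /(_ m (leqnn m))/=] := @cvg_harmonic R;
    rewrite sub0r normrN gtr0_norm ?invr_gt0 ?ltr0n// => ?; exists m.
set d : R := m.+1%:R^-1 in m_e.
have d0 : 0 < d by rewrite invr_gt0 ltr0n.
have rc i : exists s : rat, x 0 i - d < ratr s < x 0 i + d.
  have [|s] := @rat_in_itvoo R (x 0 i - d) (x 0 i + d).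
    by lra.
  by rewrite in_itv /= => ?; exists s.
pose q : 'rV[rat]_n := \row_i projT1 (cid (rc i)).
have qP i : x 0 i - d < ratr (q 0 i) < x 0 i + d by rewrite mxE; case: cid.
exists (pickle (q, m)).
  move=> y /= yab; apply: xeU; rewrite rV_ball; split => // i.
  have := yab i; have := qP i.
  rewrite /= in_itv /= !mxE /c /r pickleK !mxE -/d ltr_norml => /andP[? ?] /andP[? ?].
  by apply/andP; split; lra.
move=> i /=; have := qP i.
rewrite in_itv /= !mxE /c /r pickleK !mxE -/d => /andP[? ?].
by apply/andP; split; lra.
Qed.

Lemma measurable_tuple_obox (a b : V) : measurable (rV_tuple @^-1` obox a b).
Proof.
rewrite (_ : _ @^-1` _ = [set t | forall i, `]a 0 i, b 0 i[%classic (tnth t i)]).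
  exact: (@measurable_tuple_box R n (fun i => `]a 0 i, b 0 i[%classic)).
by apply/seteqP; split => t /= h i; have := h i; rewrite rV_tupleE.
Qed.

Lemma measurable_tuple_open (U : set V) : open U -> measurable (rV_tuple @^-1` U).
Proof.
move=> /open_bigcup_boxes[D [a [b [-> _]]]]; rewrite preimage_bigcup.
by apply: bigcup_measurable => k _; apply: measurable_tuple_obox.
Qed.

Lemma rV_measurable_tuple (A : set V) :
  measurable (rV_tuple @^-1` A) -> measurable A.
Proof.
move=> mA; rewrite /measurable /= /rV_measurable /=.
exact: (@caratheodory_measurable_mu_ext _ R _ (tuple_lebesgue n) _ mA).
Qed.

Lemma open_rV_measurable (U : set V) : open U -> measurable U.
Proof. by move=> /measurable_tuple_open/rV_measurable_tuple. Qed.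

Lemma closed_rV_measurable (U : set V) : closed U -> measurable U.
Proof.
by move=> /closed_openC/open_rV_measurable/measurableC; rewrite setCK.
Qed.

Lemma compact_rV_measurable (K : set V) : compact K -> measurable K.
Proof.
move=> cK; apply: closed_rV_measurable; apply: compact_closed; last exact: cK.
exact: norm_hausdorff.
Qed.

Lemma continuous_tuple_measurable (f : V -> R) : continuous f ->
  measurable_fun setT (f \o rV_tuple).
Proof.
move=> /continuousP cf.
apply: (measurability _ (RGenOInfty.measurableE R)) => // _ [_ [x ->] <-].
rewrite setTI comp_preimage; exact: (measurable_tuple_open (cf _ (@open_itvoy R x))).
Qed.

Lemma continuous_rV_measurable D (f : V -> R) : continuous f -> measurable_fun D f.
Proof.
move=> /continuousP cf; apply: measurable_funTS.
apply: (measurability _ (RGenOInfty.measurableE R)) => // _ [_ [x ->] <-].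
rewrite setTI; apply/open_rV_measurable/cf; exact: open_itvoy.
Qed.

(** The completed measure is transported twice: along the change of type from
    tuples to row vectors, and along the identity from the completed to the Borel
    sigma-algebra. *)
Lemma ge0_integral_rV_tuple (f : V -> \bar R) : (forall x, 0 <= f x)%E ->
  measurable_fun setT (fun t => f (rV_tuple t)) ->
  (\int[mu]_x f x = \int[tmu]_t f (rV_tuple t))%E.
Proof.
move=> f0 mf.
have mf' : measurable_fun setT f.
  move=> _ A mA; rewrite setTI; apply: rV_measurable_tuple.
  by rewrite -comp_preimage -[X in measurable X]setTI; exact: mf.
have mid : measurable_fun setT
    (fun t : caratheodory_type (mu_ext (@tuple_lebesgue R n)) => (t : n.-tuple R)).
  by move=> _ A mA; rewrite setTI; exact: caratheodory_measurable_mu_ext.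
have E1 := @ge0_integral_pushforward _ _ _ _ R _ (@measurable_rV_of_tuple R n)
  (@completed_measure_extension _ _ _ (@tuple_lebesgue R n)) setT f measurableT mf'
  (fun y _ => f0 y).
have E2 := @ge0_integral_pushforward _ _ _ _ R _ mid
  (@completed_measure_extension _ _ _ (@tuple_lebesgue R n)) setT (fun t => f (rV_tuple t)) measurableT mf
  (fun y _ => f0 _).
rewrite preimage_setT in E1; rewrite preimage_setT in E2.
rewrite [LHS]E1 -[LHS]E2.
apply: eq_measure_integral => A mA _.
exact: (@measurable_mu_extE _ _ _ (tuple_lebesgue n) A mA).
Qed.

Lemma rV_lebesgue_tuple (A : set V) : measurable (rV_tuple @^-1` A) ->
  mu A = tmu (rV_tuple @^-1` A).
Proof.
by move=> mA; rewrite /rV_lebesgue /pushforward /completed_measure_extension measurable_mu_extE.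
Qed.

Lemma le_rV_lebesgue (A B : set V) : A `<=` B -> (mu A <= mu B)%E.
Proof. by move=> AB; rewrite /rV_lebesgue /pushforward; apply: le_mu_ext => t /AB. Qed.

(** Completeness lets the values of a function on a null set be ignored when its
    measurability is proved, see [caratheodory_comp_measurable]. *)
Lemma rV_lebesgue_complete : measure_is_complete mu.
Proof.
move=> B [A [mA A0 BA]]; apply: (@measure_is_complete_caratheodory R _ (mu_ext (@tuple_lebesgue R n))).
exists (rV_of_tuple @^-1` A); split => //.
by move=> t /BA.
Qed.

Lemma rV_lebesgue_bounded (A : set V) : measurable A -> bounded_set A -> (mu A < +oo)%E.
Proof.
move=> mA [M [_ /(_ (`|M| + 1))]].
have -> : M < `|M| + 1 by rewrite (le_lt_trans (ler_norm M))// ltrDl.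
move=> /(_ isT) AM.
pose B := [set v : V | forall i, `[- (`|M| + 1), `|M| + 1]%classic (v ord0 i)].
have [mB BE] := @rV_lebesgue_box R n (fun=> `[- (`|M| + 1), `|M| + 1]%classic)
  (fun=> measurable_itv _).
have AB : A `<=` B.
  move=> x /AM /= xM i /=; rewrite in_itv /= -ler_norml.
  by apply: le_trans xM; rewrite /Num.norm /= mx_normrE; exact: (le_bigmax _ (fun ij => `|x ij.1 ij.2|) (ord0, i)).
apply: (@le_lt_trans _ _ (mu B)); first by apply: le_measure; rewrite ?inE.
rewrite [X in (X < _)%E]BE.
rewrite -ge0_fin_numE; last by apply: prode_ge0 => i _; exact: measure_ge0.
apply: (big_ind (fun x => x \is a fin_num)) => // [x y|i _]; first exact: fin_numM.
by rewrite lebesgue_measure_itv /=; case: ifP => _; rewrite -?EFinN -?EFinD.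
Qed.

(** Outer regularity by Borel sets.  It bridges the gap between Lebesgue
    measurable sets, on which functions are given, and Borel sets, which are
    reached by induction from boxes. *)
Lemma measurable_hull (E : set V) : (mu E < +oo)%E ->
  exists2 B : set V, measurable (rV_tuple @^-1` B) & E `<=` B /\ mu B = mu E.
Proof.
move=> Eoo.
have Efin : ereal_inf [set (\sum_(0 <= k <oo) tmu (A k))%E | A in measurable_cover (rV_tuple @^-1` E)] \is a fin_num.
  by rewrite ge0_fin_numE//; exact: mu_ext_ge0.
have ex k : exists B : set (n.-tuple R), [/\ measurable B, rV_tuple @^-1` E `<=` B &
    (tmu B <= mu E + (k.+1%:R^-1)%:E)%E].
  have k0 : 0 < k.+1%:R^-1 :> R by rewrite invr_gt0 ltr0n.
  have [x [F [mF EF] <-] lt] := lb_ereal_inf_adherent k0 Efin.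
  exists (\bigcup_j F j); split => //; first exact: bigcup_measurable.
  apply: le_trans (ltW lt).
  by apply: measure_sigma_subadditive => //; exact: bigcup_measurable.
pose B k := projT1 (cid (ex k)).
have BP k : [/\ measurable (B k), rV_tuple @^-1` E `<=` B k &
    (tmu (B k) <= mu E + (k.+1%:R^-1)%:E)%E] by rewrite /B; case: cid.
exists (tuple_rV @^-1` \bigcap_k B k).
  rewrite -comp_preimage (_ : _ \o _ = id) ?preimage_id; last by apply/funext => t /=; rewrite rV_tupleK.
  by apply: bigcapT_measurable => k; have [] := BP k.
have EB : E `<=` tuple_rV @^-1` \bigcap_k B k.
  by move=> x Ex k _; have [_ + _] := BP k; apply; rewrite /= tuple_rVK.
split => //.
have mB : measurable (\bigcap_k B k) by apply: bigcapT_measurable => k; have [] := BP k.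
have BE : rV_tuple @^-1` (tuple_rV @^-1` \bigcap_k B k) = \bigcap_k B k.
  by apply/seteqP; split => t /=; rewrite rV_tupleK.
apply/eqP; rewrite eq_le; apply/andP; split; last first.
  by rewrite /rV_lebesgue /pushforward; apply: le_mu_ext => t /EB.
rewrite rV_lebesgue_tuple BE//.
apply/lee_addgt0Pr => e e0.
have /cvgrPdist_lt/(_ _ e0)[k _ /(_ k (leqnn k))/=] := @cvg_harmonic R.
rewrite sub0r normrN gtr0_norm ?invr_gt0 ?ltr0n// => ke.
have [mBk _ le] := BP k.
apply: (@le_trans _ _ (tmu (B k))).
  by apply: le_measure; rewrite ?inE//; exact: bigcap_inf.
by apply: le_trans le _; rewrite leeD2l// lee_fin ltW.
Qed.

End rV_measure.

(** * A Loomis-Whitney inequality of weak type *)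

Lemma measurable_indicE d (T : measurableType d) (R : realType) (D A : set T) :
  measurable A -> measurable_fun D (fun t => (\1_A t : R)%:E).
Proof. by move=> mA; apply/measurable_EFinP; exact: measurable_indic. Qed.

Lemma integral_le_sum d (T : measurableType d) (R : realType)
    (mu : {measure set T -> \bar R}) m (f : T -> \bar R) (w b : 'I_m -> R)
    (G : 'I_m -> T -> \bar R) :
  measurable_fun setT f -> (forall x, 0 <= f x)%E ->
  (forall i, measurable_fun setT (G i)) -> (forall i x, 0 <= G i x)%E ->
  (forall i, 0 <= w i) -> (forall x, f x <= \sum_i (w i)%:E * G i x)%E ->
  (forall i, \int[mu]_x G i x <= (b i)%:E)%E ->
  (\int[mu]_x f x <= (\sum_i w i * b i)%:E)%E.
Proof.
move=> mf f0 mG G0 w0 fG Gb.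
apply: (@le_trans _ _ (\int[mu]_x (\sum_i (w i)%:E * G i x))%E).
  apply: ge0_le_integral => //.
  by apply: emeasurable_sum => i; exact: measurable_funeM.
rewrite ge0_integral_sum//; last 2 first.
- by move=> i; exact: measurable_funeM.
- by move=> i x _; rewrite mule_ge0// lee_fin.
rewrite -sumEFin; apply: lee_sum => i _; rewrite ge0_integralZl_EFin//.
by rewrite EFinM lee_wpmul2l// lee_fin.
Qed.

Section slices.
Context {R : realType}.
Local Notation leb := (@lebesgue_measure R).
Local Notation tmu n := (@tuple_lebesgue R n).

Lemma measurable_consTR n :
  @measurable_fun _ _ (measurableTypeR R * n.-tuple R)%type _ setT (@consT R n).
Proof. exact: measurable_consT. Qed.

Definition upd n (t : n.-tuple R) (i : 'I_n) (s : R) : n.-tuple R :=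
  [tuple if j == i then s else tnth t j | j < n].

Lemma tnth_consT0 n (x : R) (t : n.-tuple R) : tnth (consT (x, t)) ord0 = x.
Proof. by []. Qed.

Lemma tnth_consTS n (x : R) (t : n.-tuple R) j :
  tnth (consT (x, t)) (lift ord0 j) = tnth t j.
Proof. by rewrite tnthS. Qed.

Lemma upd_consT0 n (x s : R) (t : n.-tuple R) :
  upd (consT (x, t)) ord0 s = consT (s, t).
Proof.
apply/eq_from_tnth => j; rewrite tnth_mktuple.
by have [k ->|->] := unliftP ord0 j; rewrite ?eqxx ?tnth_consTS// tnth_consT0.
Qed.

Lemma upd_consTS n (x s : R) (t : n.-tuple R) i :
  upd (consT (x, t)) (lift ord0 i) s = consT (x, upd t i s).
Proof.
apply/eq_from_tnth => j; rewrite tnth_mktuple.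
have [k ->|->] := unliftP ord0 j; last by rewrite tnth_consT0.
by rewrite (inj_eq lift_inj) !tnth_consTS tnth_mktuple.
Qed.

Lemma tuple_consT n (t : n.+1.-tuple R) : exists x s, t = consT (x, s).
Proof. by rewrite -(unconsTK t); eexists; eexists. Qed.

Lemma measurable_slice n (F : n.+1.-tuple R -> \bar R) (x : R) :
  measurable_fun setT F -> measurable_fun setT (fun t => F (consT (x, t))).
Proof.
move=> mF; apply: (measurableT_comp mF).
exact: (measurableT_comp (@measurable_consT R n) (pair1_measurable x)).
Qed.

Section cons_tonelli.
Variables (n : nat) (F : n.+1.-tuple R -> \bar R).
Hypotheses (mF : measurable_fun setT F) (F0 : forall t, (0 <= F t)%E).

Let mFc : @measurable_fun _ _ (measurableTypeR R * n.-tuple R)%type _ setT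
  (fun z => F (consT z)).
Proof. exact: (measurableT_comp mF (@measurable_consTR n)). Qed.

Lemma tonelli_cons :
  (\int[tmu n.+1]_t F t = \int[leb]_x \int[tmu n]_t F (consT (x, t)))%E.
Proof.
have := @ge0_integral_pushforward _ _ _ _ R _ (@measurable_consTR n)
  (leb \x tmu n)%E
  setT F measurableT mF (fun t _ => F0 t).
rewrite preimage_setT => E; rewrite [LHS]E.
exact: (@fubini_tonelli1 _ _ _ _ R leb (tmu n) _ mFc (fun z => F0 _)).
Qed.

Lemma tonelli_cons_swap :
  (\int[tmu n.+1]_t F t = \int[tmu n]_t \int[leb]_x F (consT (x, t)))%E.
Proof.
rewrite tonelli_cons.
exact: (@fubini_tonelli _ _ _ _ R leb (tmu n) _ mFc (fun z => F0 _)).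
Qed.

Lemma measurable_slice_integral :
  measurable_fun setT (fun x => \int[tmu n]_t F (consT (x, t)))%E.
Proof. exact: (@measurable_fun_fubini_tonelli_F _ _ _ _ R (tmu n) _ mFc (fun z => F0 _)). Qed.

Lemma measurable_line_integral :
  measurable_fun setT (fun t => \int[leb]_x F (consT (x, t)))%E.
Proof. exact: (@measurable_fun_fubini_tonelli_G _ _ _ _ R leb _ mFc (fun z => F0 _)). Qed.

End cons_tonelli.

(** By Tonelli an integral is determined by the integrals on the lines parallel to
    any one axis.  Applied to the positive and negative parts of a partial
    derivative, it gives integration by parts. *)
Lemma eq_integral_lines n (k : 'I_n) (F G : n.-tuple R -> \bar R) :
  measurable_fun setT F -> measurable_fun setT G ->
  (forall t, (0 <= F t)%E) -> (forall t, (0 <= G t)%E) ->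
  (forall t, \int[leb]_s F (upd t k s) = \int[leb]_s G (upd t k s))%E ->
  (\int[tmu n]_t F t = \int[tmu n]_t G t)%E.
Proof.
elim: n k F G => [[]//|n IH] k F G mF mG F0 G0 FG.
have [j kE|k0] := unliftP ord0 k.
  rewrite (tonelli_cons mF F0) (tonelli_cons mG G0); apply: eq_integral => x _.
  apply: (IH j) => //; [exact: measurable_slice..|move=> t].
  have := FG (consT (x, t)); rewrite kE.
  by under eq_fun do rewrite upd_consTS; under [in RHS]eq_fun do rewrite upd_consTS.
rewrite (tonelli_cons_swap mF F0) (tonelli_cons_swap mG G0); apply: eq_integral => t _.
have := FG (consT (0, t)); rewrite k0.
by under eq_fun do rewrite upd_consT0; under [in RHS]eq_fun do rewrite upd_consT0.
Qed.

Lemma AGM_prod m (E : 'I_m.+1 -> R) : (forall i, 0 <= E i) ->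
  \prod_i E i <= ((\sum_i E i) / m.+1%:R) ^+ m.+1.
Proof.
move=> E0.
have := @leif_AGM R 'I_m.+1 predT E (fun i _ => E0 i).
by rewrite cardT size_enum_ord => -[].
Qed.

Lemma exists_root m (x : R) : 0 < x -> exists2 K : R, 0 < K & K ^+ m.+1 = x.
Proof.
move=> x0; exists (x `^ (m.+1%:R^-1)); first exact: powR_gt0.
rewrite -(powR_mulrn _ (powR_ge0 _ _)) -powRrM mulVf ?pnatr_eq0//.
by rewrite powRr1// ltW.
Qed.

(** The arithmetic step of the induction for [weak_loomis_whitney]. A slice of
    measure [d] satisfies [d ^ m <= prod G_i] by induction and [d <= J 0]; the
    product of the two, normalized by [J] and split by the inequality between the
    arithmetic and geometric means, is a bound for [d] which is linear in the
    [G_i] and can be integrated. The [G_i] are perturbed by [e] as the induction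
    hypothesis is only available for positive numbers. *)
Lemma AGM_slice m (J : 'I_m.+2 -> R) (G : 'I_m.+1 -> R) (K d e : R) :
  (forall i, 0 < J i) -> 0 < K -> K ^+ m.+1 = \prod_i J i ->
  0 <= d -> d <= J ord0 -> (forall i, 0 <= G i) -> 0 < e ->
  d ^+ m <= \prod_i (G i + e / K * J (lift ord0 i)) ->
  d <= \sum_i (K / (m.+1%:R * J (lift ord0 i))) * G i + e.
Proof.
move=> J0 K0 KE d0 dJ G0 e0 dm.
pose H i := G i + e / K * J (lift ord0 i).
have H0 i : 0 < H i by rewrite ltr_wpDl// mulr_gt0// divr_gt0.
have HJ i : 0 <= H i / J (lift ord0 i) by rewrite divr_ge0// ltW.
have dK : d ^+ m.+1 <= (K * ((\sum_i H i / J (lift ord0 i)) / m.+1%:R)) ^+ m.+1.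
  rewrite exprMn KE big_ord_recl exprS -mulrA ler_pM ?exprn_ge0//.
  apply: (le_trans dm).
  apply: le_trans (ler_wpM2l _ (AGM_prod HJ)).
    rewrite -big_split/= le_eqVlt; apply/orP; left; apply/eqP.
    by apply: eq_bigr => i _; rewrite [RHS]mulrC divfK// gt_eqF.
  by apply: prodr_ge0 => i _; exact: ltW.
move: dK; rewrite ler_pXn2r// ?nnegrE//; last first.
  by rewrite mulr_ge0 ?(ltW K0)// divr_ge0// sumr_ge0.
move/le_trans; apply; rewrite le_eqVlt; apply/orP; left; apply/eqP.
have EH i : H i / J (lift ord0 i) = G i / J (lift ord0 i) + e / K.
  by rewrite mulrDl mulfK// gt_eqF.
under eq_bigr do rewrite EH.
rewrite big_split/= sumr_const card_ord mulrDl mulrDr; congr (_ + _).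
  rewrite mulrA mulrAC mulr_sumr; apply: eq_bigr => i _.
  by rewrite invfM; ring.
by rewrite -[_ *+ _]mulr_natr mulfK ?pnatr_eq0// mulrC divfK// gt_eqF.
Qed.

(** Integrating the linear bound of [AGM_slice] replaces [G_i] by at most
    [J_i]: the weights have been chosen so that the total is [K]. *)
Lemma sum_weights m (J : 'I_m.+1 -> R) (K : R) : (forall i, 0 < J i) ->
  \sum_i K / (m.+1%:R * J i) * J i <= K.
Proof.
move=> J0; under eq_bigr => i _.
  rewrite invfM mulrA -mulrA mulVf ?mulr1; last by rewrite gt_eqF.
  over.
by rewrite sumr_const card_ord -[leLHS]mulr_natr divfK ?pnatr_eq0.
Qed.

(** [AGM_slice] for slice integrals that may be infinite; the linear bound is
    trivial when one of them is. *)
Lemma AGM_slice_ereal m (J : 'I_m.+2 -> R) (G : 'I_m.+1 -> \bar R) (K : R) (d : \bar R) :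
  (forall i, 0 < J i) -> 0 < K -> K ^+ m.+1 = \prod_i J i ->
  (0 <= d)%E -> (d <= (J ord0)%:E)%E -> (forall i, 0 <= G i)%E ->
  (d != 0%E -> forall H : 'I_m.+1 -> R, (forall i, 0 < H i) -> (forall i, G i <= (H i)%:E)%E ->
     fine d ^+ m <= \prod_i H i) ->
  (d <= \sum_i (K / (m.+1%:R * J (lift ord0 i)))%:E * G i)%E.
Proof.
move=> J0 K0 KE d0 dJ G0 dH; pose w i : R := K / (m.+1%:R * J (lift ord0 i)).
have w0 i : 0 < w i by rewrite divr_gt0// mulr_gt0.
have wG0 i : (0 <= (w i)%:E * G i)%E by rewrite mule_ge0// lee_fin ltW.
rewrite -[leRHS]/(\sum_i (w i)%:E * G i)%E.
have [->|dn0] := eqVneq d 0%E; first by rewrite sume_ge0.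
have [/existsP[i /eqP Gi]|/existsPn Gfin] := boolP [exists i, G i == +oo%E].
  rewrite (bigD1 i)//= Gi gt0_muley ?lte_fin// addye ?leey//.
  by rewrite gt_eqF// (lt_le_trans (ltNyr 0))// sume_ge0.
have Gf i : G i \is a fin_num by rewrite ge0_fin_numE// ltey; exact: (Gfin i).
have dfin : d \is a fin_num by rewrite ge0_fin_numE// (le_lt_trans dJ)// ltry.
apply/lee_addgt0Pr => e e0.
have Gx0 i : 0 <= fine (G i) by apply/fine_ge0/G0.
have dle : fine d <= \sum_i w i * fine (G i) + e.
  apply: (AGM_slice J0 K0 KE _ _ Gx0 e0); first exact: fine_ge0.
    by rewrite -lee_fin fineK.
  apply: dH => // i; first by rewrite ltr_wpDl// mulr_gt0// divr_gt0.
  rewrite -[X in (X <= _)%E](fineK (Gf i)) lee_fin lerDl.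
  by rewrite mulr_ge0// ltW// divr_gt0.
rewrite -(fineK dfin).
under eq_bigr do rewrite -(fineK (Gf _)).
by rewrite sumEFin -EFinD lee_fin.
Qed.

(** If every line parallel to an axis through a point of [A] carries mass at least
    1 of [g i], then [A] is small. In the induction on the dimension the slices of
    [A] orthogonal to the first axis satisfy the hypothesis for [g 1], ..., while
    their measure is at most the integral of [g 0]. The conclusion is about every
    real number [c] below the measure of [A], as this measure might be infinite.
    *)
Lemma weak_loomis_whitney n (A : set (n.+1.-tuple R))
    (g : 'I_n.+1 -> n.+1.-tuple R -> \bar R) (J : 'I_n.+1 -> R) (c : R) :
  measurable A -> A !=set0 ->
  (forall i, measurable_fun setT (g i)) -> (forall i t, (0 <= g i t)%E) ->
  (forall t i, A t -> (1 <= \int[leb]_s g i (upd t i s))%E) ->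
  (forall i, 0 < J i) -> (forall i, \int[tmu n.+1]_t g i t <= (J i)%:E)%E ->
  0 <= c -> (c%:E <= tmu n.+1 A)%E ->
  c ^+ n <= \prod_i J i.
Proof.
elim: n A g J c => [|n IH] A g J c mA A0 mg g0 Ag J0 gJ c0 cA.
  rewrite expr0 big_ord_recl big_ord0 mulr1.
  case: A0 => t At; have := Ag t ord0 At; have [x [s ->]] := tuple_consT t.
  under eq_fun do rewrite upd_consT0.
  have -> : s = [tuple] by exact: tuple0.
  move=> h; have := gJ ord0; rewrite tonelli_cons// -lee_fin; apply: le_trans.
  apply: (le_trans h); rewrite le_eqVlt; apply/orP; left; apply/eqP.
  apply: eq_integral => y _ /=.
  by rewrite integral_dirac// ?diracT ?mul1e//; exact: measurable_slice.
pose Ax x : set (n.+1.-tuple R) := [set t | A (consT (x, t))].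
have mAx x : measurable (Ax x).
  rewrite -[X in measurable X]setTI.
  exact: (measurableT_comp (@measurable_consT R n.+1) (pair1_measurable x)).
pose G i x := (\int[tmu n.+1]_t g (lift ord0 i) (consT (x, t)))%E.
have G0 i x : (0 <= G i x)%E by apply: integral_ge0.
have mG i : measurable_fun setT (G i) by exact: measurable_slice_integral.
have GJ i : (\int[leb]_x G i x <= (J (lift ord0 i))%:E)%E by rewrite -tonelli_cons.
have AxJ x : (tmu n.+1 (Ax x) <= (J ord0)%:E)%E.
  apply: le_trans (gJ ord0); rewrite tonelli_cons_swap//.
  rewrite -[X in (tmu _ X <= _)%E]setIT -integral_indic//.
  apply: ge0_le_integral => //.
  - exact: measurable_indicE.
  - exact: measurable_line_integral.
  move=> t _; rewrite indicE; have [|_] := boolP (t \in Ax x); last by apply: integral_ge0.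
  rewrite inE => /(Ag _ ord0); by under eq_fun do rewrite upd_consT0.
have AE : (tmu n.+2 A = \int[leb]_x tmu n.+1 (Ax x))%E.
  rewrite -[X in (tmu _ X = _)%E]setIT -integral_indic// tonelli_cons//; last exact: measurable_indicE.
  apply: eq_integral => x _; rewrite -[X in (_ = tmu _ X)%E]setIT -integral_indic//.
have PJ0 : 0 < \prod_i J i by apply: prodr_gt0.
have [K K0 KE] := exists_root n PJ0.
have key x : (tmu n.+1 (Ax x) <=
    \sum_i (K / (n.+1%:R * J (lift ord0 i)))%:E * G i x)%E.
  apply: (AGM_slice_ereal J0 K0 KE (measure_ge0 _ _) (AxJ x) (G0 ^~ x)) => d0 H H0 GH.
  have Axfin : tmu n.+1 (Ax x) \is a fin_num.
    by rewrite (ge0_fin_numE (measure_ge0 _ _)); exact: le_lt_trans (AxJ x) (ltry _).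
  apply: (IH (Ax x) (fun i t => g (lift ord0 i) (consT (x, t))) H _ (mAx x)).
  - by apply/set0P; apply: contraNneq d0 => ->; rewrite measure0.
  - by move=> i; exact: (measurable_slice _ (mg _)).
  - by move=> i t; exact: g0.
  - move=> t i /(Ag _ (lift ord0 i)).
    by under eq_fun do rewrite upd_consTS.
  - exact: H0.
  - exact: GH.
  - exact: (fine_ge0 (measure_ge0 _ _)).
  - by rewrite (fineK Axfin).
have mAxm : measurable_fun setT (fun x : measurableTypeR R => tmu n.+1 (Ax x)).
  rewrite (_ : (fun x => _) = (fun x => \int[tmu n.+1]_t (\1_A (consT (x, t)))%:E)%E).
    apply: (@measurable_slice_integral n.+1 (fun t => (\1_A t)%:E)) => [|t].
      exact: measurable_indicE.
    by rewrite lee_fin.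
  apply/funext => x; rewrite -[X in (tmu _ X = _)%E]setIT -integral_indic//.
have w0 i : 0 <= K / (n.+1%:R * J (lift ord0 i)).
  by apply/ltW/divr_gt0; [exact: K0|apply: mulr_gt0; [exact: ltr0Sn|exact: J0]].
have AK := integral_le_sum mAxm (fun x => measure_ge0 (tmu n.+1) (Ax x)) mG G0 w0 key GJ.
have : c <= K.
  rewrite -lee_fin; apply: (le_trans cA); rewrite AE; apply: (le_trans AK).
  by rewrite lee_fin; exact: (sum_weights K (fun i => J0 (lift ord0 i))).
by rewrite -KE => cK; apply: lerXn2r; [exact: c0|exact: (ltW K0)|exact: cK].
Qed.

End slices.

(** * Test functions: integration along lines and weak Sobolev inequality *)

Lemma integral_supp d (T : measurableType d) (R : realType) (mu : {measure set T -> \bar R})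
    (D : set T) (f : T -> \bar R) : (forall x, ~ D x -> f x = 0%E) ->
  (\int[mu]_(x in D) f x = \int[mu]_x f x)%E.
Proof.
move=> f0; rewrite integral_mkcond; congr integral; apply/funext => x.
by rewrite /patch; case: ifPn => //; rewrite notin_setE => /f0.
Qed.

Section line.
Context {R : realType}.
Local Notation leb := (@lebesgue_measure R).
Variables (l dl : R -> R) (M : R).
Hypotheses (M0 : 0 < M) (Dl : forall s : R, is_derive s 1 l (dl s)) (cdl : continuous dl).
Hypotheses (l0 : forall s, M <= `|s| -> l s = 0) (dl0 : forall s, M <= `|s| -> dl s = 0).

Let mdl : measurable_fun setT (EFin \o dl).
Proof. by apply: measurableT_comp => //; exact: continuous_measurable_fun. Qed.

Let cl : continuous l.
Proof.
move=> x; apply: differentiable_continuous.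
by apply/derivable1_diffP; have [] := Dl x.
Qed.

Lemma line_FTC a b : a < b ->
  (\int[leb]_(x in `[a, b]) (dl x)%:E = (l b)%:E - (l a)%:E)%E.
Proof.
move=> ab; apply: continuous_FTC2 => //.
- exact: continuous_subspaceT.
- split.
  + by move=> x _; have [] := Dl x.
  + apply: cvg_at_right_filter; exact: cl.
  + apply: cvg_at_left_filter; exact: cl.
- by move=> x _; rewrite derive1E; have [_] := Dl x.
Qed.

(** The fundamental theorem of calculus from a point where [l] vanishes. *)
Lemma line_le s : (`|l s|%:E <= \int[leb]_x `|dl x|%:E)%E.
Proof.
pose b := - (Num.max M `|s| + 1).
have bs : b < s.
  rewrite /b ltrNl (le_lt_trans (ler_norm _))// normrN.
  by rewrite (@le_lt_trans _ _ (Num.max M `|s|)) ?le_max ?lexx ?orbT// ltrDl.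
have lb : l b = 0.
  rewrite l0// /b normrN ger0_norm; last by rewrite addr_ge0// le_max ltW.
  by rewrite (@le_trans _ _ (Num.max M `|s|)) ?le_max ?lexx// lerDl.
have := line_FTC bs; rewrite lb sube0 => E.
rewrite -[X in (X <= _)%E]/(`|(l s)%:E|)%E -E.
apply: le_trans (le_abse_integral _ _ _) _ => //; first exact: measurable_funTS.
apply: ge0_subset_integral => //.
exact: measurableT_comp.
Qed.

(** The integral of the derivative is 0; in this form, with nonnegative integrands,
    it is the hypothesis of [eq_integral_lines]. *)
Lemma line_pos_neg :
  (\int[leb]_x (EFin \o dl)^\+ x = \int[leb]_x (EFin \o dl)^\- x)%E.
Proof.
have out x : ~ `[- M, M]%classic x -> dl x = 0.
  by rewrite /= in_itv /= -ler_norml => /negP; rewrite -ltNge => /ltW/dl0.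
have ND : - M < M by rewrite (@lt_trans _ _ 0)// oppr_lt0.
have int : leb.-integrable `[- M, M] (EFin \o dl).
  apply: continuous_compact_integrable; first exact: segment_compact.
  exact: continuous_subspaceT.
have := line_FTC ND; rewrite !l0 ?normrN ?ger0_norm ?(ltW M0)// subee//.
rewrite integralE => E.
have P : (\int[leb]_(x in `[(- M)%R, M]) (EFin \o dl)^\+ x)%E \is a fin_num.
  exact: integrable_pos_fin_num.
have N : (\int[leb]_(x in `[(- M)%R, M]) (EFin \o dl)^\- x)%E \is a fin_num.
  exact: integrable_neg_fin_num.
have suppP := @integral_supp _ _ _ leb `[- M, M]%classic (EFin \o dl)^\+%E.
have suppN := @integral_supp _ _ _ leb `[- M, M]%classic (EFin \o dl)^\-%E.
rewrite -[LHS]suppP => [|x /out dx]; last by rewrite funeposE /= dx maxxx.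
rewrite -[RHS]suppN => [|x /out dx]; last by rewrite funenegE /= dx oppr0 maxxx.
rewrite -[LHS](fineK P) -[RHS](fineK N); congr (_%:E).
by move: E; rewrite -(fineK P) -(fineK N) -EFinB => -[] /eqP; rewrite subr_eq0 => /eqP.
Qed.

End line.

Section test_fun_integrals.
Context {R : realType} {n : nat}.
Local Notation V := 'rV[R]_n.
Local Notation mu := (@rV_lebesgue R n).
Implicit Types (f phi : V -> R) (Om : set V).

Local Notation "''e_' i" := (delta_mx 0 i : 'rV[R]_n) (at level 8, i at level 2).

Lemma compact_rV_bounded (K : set V) : compact K -> exists2 M : R, 0 < M &
  forall x, K x -> forall i, `|x 0 i| < M.
Proof.
move=> /compact_bounded[M [_ /(_ (`|M| + 1))]].
have -> : M < `|M| + 1 by rewrite (le_lt_trans (ler_norm M))// ltrDl.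
move=> /(_ isT) KM; exists (`|M| + 2) => [|x /KM /= xM i].
  by rewrite ltr_wpDl.
apply: (@le_lt_trans _ _ (`|M| + 1)); last by rewrite ltrD2l ltr1n.
by apply: le_trans xM; rewrite /Num.norm /= mx_normrE; exact: (le_bigmax _ (fun ij => `|x ij.1 ij.2|) (ord0, i)).
Qed.

Lemma rV_lebesgue_compact (K : set V) : compact K -> (mu K < +oo)%E.
Proof.
move=> cK; apply: rV_lebesgue_bounded; first exact: compact_rV_measurable.
exact: compact_bounded.
Qed.

Lemma compact_supp_bounded (K : set V) f : compact K -> continuous f ->
  (forall x, ~ K x -> f x = 0) -> exists2 C : R, 0 < C & forall x, `|f x| <= C.
Proof.
move=> cK cf f0.
have : compact (f @` K) by apply: continuous_compact => //; exact: continuous_subspaceT.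
move=> /compact_bounded[M [_ /(_ (`|M| + 1))]].
have -> : M < `|M| + 1 by rewrite (le_lt_trans (ler_norm M))// ltrDl.
move=> /(_ isT) KM; exists (`|M| + 1) => [|x]; first by rewrite ltr_wpDl.
have [Kx|/f0 ->] := pselect (K x); last by rewrite normr0 addr_ge0.
by apply: KM; exists x.
Qed.

Lemma compact_supp_integrable (K : set V) f : compact K -> continuous f ->
  (forall x, ~ K x -> f x = 0) -> mu.-integrable setT (EFin \o f).
Proof.
move=> cK cf f0; have [C C0 fC] := compact_supp_bounded cK cf f0.
have mK := compact_rV_measurable cK.
have : mu.-integrable K (EFin \o f).
  apply: measurable_bounded_integrable => //; first exact: rV_lebesgue_compact.
    exact: continuous_rV_measurable.
  exists C; split; first exact: num_real.
  by move=> y Cy x _ /=; rewrite (le_trans (fC x))// ltW.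
move=> /integrableP[_ fK]; apply/integrableP; split.
  by apply/measurable_EFinP; exact: continuous_rV_measurable.
by rewrite -(@integral_supp _ _ _ mu K) // => x /f0 /= ->; rewrite normr0.
Qed.

Lemma rV_tuple_upd (t : n.-tuple R) i s :
  rV_tuple (upd t i s) = s *: 'e_i + rV_tuple (upd t i 0).
Proof.
apply/rowP => j; rewrite !mxE !tnth_mktuple eqxx /= eq_sym.
by case: ifP => _; rewrite ?mulr1 ?addr0 ?mulr0 ?add0r.
Qed.

Lemma rV_tuple_updE (t : n.-tuple R) i s : rV_tuple (upd t i s) 0 i = s.
Proof. by rewrite rV_tupleE tnth_mktuple eqxx. Qed.

Section lines_of_test_fun.
Variables (Om : set V) (phi : V -> R) (tphi : test_fun Om phi) (i : 'I_n).

Let sphi : smooth phi. Proof. by case: tphi. Qed.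

Lemma test_fun_line (t : n.-tuple R) : exists2 M : R, 0 < M &
  let l s := phi (rV_tuple (upd t i s)) in
  let dl s := partial i phi (rV_tuple (upd t i s)) in
  [/\ (forall s : R, is_derive s 1 l (dl s)), continuous dl,
     (forall s, M <= `|s| -> l s = 0) & (forall s, M <= `|s| -> dl s = 0)].
Proof.
have [_ cK _] := tphi; have [M M0 KM] := compact_rV_bounded cK.
exists M => //.
have out s : M <= `|s| -> ~ support_of phi (rV_tuple (upd t i s)).
  by move=> Ms /KM/(_ i); rewrite rV_tuple_updE ltNge Ms.
split => [s|s|s /out|s /out].
- under eq_fun do rewrite rV_tuple_upd.
  apply: is_derive_line; rewrite -rV_tuple_upd; apply/derivableP.
  exact: smooth_derivable.
- have -> : (fun s => partial i phi (rV_tuple (upd t i s))) =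
      partial i phi \o (fun s => s *: 'e_i + rV_tuple (upd t i 0)).
    by apply/funext => y /=; rewrite rV_tuple_upd.
  apply: continuous_comp; last exact: smooth_partial_cont.
  apply: cvgD; last exact: cvg_cst.
  by apply: cvgZr_tmp; exact: cvg_id.
- exact: support_out.
- exact: partial_out.
Qed.

Lemma test_fun_integrable : mu.-integrable setT (EFin \o phi).
Proof.
have [_ cK _] := tphi.
by apply: compact_supp_integrable cK _ _; [exact: smooth_cont|exact: support_out].
Qed.

Lemma partial_test_fun_integrable : mu.-integrable setT (EFin \o partial i phi).
Proof.
have [_ cK _] := tphi.
by apply: compact_supp_integrable cK _ _; [exact: smooth_partial_cont|exact: partial_out].
Qed.

Lemma partial_test_fun_bounded : exists2 C : R, 0 < C & forall x, `|partial i phi x| <= C.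
Proof.
have [_ cK _] := tphi.
by apply: compact_supp_bounded cK _ _; [exact: smooth_partial_cont|exact: partial_out].
Qed.

Lemma test_fun_bounded : exists2 C : R, 0 < C & forall x, `|phi x| <= C.
Proof.
have [_ cK _] := tphi.
by apply: compact_supp_bounded cK _ _; [exact: smooth_cont|exact: support_out].
Qed.

Lemma integral_partial_test_fun : (\int[mu]_x (partial i phi x)%:E = 0)%E.
Proof.
have md : measurable_fun setT (fun t : n.-tuple R => (partial i phi (rV_tuple t))%:E).
  apply/measurable_EFinP.
  exact: (continuous_tuple_measurable (smooth_partial_cont (i := i) sphi)).
have mp : measurable_fun setT (fun t : n.-tuple R => (EFin \o partial i phi)^\+ (rV_tuple t))%E.
  have := measurable_funepos md.
  by apply: eq_measurable_fun => t _; rewrite !funeposE.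
have mn : measurable_fun setT (fun t : n.-tuple R => (EFin \o partial i phi)^\- (rV_tuple t))%E.
  have := measurable_funeneg md.
  by apply: eq_measurable_fun => t _; rewrite !funenegE.
have E : (\int[mu]_x (EFin \o partial i phi)^\+ x =
          \int[mu]_x (EFin \o partial i phi)^\- x)%E.
  rewrite !ge0_integral_rV_tuple//.
  have := eq_integral_lines (k := i) mp mn; apply => // t.
  have [M M0 [Dl cdl l0 dl0]] := test_fun_line t.
  have := line_pos_neg M0 Dl cdl l0 dl0.
  under eq_integral do rewrite funeposE.
  under [in RHS]eq_integral do rewrite funenegE.
  move=> H.
  under eq_integral do rewrite funeposE.
  by under [in RHS]eq_integral do rewrite funenegE.
rewrite integralE [X in (X - _)%E]E subee//.
exact: (integrable_neg_fin_num _ partial_test_fun_integrable).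
Qed.

End lines_of_test_fun.
End test_fun_integrals.

Section weak_sobolev.
Context {R : realType} {n : nat}.
Local Notation V := 'rV[R]_n.+1.
Local Notation mu := (@rV_lebesgue R n.+1).

Lemma upd_id m (t : m.-tuple R) i : upd t i (tnth t i) = t.
Proof.
by apply/eq_from_tnth => j; rewrite tnth_mktuple; case: eqP => [->|].
Qed.

(** [weak_loomis_whitney] with [g i] the [i]-th partial derivative in absolute value,
    divided by [lam]. *)
Lemma weak_sobolev (Om : set V) (phi : V -> R) (lam c : R) (J : 'I_n.+1 -> R) :
  (0 < n)%N -> test_fun Om phi -> 0 < lam -> (forall i, 0 < J i) ->
  (forall i, \int[mu]_x `|partial i phi x|%:E <= (J i)%:E)%E ->
  0 <= c -> (c%:E <= mu [set x | (lam <= `|phi x|)%R])%E ->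
  c ^+ n <= \prod_i (J i / lam).
Proof.
move=> n0 tphi lam0 J0 HJ c0.
have sphi : smooth phi by case: tphi.
set A := [set x | _].
have mA : measurable (rV_tuple @^-1` A).
  have := continuous_tuple_measurable (smooth_cont sphi).
  move/(measurableT_comp (@normr_measurable R setT)) => /(_ measurableT `[lam, +oo[%classic).
  rewrite setTI => /(_ (measurable_itv _)).
  by congr measurable; apply/seteqP; split => t; rewrite /A /= in_itv /= andbT.
rewrite rV_lebesgue_tuple// => cA.
have JL i : 0 < J i / lam by rewrite divr_gt0.
have [A0|A0] := pselect (rV_tuple @^-1` A !=set0); last first.
  have c00 : c = 0.
    apply/eqP; rewrite eq_le c0 andbT -lee_fin; apply: (le_trans cA).
    have -> : rV_tuple @^-1` A = set0 by apply: contrapT => /eqP/set0P.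
    by rewrite measure0.
  by rewrite c00 expr0n gtn_eqF// prodr_ge0// => i _; rewrite ltW.
have mN i : measurable_fun setT (fun t : n.+1.-tuple R => `|partial i phi (rV_tuple t)|%:E).
  apply/measurable_EFinP; apply: measurableT_comp => //.
  exact: (continuous_tuple_measurable (smooth_partial_cont (i := i) sphi)).
have l0 : 0 <= lam^-1 by rewrite invr_ge0 ltW.
apply: (@weak_loomis_whitney R n _
  (fun i t => (lam^-1)%:E * `|partial i phi (rV_tuple t)|%:E)%E _ _ mA A0 _ _ _ JL _ c0 cA).
- by move=> i; exact: measurable_funeM.
- by move=> i t; rewrite mule_ge0.
- move=> t i /=; rewrite /A /= => At.
  have [M M0 [Dl cdl lM dlM]] := test_fun_line tphi i t.
  rewrite ge0_integralZl_EFin//; last first.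
    apply/measurable_EFinP; apply: measurableT_comp => //.
    exact: continuous_measurable_fun.
  apply: (@le_trans _ _ ((lam^-1)%:E * `|phi (rV_tuple t)|%:E)%E).
    by rewrite -EFinM lee_fin mulrC ler_pdivlMr// mul1r.
  apply: lee_wpmul2l; first by rewrite lee_fin.
  by have := line_le M0 Dl cdl lM (tnth t i); rewrite upd_id.
- move=> i; rewrite ge0_integralZl_EFin// EFinM muleC.
  apply: lee_wpmul2r; first by rewrite lee_fin.
  by rewrite -(@ge0_integral_rV_tuple R n.+1 (fun x => `|partial i phi x|%:E)).
Qed.

End weak_sobolev.

(** * Functions orthogonal to all test functions vanish *)

Lemma integrable_mul_supp d (T : measurableType d) (R : realType)
    (mu : {measure set T -> \bar R}) (Om K : set T) (C : R) (g phi : T -> R) :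
  measurable Om -> measurable K -> K `<=` Om -> measurable_fun Om g ->
  measurable_fun Om phi -> 0 <= C -> (forall x, ~ K x -> phi x = 0) ->
  (forall x, `|phi x| <= C) -> (\int[mu]_(x in K) `|g x|%:E < +oo)%E ->
  mu.-integrable Om (fun x => (g x * phi x)%:E).
Proof.
move=> mOm mK KOm mg mphi C0 phi0 phiC gK.
have mgK := measurable_funS mOm KOm mg; have mphiK := measurable_funS mOm KOm mphi.
apply/integrableP; split; first by apply/measurable_EFinP; exact: measurable_funM.
rewrite integral_mkcond.
rewrite (_ : _ \_ Om = (fun x => `|(g x * phi x)%:E|%E) \_ K); last first.
  apply/funext => x; rewrite /patch; case: ifPn => xOm; case: ifPn => xK //.
    by move: xK; rewrite notin_setE => /phi0 ->; rewrite mulr0 abse0.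
  by move: xK xOm; rewrite inE notin_setE => /KOm.
rewrite -integral_mkcond.
have mgE : measurable_fun K (fun x => `|g x|%:E).
  by apply/measurable_EFinP; exact: measurableT_comp.
apply: (@le_lt_trans _ _ (\int[mu]_(x in K) (C%:E * `|g x|%:E))%E).
  apply: ge0_le_integral => //.
  - by do 2 apply: measurableT_comp => //; exact: measurable_funM.
  - exact: measurable_funeM.
  - by move=> x _; rewrite -EFinM lee_fin normrM mulrC ler_wpM2r.
by rewrite ge0_integralZl_EFin//; apply: lte_mul_pinfty.
Qed.

Section tuple_generators.
Context {R : realType} {n : nat}.
Local Notation V := 'rV[R]_n.

(** The whole space is added because it is not a bounded box; the set is then a
    pi-system that generates the Borel sets. *)
Definition tuple_boxes : set (set (n.-tuple R)) :=
  [set B | B = setT \/ exists a b : V, B = rV_tuple @^-1` obox a b].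

Lemma oboxI (a b a' b' : V) : obox a b `&` obox a' b' =
  obox (\row_i Num.max (a 0 i) (a' 0 i)) (\row_i Num.min (b 0 i) (b' 0 i)).
Proof.
apply/seteqP; split => [x [xab xab'] i|x xab].
  have := xab i; have := xab' i; rewrite /= !in_itv /= !mxE.
  by rewrite gt_max lt_min => /andP[-> ->] /andP[-> ->].
by split => i; have := xab i; rewrite /= !in_itv /= !mxE gt_max lt_min;
  move=> /andP[/andP[? ?] /andP[? ?]]; apply/andP.
Qed.

Lemma setI_closed_tuple_boxes : setI_closed tuple_boxes.
Proof.
move=> A B [->|[a [b ->]]] [->|[a' [b' ->]]]; rewrite ?setTI ?setIT.
- by left.
- by right; exists a', b'.
- by right; exists a, b.
- by right; rewrite -preimage_setI oboxI; do 2 eexists.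
Qed.

Lemma tuple_ray_bigcup (i : 'I_n) (x : R) :
  [set t : n.-tuple R | x < tnth t i] = \bigcup_k (rV_tuple @^-1`
    obox (\row_j if j == i then x else - k%:R) (\row_j k%:R)).
Proof.
apply/seteqP; split => [t /= xt|t [k _ /(_ i)]]; last first.
  by rewrite /= in_itv /= !mxE eqxx => /andP[].
pose M := \sum_j `|tnth t j|.
have tM j : `|tnth t j| <= M by rewrite /M (bigD1 j)//= lerDl sumr_ge0.
have M0 : 0 <= M by apply: sumr_ge0.
have [k Mk] : exists k : nat, M < k%:R by exists (Num.bound M); exact: archi_boundP.
exists k => // j; rewrite /= in_itv /= !mxE.
have := le_lt_trans (tM j) Mk; rewrite ltr_norml => /andP[h1 h2].
by rewrite h2 andbT; case: eqP => [->|].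
Qed.

Lemma measurable_tuple_boxes (B : set (n.-tuple R)) :
  measurable B -> <<s tuple_boxes >> B.
Proof.
move=> mB.
suff mid : measurable_fun (setT : set (g_sigma_algebraType tuple_boxes))
   (fun t => t : n.-tuple R) by have := mid measurableT B mB; rewrite setTI.
apply/measurable_fun_tnthP => i.
apply: (measurability _ (RGenOInfty.measurableE R)) => _ [_ [x ->] <-].
rewrite setTI (_ : _ @^-1` _ = [set t : n.-tuple R | x < tnth t i]); last first.
  by apply/seteqP; split => t /=; rewrite in_itv /= andbT.
rewrite tuple_ray_bigcup; apply: bigcupT_measurable => k.
by apply: sub_sigma_algebra; right; do 2 eexists.
Qed.

End tuple_generators.

Section uniqueness.
Context {R : realType} {n : nat}.
Local Notation V := 'rV[R]_n.
Local Notation mu := (@rV_lebesgue R n).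
Variables (Om : set V) (oOm : open Om).

Lemma L1loc_test_integrable (g phi : V -> R) : L1loc Om g -> test_fun Om phi ->
  mu.-integrable Om (fun x => (g x * phi x)%:E).
Proof.
move=> [mg gK] tphi; have [sphi cK KOm] := tphi.
have [C C0 phiC] := test_fun_bounded tphi.
have mOm := open_rV_measurable oOm.
have mK := compact_rV_measurable cK.
apply: (integrable_mul_supp mOm mK KOm mg _ (ltW C0) (@support_out _ _ phi) phiC).
  by apply: continuous_rV_measurable; exact: smooth_cont.
exact: (gK _ cK KOm).
Qed.

Section orthogonal_to_test_functions.
Variables (g : V -> R) (Lg : L1loc Om g).
Hypothesis g_test : forall phi, test_fun Om phi ->
  \int[mu]_(x in Om) (g x * phi x) = 0.

Let mOm : measurable Om. Proof. exact: open_rV_measurable. Qed.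

Let mcbox (a b : V) : measurable (cbox a b).
Proof. by apply: compact_rV_measurable; exact: cbox_compact. Qed.

Let mobox (a b : V) : measurable (obox a b : set V).
Proof. by apply: rV_measurable_tuple; exact: measurable_tuple_obox. Qed.

Lemma L1loc_cbox_integrable (a b : V) : cbox a b `<=` Om ->
  mu.-integrable (cbox a b) (EFin \o g).
Proof.
move=> abOm; have [mg gK] := Lg; apply/integrableP; split.
  by apply/measurable_EFinP; apply: measurable_funS mg.
have := gK _ (@cbox_compact _ _ a b) abOm; exact.
Qed.

(** Dominated convergence along [box_bump]. *)
Lemma integral_obox0 (a b : V) : cbox a b `<=` Om ->
  (\int[mu]_(x in obox a b) (g x)%:E = 0)%E.
Proof.
move=> abOm; have ig := L1loc_cbox_integrable abOm.
have mg : measurable_fun (cbox a b) g by apply/measurable_EFinP; case/integrableP: ig.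
pose f_ m x := (g x * box_bump a b m x)%:E; pose f x := (g x * \1_(obox a b) x)%:E.
have mf_ m : measurable_fun (cbox a b) (f_ m).
  apply/measurable_EFinP; apply: measurable_funM => //.
  by apply/continuous_rV_measurable/smooth_cont/smooth_box_bump.
have mf : measurable_fun (cbox a b) f.
  by apply/measurable_EFinP; apply: measurable_funM => //.
have f_f : {ae mu, forall x, cbox a b x -> f_ ^~ x @ \oo --> f x}.
  apply: aeW => x xab; rewrite /f_ /f.
  apply: cvg_EFin; first exact: nearW.
  have [xo|xo] := pselect (obox a b x).
    rewrite indicE mem_set//=.
    exact: (cvgM (cvg_cst (g x)) (cvg_box_bump xo)).
  rewrite indicE memNset//= mulr0.
  under eq_fun do rewrite /= box_bump_out// mulr0.
  exact: cvg_cst.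
have f_g : {ae mu, forall x m, cbox a b x -> (`|f_ m x| <= (abse \o (EFin \o g)) x)%E}.
  apply: aeW => x m xab; rewrite /f_ /= lee_fin normrM ler_piMr//.
  by rewrite ger0_norm ?box_bump_ge0// box_bump_le1.
have [_ _ lim] := @dominated_convergence _ _ _ mu _ (mcbox a b) f_ f (abse \o (EFin \o g)) mf_ mf
  f_f (integrable_abse ig) f_g.
have f_0 m : (\int[mu]_(x in cbox a b) f_ m x = 0)%E.
  have tb := test_fun_box_bump m abOm.
  have := g_test tb; rewrite /Rintegral => H.
  have I := L1loc_test_integrable Lg tb.
  have F : (\int[mu]_(x in Om) (g x * box_bump a b m x)%:E = 0)%E.
    by rewrite -[LHS]fineK ?H//; exact: integrable_fin_num.
  rewrite -F [RHS]integral_mkcond [LHS]integral_mkcond; congr integral.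
  apply/funext => x; rewrite /patch; case: ifPn => xab; case: ifPn => xOm //.
    by move: xab xOm; rewrite inE notin_setE => /abOm.
  by move: xab; rewrite notin_setE => xab; rewrite box_bump_out ?mulr0// => /obox_sub_cbox.
have : (\int[mu]_(x in cbox a b) f x = 0)%E.
  have : (fun m => \int[mu]_(x in cbox a b) f_ m x)%E @ \oo --> (\int[mu]_(x in cbox a b) f x)%E.
    exact: lim.
  under eq_fun do rewrite f_0.
  by move=> /cvg_lim <- //; rewrite lim_cst.
move=> F0; rewrite -[RHS]F0 [LHS]integral_mkcond [RHS]integral_mkcond; congr integral.
apply/funext => x; rewrite /patch /f indicE; case: ifPn => xo; last first.
  by rewrite mulr0; case: ifP.
by rewrite mulr1 mem_set//; apply: obox_sub_cbox; rewrite inE in xo.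
Qed.

(** Dynkin's pi-lambda theorem extends [integral_obox0] from boxes to the Borel
    subsets of a box. *)
Lemma integral_obox_tuple0 (a b : V) (B : set V) : cbox a b `<=` Om ->
  measurable (rV_tuple @^-1` B) -> (\int[mu]_(x in obox a b `&` B) (g x)%:E = 0)%E.
Proof.
move=> abOm mB.
have ig : mu.-integrable (obox a b) (EFin \o g).
  by apply: integrableS (L1loc_cbox_integrable abOm) => //; exact: obox_sub_cbox.
pose H : set (set (n.-tuple R)) := [set C | measurable C /\
  (\int[mu]_(x in obox a b `&` tuple_rV @^-1` C) (g x)%:E = 0)%E].
have mC (C : set (n.-tuple R)) : measurable C -> measurable (tuple_rV @^-1` C).
  move=> mC; apply: rV_measurable_tuple; rewrite -comp_preimage.
  by rewrite (_ : _ \o _ = id) ?preimage_id//; apply/funext => t /=; rewrite rV_tupleK.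
have dH : dynkin H.
  split.
  - by split => //; rewrite preimage_setT setIT integral_obox0.
  - move=> C [mC0 C0]; split; first exact: measurableC.
    have mD := mC _ mC0.
    have : (\int[mu]_(x in obox a b) (g x)%:E = 0)%E by exact: integral_obox0.
    have E : obox a b = (obox a b `&` tuple_rV @^-1` C) `|` (obox a b `&` ~` (tuple_rV @^-1` C)).
      by rewrite -setIUr setUv setIT.
    rewrite {1}E.
    rewrite integral_setU.
    + by rewrite C0 add0e preimage_setC.
    + exact: measurableI.
    + by apply: measurableI => //; exact: measurableC.
    + by apply: measurable_funS (measurable_int _ ig) => // x [[]|[]].
    + by apply/disj_setPS => x [[_ ?] [_]].
  - move=> F tF HF; split; first by apply: bigcupT_measurable => k; have [] := HF k.
    rewrite preimage_bigcup setI_bigcupr integral_bigcup.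
    + by apply: eseries0 => k _ _; have [] := HF k.
    + apply/trivIsetP => i j _ _ ij; apply/seteqP; split => // x [[_ Fi] [_ Fj]].
      by have /trivIsetP/(_ i j I I ij) := tF; rewrite -subset0 => /(_ (tuple_rV x)); apply.
    + by move=> k; apply: measurableI => //; apply: mC; have [] := HF k.
    + apply: integrableS ig => //; last by move=> x [k _ []].
      by apply: bigcupT_measurable => k; apply: measurableI => //; apply: mC; have [] := HF k.
have : <<s tuple_boxes >> `<=` H.
  apply: lambda_system_subset => //.
  - exact: setI_closed_tuple_boxes.
  - exact/dynkin_lambda_system.
  - move=> C [->|[a' [b' ->]]]; first by split => //; rewrite preimage_setT setIT integral_obox0.
    split; first exact: measurable_tuple_obox.
    rewrite -comp_preimage (_ : _ \o _ = id); last by apply/funext => x /=; rewrite tuple_rVK.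
    rewrite preimage_id oboxI integral_obox0// => x xab; apply: abOm => i.
    have := xab i; rewrite /= !in_itv /= !mxE ge_max le_min.
    by move=> /andP[/andP[-> _] /andP[-> _]].
move=> /(_ _ (measurable_tuple_boxes mB))[_].
by rewrite -comp_preimage (_ : _ \o _ = id) ?preimage_id//; apply/funext => x /=; rewrite tuple_rVK.
Qed.

(** The set where [g > 0] is only Lebesgue measurable; its Borel hull differs from
    it by a null set, so [g] has integral 0 on it. *)
Lemma obox_le0 (a b : V) : cbox a b `<=` Om ->
  {ae mu, forall x, obox a b x -> g x <= 0}.
Proof.
move=> abOm.
have ig : mu.-integrable (obox a b) (EFin \o g).
  by apply: integrableS (L1loc_cbox_integrable abOm) => //; exact: obox_sub_cbox.
have mg : measurable_fun (obox a b) g by apply/measurable_EFinP; case/integrableP: ig.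
pose E := obox a b `&` g @^-1` `]0, +oo[%classic.
have mE : measurable E by apply: mg.
have Eoo : (mu E < +oo)%E.
  apply: (@le_lt_trans _ _ (mu (cbox a b))); last exact/rV_lebesgue_compact/cbox_compact.
  by apply: le_measure; rewrite ?inE// => x [/obox_sub_cbox].
have [B mB [EB BE]] := measurable_hull Eoo.
have mBV := rV_measurable_tuple mB.
have E0 : (\int[mu]_(x in E) (g x)%:E = 0)%E.
  have := integral_obox_tuple0 abOm mB.
  rewrite (@negligible_integral _ _ _ mu _ (B `\` E)).
  - rewrite (_ : (obox a b `&` B) `\` (B `\` E) = E)//; apply/seteqP; split => [x [[xab Bx] nBE]|x Ex].
      by apply: contrapT => nE; apply: nBE.
    by split; [split; [case: Ex|exact: EB]|case].
  - exact: measurableD.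
  - exact: measurableI.
  - by apply: integrableS ig => //; exact: measurableI.
  - have Boo : (mu B < +oo)%E by rewrite BE.
    transitivity (mu B - mu (B `&` E))%E; first exact: (measureD mBV mE Boo).
    by rewrite setIidr// BE subee// ge0_fin_numE.
have : (\int[mu]_(x in E) `|(g x)%:E| = 0)%E.
  rewrite -[RHS]E0; apply: eq_integral => x; rewrite inE => -[_ /=].
  by rewrite in_itv /= andbT => /ltW g0; rewrite ger0_norm.
have mgE : measurable_fun E (EFin \o g).
  by apply/measurable_EFinP; apply: measurable_funS mg => // x [].
move=> /(ae_eq_integral_abs mu mE mgE).1; apply: filterS => x /= + xab.
move=> Egx; rewrite leNgt; apply/negP => gx.
have : E x by split => //=; rewrite in_itv /= andbT.
by move=> /Egx [] /eqP; rewrite gt_eqF.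
Qed.

End orthogonal_to_test_functions.

Lemma RintegralN_test (g phi : V -> R) : L1loc Om g -> test_fun Om phi ->
  \int[mu]_(x in Om) ((- g x) * phi x) = - \int[mu]_(x in Om) (g x * phi x).
Proof.
move=> Lg tphi; rewrite /Rintegral -fineN -integralN.
  by congr fine; apply: eq_integral => x _; rewrite mulNr.
have := L1loc_test_integrable Lg tphi => I.
exact: (integrable_add_def (open_rV_measurable oOm) I).
Qed.

(** [obox_le0] for [g] and [- g], on countably many boxes covering [Om]. *)
Lemma test_orthogonal_ae0 (g : V -> R) : L1loc Om g ->
  (forall phi, test_fun Om phi -> \int[mu]_(x in Om) (g x * phi x) = 0) ->
  {ae mu, forall x, Om x -> g x = 0}.
Proof.
move=> Lg g0.
have LN : L1loc Om (fun x => - g x).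
  split; first exact: measurableT_comp Lg.1.
  move=> K cK KOm; have := Lg.2 K cK KOm.
  by under [in X in _ -> X]eq_integral do rewrite normrN.
have gN phi : test_fun Om phi -> \int[mu]_(x in Om) ((- g x) * phi x) = 0.
  by move=> tphi; rewrite RintegralN_test// g0// oppr0.
have [D [a [b [OmE DOm]]]] := open_bigcup_boxes oOm.
have : {ae mu, forall x k, D k -> obox (a k) (b k) x -> g x = 0}.
  apply: ae_foralln => k.
  have [Dk|nDk] := pselect (D k); last by apply: aeW => x /nDk.
  have := obox_le0 LN gN (DOm _ Dk); have := obox_le0 Lg g0 (DOm _ Dk).
  apply: filterS2 => x gx ngx _ xab; apply/eqP; rewrite eq_le gx//=.
  by rewrite -oppr_le0 ngx.
apply: filterS => x gx; rewrite OmE => -[k Dk]; by apply: gx.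
Qed.

End uniqueness.

(** * Convergence in mean *)

Section ereal_cvg0.
Context {R : realType}.
Local Open Scope ereal_scope.

Lemma cvge0P (u : nat -> \bar R) : (forall j, 0 <= u j) ->
  (u @ \oo --> 0) <-> (forall e : R, (0 < e)%R -> \forall j \near \oo, u j <= e%:E).
Proof.
move=> u0; split => [/fine_cvgP[uf /cvgr0Pnorm_le u_0] e e0|ue].
  near=> j.
  have uj : u j \is a fin_num by near: j; exact: uf.
  rewrite -(fineK uj) lee_fin (le_trans (ler_norm _))//.
  by near: j; exact: u_0.
apply/fine_cvgP; split.
  near=> j; rewrite ge0_fin_numE//; apply: (@le_lt_trans _ _ 1%:E); last exact: ltry.
  by near: j; exact: ue.
apply/cvgr0Pnorm_le => e e0; near=> j => /=.
rewrite ger0_norm; last exact/fine_ge0.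
have uje : u j <= e%:E by near: j; exact: ue.
rewrite -lee_fin fineK// ge0_fin_numE//; exact: le_lt_trans uje (ltry _).
Unshelve. all: by end_near. Qed.

End ereal_cvg0.

Section L1_tools.
Context d (T : measurableType d) (R : realType) (mu : {measure set T -> \bar R}).
Variables (D : set T) (mD : measurable D).
Implicit Types (f g h : T -> R).

Lemma mEFin_norm f : measurable_fun D f -> measurable_fun D (fun x => `|f x|%:E).
Proof. by move=> mf; apply/measurable_EFinP; exact: measurableT_comp. Qed.

Lemma measurable_level_le f (a : R) : measurable_fun D f ->
  measurable (D `&` [set x | a <= `|f x|]).
Proof.
move=> mf; have := measurableT_comp (@normr_measurable R setT) mf.
move=> /(_ mD `[a, +oo[%classic (measurable_itv _)); congr measurable.
by apply/seteqP; split => x [Dx] /=; rewrite in_itv /= andbT.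
Qed.

Lemma measurable_level_lt f (a : R) : measurable_fun D f ->
  measurable (D `&` [set x | a < `|f x|]).
Proof.
move=> mf; have := measurableT_comp (@normr_measurable R setT) mf.
move=> /(_ mD `]a, +oo[%classic (measurable_itv _)); congr measurable.
by apply/seteqP; split => x [Dx] /=; rewrite in_itv /= andbT.
Qed.

Lemma measurable_fun_level_indic f (a : R) : measurable_fun D f ->
  measurable_fun D (fun x => \1_[set x | a < `|f x|] x : R).
Proof.
move=> mf; have mS := measurable_level_lt a mf.
apply: (eq_measurable_fun (\1_(D `&` [set x | a < `|f x|]) : T -> R)).
  move=> x; rewrite inE => Dx; rewrite !indicE; congr (_%:R); congr nat_of_bool.
  by apply/idP/idP; rewrite !inE => // -[].
exact: measurable_indic.
Qed.

Lemma L1_le f g h (a b : R) : measurable_fun D f -> measurable_fun D g ->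
  measurable_fun D h -> 0 <= a -> 0 <= b ->
  (forall x, D x -> `|f x| <= a * `|g x| + b * `|h x|) ->
  (\int[mu]_(x in D) `|f x|%:E <=
   a%:E * \int[mu]_(x in D) `|g x|%:E + b%:E * \int[mu]_(x in D) `|h x|%:E)%E.
Proof.
move=> mf mg mh a0 b0 fgh.
have [mf' mg' mh'] := And3 (mEFin_norm mf) (mEFin_norm mg) (mEFin_norm mh).
rewrite -!ge0_integralZl_EFin// -ge0_integralD//; last 4 first.
- by move=> x _; rewrite mule_ge0// lee_fin.
- exact: measurable_funeM.
- by move=> x _; rewrite mule_ge0// lee_fin.
- exact: measurable_funeM.
apply: ge0_le_integral => //.
by apply: emeasurable_funD; exact: measurable_funeM.
Qed.

Lemma L1_leZ f g (a : R) : measurable_fun D f -> measurable_fun D g -> 0 <= a ->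
  (forall x, D x -> `|f x| <= a * `|g x|) ->
  (\int[mu]_(x in D) `|f x|%:E <= a%:E * \int[mu]_(x in D) `|g x|%:E)%E.
Proof.
move=> mf mg a0 fg.
have := @L1_le f g g a 0 mf mg mg a0 (lexx _) _; rewrite mul0e adde0; apply.
by move=> x Dx; rewrite mul0r addr0; exact: fg.
Qed.

Lemma integrable_bounded_mul f (b : T -> R) (C : R) :
  mu.-integrable D (EFin \o f) -> measurable_fun D b ->
  (forall x, D x -> `|b x| <= C) -> mu.-integrable D (fun x => (f x * b x)%:E).
Proof.
move=> fi mb bC.
have := @integrableMl _ _ _ mu _ mD (EFin \o f) b fi mb.
apply; exists C; split; first exact: num_real.
by move=> y Cy x Dx; rewrite /= (le_trans (bC _ Dx))// ltW.
Qed.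

Lemma integrable_measurable f : mu.-integrable D (EFin \o f) -> measurable_fun D f.
Proof. by case/integrableP => /measurable_EFinP. Qed.

Lemma integrableB_fun f g : mu.-integrable D (fun x => (f x)%:E) ->
  mu.-integrable D (fun x => (g x)%:E) -> mu.-integrable D (fun x => (f x - g x)%:E).
Proof. by move=> fi gi; have := integrableB mD fi gi; exact. Qed.

Lemma cvg_Rintegral_mul (f_ : nat -> T -> R) f (b : T -> R) (C : R) : 0 <= C ->
  (forall j, mu.-integrable D (EFin \o f_ j)) -> mu.-integrable D (EFin \o f) ->
  measurable_fun D b -> (forall x, D x -> `|b x| <= C) ->
  (\int[mu]_(x in D) `|f_ j x - f x|%:E)%E @[j --> \oo] --> 0%E ->
  \int[mu]_(x in D) (f_ j x * b x) @[j --> \oo] --> \int[mu]_(x in D) (f x * b x).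
Proof.
move=> C0 fj fi mb bC; move=> lim0.
have f_0 j : (0 <= \int[mu]_(x in D) `|f_ j x - f x|%:E)%E by apply: integral_ge0.
have lim := (cvge0P f_0).1 lim0.
apply/cvgrPdist_le => e e0.
have e1 : 0 < e / (C + 1) by rewrite divr_gt0// ltr_wpDl.
near=> j.
have H : (\int[mu]_(x in D) `|f_ j x - f x|%:E <= (e / (C + 1))%:E)%E.
  by near: j; exact: lim.
have fb := integrable_bounded_mul fi mb bC.
have fjb := integrable_bounded_mul (fj j) mb bC.
rewrite -RintegralB//.
apply: (@le_trans _ _ (\int[mu]_(x in D) `|f x * b x - f_ j x * b x|)).
  by apply: le_normr_Rintegral => //; exact: (integrableB_fun fb fjb).
have mF : measurable_fun D (fun x => f x * b x - f_ j x * b x).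
  exact: (integrable_measurable (integrableB_fun fb fjb)).
have mG : measurable_fun D (fun x => f_ j x - f x).
  exact: (integrable_measurable (integrableB_fun (fj j) fi)).
have L : (\int[mu]_(x in D) `|f x * b x - f_ j x * b x|%:E <= e%:E)%E.
  apply: (le_trans (L1_leZ mF mG C0 _)) => [x Dx|].
    rewrite -mulrBl normrM mulrC distrC ler_wpM2r//; exact: bC.
  apply: (@le_trans _ _ (C%:E * (e / (C + 1))%:E)%E).
    by rewrite lee_wpmul2l// lee_fin.
  rewrite -EFinM lee_fin mulrA ler_pdivrMr ?ltr_wpDl// mulrC ler_wpM2l ?(ltW e0)//.
  by rewrite lerDl.
rewrite /Rintegral -lee_fin fineK//.
by rewrite ge0_fin_numE ?(le_lt_trans L) ?ltry//; apply: integral_ge0.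
Unshelve. all: by end_near. Qed.

(** An integrable function is small in mean where it is large, by dominated
    convergence. *)
Lemma tail_integral_small f (e : R) : mu.-integrable D (EFin \o f) -> 0 < e ->
  exists2 N : R, 0 < N &
   (\int[mu]_(x in D) `|f x * \1_[set x | N < `|f x|] x|%:E <= e%:E)%E.
Proof.
move=> fi e0; have mf := integrable_measurable fi.
pose f_ (k : nat) x := `|f x * \1_[set x | k%:R < `|f x|] x|%:E.
have mf_ k : measurable_fun D (f_ k).
  by apply: mEFin_norm; apply: measurable_funM => //; exact: measurable_fun_level_indic.
have f_f : {ae mu, forall x, D x -> f_ ^~ x @ \oo --> (0%E : \bar R)}.
  apply: aeW => x Dx; apply: cvg_near_cst; near=> k.
  rewrite /f_ indicE memNset ?mulr0 ?normr0//=; apply/negP; rewrite -leNgt.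
  apply: (le_trans (ltW (archi_boundP (normr_ge0 (f x))))).
  by rewrite ler_nat; near: k; exact: nbhs_infty_ge.
have f_g : {ae mu, forall x k, D x -> (`|f_ k x| <= (abse \o (EFin \o f)) x)%E}.
  apply: aeW => x k Dx; rewrite /f_ /= lee_fin normr_id normrM ler_piMr//.
  by rewrite indicE; case: (_ \in _); rewrite ?normr1 ?normr0.
have [_ _ lim] := @dominated_convergence _ _ _ mu _ mD f_ (cst 0%E) (abse \o (EFin \o f)) mf_
  (measurable_cst _) f_f (integrable_abse fi) f_g.
have lim0 : (fun k => \int[mu]_(x in D) f_ k x)%E @ \oo --> 0%E.
  by move: lim; rewrite integral0.
have f0 k : (0 <= \int[mu]_(x in D) f_ k x)%E by apply: integral_ge0 => x _; rewrite /f_ lee_fin.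
have := (cvge0P f0).1 lim0 => /(_ _ e0) [k _ /(_ (k.+1) (leqnSn k)) H]; exists k.+1%:R => //.
Unshelve. all: by end_near. Qed.

(** The factors [g_ j] are bounded and tend to 0 in mean only, and the product with a
    merely integrable [f] still tends to 0: where [|f| > N] the boundedness and
    [tail_integral_small] are used, elsewhere the convergence in mean. *)
Lemma cvg0_mul_L1 (g_ f_ : nat -> T -> R) f (M K : R) : 0 <= M -> 0 <= K ->
  mu.-integrable D (EFin \o f) ->
  (forall j, measurable_fun D (g_ j)) -> (forall j, measurable_fun D (f_ j)) ->
  (forall j x, D x -> `|g_ j x| <= M) -> (forall j x, D x -> `|g_ j x| <= K * `|f_ j x|) ->
  (\int[mu]_(x in D) `|f_ j x|%:E)%E @[j --> \oo] --> 0%E ->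
  (\int[mu]_(x in D) `|g_ j x * f x|%:E)%E @[j --> \oo] --> 0%E.
Proof.
move=> M0 K0 fi mg mf_ gM gK.
move=> lim0; apply/cvge0P => [j|e e0]; first exact: integral_ge0.
have f_0 j : (0 <= \int[mu]_(x in D) `|f_ j x|%:E)%E by apply: integral_ge0.
have lim := (cvge0P f_0).1 lim0; have mf := integrable_measurable fi.
have e1 : 0 < e / 2 / (M + 1) by rewrite !divr_gt0// ltr_wpDl.
have [N N0 fN] := tail_integral_small fi e1.
have e2 : 0 < e / 2 / (N * K + 1) by rewrite !divr_gt0// ltr_wpDl// mulr_ge0// ltW.
near=> j.
have H : (\int[mu]_(x in D) `|f_ j x|%:E <= (e / 2 / (N * K + 1))%:E)%E.
  by near: j; exact: lim.
have mN : measurable_fun D (fun x => f x * \1_[set x | N < `|f x|] x).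
  by apply: measurable_funM => //; exact: measurable_fun_level_indic.
have mgf : measurable_fun D (fun x => g_ j x * f x) by exact: measurable_funM.
have NK0 : 0 <= N * K by rewrite mulr_ge0// ltW.
apply: (le_trans (L1_le mgf mN (mf_ j) M0 NK0 _)) => [x Dx|].
  rewrite indicE normrM; have [xN|xN] := ltP N `|f x|.
    rewrite mem_set// mulr1 -[leLHS]addr0 lerD ?mulr_ge0 ?(ltW N0)//.
    by rewrite ler_wpM2r// gM.
  rewrite memNset/=; last by apply/negP; rewrite -leNgt.
  rewrite mulr0 normr0 mulr0 add0r -mulrA mulrC ler_pM// gK//.
apply: (@le_trans _ _ ((M * (e / 2 / (M + 1)))%:E + (N * K * (e / 2 / (N * K + 1)))%:E)%E).
  by rewrite !EFinM; apply: leeD; rewrite lee_wpmul2l// lee_fin.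
have aux (a : R) : 0 <= a -> a * (e / 2 / (a + 1)) <= e / 2.
  move=> a0; rewrite mulrA ler_pdivrMr ?ltr_wpDl// mulrC ler_wpM2l// ?divr_ge0 ?(ltW e0)//.
  by rewrite lerDl.
rewrite -EFinD lee_fin; have := aux _ M0; have := aux _ NK0; lra.
Unshelve. all: by end_near. Qed.

End L1_tools.

(** * Weak derivatives and the chain rule *)

Section Lp_facts.
Context {R : realType} {n : nat}.
Local Notation V := 'rV[R]_n.
Local Notation mu := (@rV_lebesgue R n).
Variables (Om : set V) (mOm : measurable Om).

Lemma measurable_powR_norm (r : R) (f : V -> R) : measurable_fun Om f ->
  measurable_fun Om (fun x => `|f x| `^ r).
Proof.
by move=> mf; apply: (measurableT_comp (measurable_powR r)); exact: measurableT_comp.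
Qed.

Lemma LpP (r : R) (f : V -> R) : 0 < r -> Lp Om r f <->
  (measurable_fun Om f /\ mu.-integrable Om (fun x => (`|f x| `^ r)%:E)).
Proof.
move=> r0; have rn0 : r != 0 by rewrite gt_eqF.
have E : (\int[mu]_x (`|(EFin \o (f \_ Om)) x| `^ r) =
    \int[mu]_(x in Om) `|(`|f x| `^ r)%:E|)%E.
  rewrite [RHS]integral_mkcond; congr integral; apply/funext => x.
  rewrite /= /patch; case: ifPn => _.
    by rewrite (ger0_norm (powR_ge0 _ _)).
  by rewrite normr0 powR0.
have N0 := Lnorm_ge0 mu r%:E (EFin \o (f \_ Om)).
split=> -[mf fr]; split => //.
- apply/integrableP; split.
    by apply/measurable_EFinP; exact: measurable_powR_norm.
  by rewrite -E -(poweR_Lnorm mu (EFin \o (f \_ Om)) rn0) poweR_lty.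
- move: fr => /integrableP[_]; rewrite -E -(poweR_Lnorm mu (EFin \o (f \_ Om)) rn0) => H.
  rewrite /finite_norm -[X in (X < _)%E](@poweRe1 _ _ N0) -(mulfV rn0) poweRrM.
  exact: poweR_lty.
Qed.

Lemma Lp1P (f : V -> R) : Lp Om 1 f <-> mu.-integrable Om (EFin \o f).
Proof.
rewrite LpP//; split => [[mf fi]|fi].
  apply: le_integrable fi => //; first exact/measurable_EFinP.
  by move=> x Ox /=; rewrite powRr1// normr_id.
have mf := integrable_measurable fi; split => //.
apply: (le_integrable mOm _ _ (integrable_abse fi)).
  by apply/measurable_EFinP; exact: measurable_powR_norm.
by move=> x Ox /=; rewrite powRr1// normr_id.
Qed.

End Lp_facts.

Section weak_derivatives.
Context {R : realType} {n : nat}.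
Local Notation V := 'rV[R]_n.
Local Notation mu := (@rV_lebesgue R n).
Variables (Om : set V) (oOm : open Om).
Implicit Types (k : 'I_n) (v w g phi psi : V -> R).

Let mOm : measurable Om := open_rV_measurable oOm.

Lemma integrable_L1loc g : mu.-integrable Om (EFin \o g) -> L1loc Om g.
Proof.
move=> gi; split; first exact: integrable_measurable gi.
move=> K cK KOm.
have /integrableP[_] := integrableS mOm (compact_rV_measurable cK) KOm gi.
exact.
Qed.

Lemma L1locB g g' : L1loc Om g -> L1loc Om g' -> L1loc Om (fun x => g x - g' x).
Proof.
move=> [mg gK] [mg' gK']; split; first exact: measurable_funB.
move=> K cK KOm; have mK := compact_rV_measurable cK.
have I : mu.-integrable K (EFin \o g).
  apply/integrableP; split; last exact: gK.
  by apply/measurable_EFinP; apply: measurable_funS mg.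
have I' : mu.-integrable K (EFin \o g').
  apply/integrableP; split; last exact: gK'.
  by apply/measurable_EFinP; apply: measurable_funS mg'.
by have /integrableP[_] := integrableB_fun mK I I'.
Qed.

Lemma weak_partial_unique k v g g' : is_weak_partial Om k v g ->
  is_weak_partial Om k v g' -> {ae mu, forall x, Om x -> g x = g' x}.
Proof.
move=> [Lg gE] [Lg' g'E].
have := @test_orthogonal_ae0 _ _ _ oOm _ (L1locB Lg Lg').
have H phi : test_fun Om phi -> \int[mu]_(x in Om) ((g x - g' x) * phi x) = 0.
  move=> tphi; under eq_Rintegral do rewrite mulrBl.
  rewrite RintegralB ?(L1loc_test_integrable oOm _ tphi)//.
  by apply/eqP; rewrite subr_eq0 -eqr_opp -gE// -g'E.
by move=> /(_ H); apply: filterS => x gx /gx /eqP; rewrite subr_eq0 => /eqP.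
Qed.

Lemma weakD_spec k v : (exists g, is_weak_partial Om k v g) ->
  is_weak_partial Om k v (weakD Om k v).
Proof. by move=> [g Hg]; rewrite /weakD; apply: xgetPex; exists g. Qed.

Lemma test_fun_bmul v phi : mu.-integrable Om (EFin \o v) -> test_fun Om phi ->
  mu.-integrable Om (fun x => (v x * phi x)%:E).
Proof. move=> vi tphi; apply: (L1loc_test_integrable oOm _ tphi); exact: integrable_L1loc. Qed.

Lemma partial_measurable k phi : test_fun Om phi -> measurable_fun Om (partial k phi).
Proof. by move=> [sphi _ _]; apply: continuous_rV_measurable; exact: smooth_partial_cont. Qed.

Lemma partial_bmul k v phi : mu.-integrable Om (EFin \o v) -> test_fun Om phi ->
  mu.-integrable Om (fun x => (v x * partial k phi x)%:E).
Proof.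
move=> vi tphi; have [C C0 CP] := partial_test_fun_bounded tphi k.
by apply: (integrable_bounded_mul mOm vi (partial_measurable k tphi)) => x _; exact: CP.
Qed.

Lemma is_weak_partialD k v w g g' :
  mu.-integrable Om (EFin \o v) -> mu.-integrable Om (EFin \o w) ->
  mu.-integrable Om (EFin \o g) -> mu.-integrable Om (EFin \o g') ->
  is_weak_partial Om k v g -> is_weak_partial Om k w g' ->
  is_weak_partial Om k (fun x => v x + w x) (fun x => g x + g' x).
Proof.
move=> vi wi gi gi' [Lg gE] [Lg' g'E]; split.
  apply: integrable_L1loc; have := integrableD mOm gi gi'; exact.
move=> phi tphi; under eq_Rintegral do rewrite mulrDl.
rewrite RintegralD//; try exact: partial_bmul.
rewrite gE// g'E// -opprD; congr (- _).
under [in RHS]eq_Rintegral do rewrite mulrDl.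
by rewrite RintegralD//; exact: test_fun_bmul.
Qed.

Lemma test_fun_integrable_Om phi : test_fun Om phi -> mu.-integrable Om (EFin \o phi).
Proof. by move=> tphi; apply: integrableS (test_fun_integrable tphi). Qed.

Lemma partial_integrable_Om k phi : test_fun Om phi ->
  mu.-integrable Om (EFin \o partial k phi).
Proof. by move=> tphi; apply: integrableS (partial_test_fun_integrable tphi k). Qed.

Lemma integral_partial_Om0 k phi : test_fun Om phi ->
  \int[mu]_(x in Om) (partial k phi x) = 0.
Proof.
move=> tphi; have [_ _ KOm] := tphi.
rewrite /Rintegral.
have -> : (\int[mu]_(x in Om) (partial k phi x)%:E = 0)%E; last by [].
rewrite -[RHS](integral_partial_test_fun tphi k); apply: integral_supp => x nOm.
by rewrite partial_out// => /KOm.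
Qed.

Lemma integration_by_parts_test k psi phi : test_fun Om psi -> test_fun Om phi ->
  \int[mu]_(x in Om) (psi x * partial k phi x) =
  - \int[mu]_(x in Om) (partial k psi x * phi x).
Proof.
move=> tpsi tphi; have [spsi _ _] := tpsi; have [sphi _ _] := tphi.
have := integral_partial_Om0 k (test_funM spsi tphi).
under eq_Rintegral => x _.
  rewrite partialM; [|exact: smooth_derivable..].
  rewrite (mulrC (phi x)); over.
rewrite RintegralD//; last 2 first.
- by apply: partial_bmul => //; exact: test_fun_integrable_Om.
- by apply: test_fun_bmul => //; exact: partial_integrable_Om.
by move/eqP; rewrite addr_eq0 => /eqP.
Qed.

(** Weak derivatives are closed under convergence in mean, so they need only be
    computed on test functions. *)
Lemma is_weak_partial_lim k w g (psi : nat -> V -> R) :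
  (forall j, test_fun Om (psi j)) ->
  mu.-integrable Om (EFin \o w) -> mu.-integrable Om (EFin \o g) ->
  (\int[mu]_(x in Om) `|psi j x - w x|%:E)%E @[j --> \oo] --> 0%E ->
  (\int[mu]_(x in Om) `|partial k (psi j) x - g x|%:E)%E @[j --> \oo] --> 0%E ->
  is_weak_partial Om k w g.
Proof.
move=> tpsi wi gi psiw psig; split; first exact: integrable_L1loc.
move=> phi tphi.
have [C C0 CP] := partial_test_fun_bounded tphi k; have [C' C'0 CP'] := test_fun_bounded tphi.
have mphi : measurable_fun Om phi by apply: continuous_rV_measurable; apply: smooth_cont; case: tphi.
have L1 := cvg_Rintegral_mul mOm (ltW C0) (fun j => test_fun_integrable_Om (tpsi j)) wi
  (partial_measurable k tphi) (fun x _ => CP x) psiw.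
have L2 := cvg_Rintegral_mul mOm (ltW C'0) (fun j => partial_integrable_Om k (tpsi j)) gi
  mphi (fun x _ => CP' x) psig.
have L3 := cvgN L2.
have E : (fun j => \int[mu]_(x in Om) (psi j x * partial k phi x)) =
   (fun j => - \int[mu]_(x in Om) (partial k (psi j) x * phi x)).
  by apply/funext => j; exact: integration_by_parts_test.
rewrite E in L1.
have <- := cvg_lim (@Rhausdorff R) L1.
by apply: (cvg_lim (@Rhausdorff R)); exact: L3.
Qed.


Section chain_rule.
Variables (g g' : R -> R).
Hypotheses (Sg : flat_class g) (Sg' : flat_class g').
Hypotheses (Dg : forall s : R, is_derive s 1 g (g' s)) (g0 : g 0 = 0).

Lemma test_fun_comp phi : test_fun Om phi -> test_fun Om (fun x => g (phi x)).
Proof.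
move=> tphi; have [sphi _ _] := tphi; apply: (test_fun_le _ tphi) => [|x ->]; last exact: g0.
exact: smooth_comp (@smooth_flat_class R) Sg sphi.
Qed.

Lemma partial_comp k phi x : smooth phi ->
  partial k (fun x => g (phi x)) x = g' (phi x) * partial k phi x.
Proof.
move=> sphi; have dphi : derivable phi x (delta_mx 0 k) by exact: smooth_derivable.
by have [] := is_derive_comp1 (Dg (phi x)) (derivableP dphi).
Qed.

Let mg : measurable_fun setT g.
Proof. by apply: continuous_measurable_fun; apply: smooth_class_cont Sg; exact: smooth_flat_class. Qed.

Let mg' : measurable_fun setT g'.
Proof. by apply: continuous_measurable_fun; apply: smooth_class_cont Sg'; exact: smooth_flat_class. Qed.

Variables (v : V -> R) (v0 : W11_0 Om v).

Let vi : mu.-integrable Om (EFin \o v).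
Proof. by case: v0 => -[/(Lp1P mOm)]. Qed.

Let Dvi k : mu.-integrable Om (EFin \o weakD Om k v).
Proof. by case: v0 => -[_ /(_ k)[_ /(Lp1P mOm)]]. Qed.

Let mv : measurable_fun Om v. Proof. exact: integrable_measurable vi. Qed.

Let mDv k : measurable_fun Om (weakD Om k v).
Proof. exact: integrable_measurable (Dvi k). Qed.

Let mw : measurable_fun Om (fun x => g (v x)).
Proof. exact: (measurableT_comp mg mv). Qed.

Let mdw : measurable_fun Om (fun x => g' (v x)).
Proof. exact: (measurableT_comp mg' mv). Qed.

Lemma comp_integrable : mu.-integrable Om (EFin \o (fun x => g (v x))).
Proof.
have [K /ltW K0 gK] := flat_class_lipschitz Sg.
have mw' : measurable_fun Om (EFin \o (fun x => g (v x))) by apply/measurable_EFinP.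
have Kvi : mu.-integrable Om (fun x => K%:E * (v x)%:E)%E by exact: integrableZl.
apply: (le_integrable mOm mw' _ Kvi) => x Ox /=.
by rewrite lee_fin normrM (ger0_norm K0); have := gK (v x) 0; rewrite g0 !subr0.
Qed.

Lemma dcomp_integrable k : mu.-integrable Om (EFin \o (fun x => g' (v x) * weakD Om k v x)).
Proof.
have [M M0 g'M] := flat_class_bounded Sg'.
have := integrable_bounded_mul mOm (Dvi k) mdw (fun x _ => g'M (v x)).
by under eq_fun do rewrite mulrC.
Qed.

(** If test functions [phi j] approximate [v], then [g (phi j)] approximate [g v].
    For the derivatives, [g' (phi j) D (phi j) - g' v D v] is split as [g' (phi j)
    (D (phi j) - D v) + (g' (phi j) - g' v) D v]; the second term is treated by
    [cvg0_mul_L1]. *)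
Lemma chain_rule_approx : exists psi : nat -> V -> R,
  [/\ forall j, test_fun Om (psi j),
      (\int[mu]_(x in Om) `|psi j x - g (v x)|%:E)%E @[j --> \oo] --> 0%E &
      forall k, (\int[mu]_(x in Om) `|partial k (psi j) x -
         g' (v x) * weakD Om k v x|%:E)%E @[j --> \oo] --> 0%E].
Proof.
have [K /ltW K0 gK] := flat_class_lipschitz Sg.
have [K' /ltW K'0 g'K] := flat_class_lipschitz Sg'.
have [M /ltW M0 g'M] := flat_class_bounded Sg'.
have [_ [phi [tphi phiv Dphiv]]] := v0.
have mphi j : measurable_fun Om (phi j).
  by apply: continuous_rV_measurable; apply: smooth_cont; case: (tphi j).
have mphiv j : measurable_fun Om (fun x => phi j x - v x) by exact: measurable_funB.
exists (fun j x => g (phi j x)); split => [j||k]; first exact: test_fun_comp.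
- apply/cvge0P => [j|e e0]; first exact: integral_ge0.
  have p0 j : (0 <= \int[mu]_(x in Om) `|phi j x - v x|%:E)%E by exact: integral_ge0.
  have eK : 0 < e / (K + 1) by rewrite divr_gt0// ltr_wpDl.
  have := (cvge0P p0).1 phiv _ eK; apply: filterS => j H.
  have mgg : measurable_fun Om (fun x => g (phi j x) - g (v x)).
    by apply: measurable_funB; [exact: (measurableT_comp mg (mphi j))|exact: mw].
  apply: (le_trans (L1_leZ mu mOm mgg (mphiv j) K0 (fun x _ => gK _ _))).
  apply: (@le_trans _ _ (K%:E * (e / (K + 1))%:E)%E).
    by rewrite lee_wpmul2l// lee_fin.
  rewrite -EFinM lee_fin mulrA ler_pdivrMr ?ltr_wpDl// mulrC ler_wpM2l ?(ltW e0)//.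
  by rewrite lerDl.
- pose G_ j x := g' (phi j x) - g' (v x).
  have mG j : measurable_fun Om (G_ j).
    by apply: measurable_funB; [exact: (measurableT_comp mg' (mphi j))|exact: mdw].
  have mDphi j : measurable_fun Om (partial k (phi j)) by exact: partial_measurable.
  have mDB j : measurable_fun Om (fun x => partial k (phi j) x - weakD Om k v x).
    exact: measurable_funB.
  have GM j x : Om x -> `|G_ j x| <= M + M.
    by move=> _; rewrite (le_trans (ler_normB _ _))// lerD.
  have GK j x : Om x -> `|G_ j x| <= K' * `|phi j x - v x| by move=> _; exact: g'K.
  have MM0 : 0 <= M + M by rewrite addr_ge0.
  have lim := cvg0_mul_L1 mOm MM0 K'0 (Dvi k) mG mphiv GM GK phiv.
  apply/cvge0P => [j|e e0]; first exact: integral_ge0.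
  have p0 j : (0 <= \int[mu]_(x in Om) `|partial k (phi j) x - weakD Om k v x|%:E)%E.
    exact: integral_ge0.
  have q0 j : (0 <= \int[mu]_(x in Om) `|G_ j x * weakD Om k v x|%:E)%E by exact: integral_ge0.
  have e2 : 0 < e / 2 by rewrite divr_gt0.
  have e3 : 0 < e / 2 / (M + 1) by rewrite divr_gt0// ltr_wpDl.
  have := (cvge0P q0).1 lim _ e2; have := (cvge0P p0).1 (Dphiv k) _ e3.
  apply: filterS2 => j H1 H2.
  have mF : measurable_fun Om (fun x => partial k (fun x => g (phi j x)) x -
      g' (v x) * weakD Om k v x).
    apply: measurable_funB; first exact: (partial_measurable k (test_fun_comp (tphi j))).
    exact: measurable_funM.
  have mGD : measurable_fun Om (fun x => G_ j x * weakD Om k v x) by exact: measurable_funM.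
  apply: (le_trans (L1_le mu mOm mF (mDB j) mGD M0 ler01 _)) => [x _|].
    rewrite partial_comp; last by case: (tphi j).
    rewrite mul1r (_ : _ - _ = g' (phi j x) * (partial k (phi j) x - weakD Om k v x) +
       G_ j x * weakD Om k v x); last by rewrite /G_; ring.
    by rewrite (le_trans (ler_normD _ _))// lerD// normrM ler_wpM2r.
  apply: (@le_trans _ _ (M%:E * (e / 2 / (M + 1))%:E + (e / 2)%:E)%E).
    by rewrite mul1e leeD// lee_wpmul2l// lee_fin.
  rewrite -EFinM -EFinD lee_fin.
  suff : M * (e / 2 / (M + 1)) <= e / 2 by lra.
  rewrite mulrA ler_pdivrMr ?ltr_wpDl// mulrC ler_wpM2l ?(ltW e2)//.
  by rewrite lerDl.
Qed.

Lemma chain_rule_partial k :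
  is_weak_partial Om k (fun x => g (v x)) (fun x => g' (v x) * weakD Om k v x).
Proof.
have [psi [tpsi psiw psig]] := chain_rule_approx.
exact: (is_weak_partial_lim tpsi comp_integrable (dcomp_integrable k) psiw (psig k)).
Qed.

Lemma chain_rule_weakD k : {ae mu, forall x, Om x ->
  weakD Om k (fun x => g (v x)) x = g' (v x) * weakD Om k v x}.
Proof.
apply: weak_partial_unique (chain_rule_partial k).
by apply: weakD_spec; eexists; exact: chain_rule_partial.
Qed.

End chain_rule.

End weak_derivatives.

(** * The weak Sobolev inequality for truncations *)

Section ae_tools.
Context d (T : measurableType d) (R : realType) (mu : {measure set T -> \bar R}).
Variables (D : set T) (mD : measurable D).

Lemma ae_L1_eq (f g : T -> R) : measurable_fun D f -> measurable_fun D g ->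
  {ae mu, forall x, D x -> f x = g x} ->
  (\int[mu]_(x in D) `|f x|%:E = \int[mu]_(x in D) `|g x|%:E)%E.
Proof.
move=> mf mg fg; apply: ae_eq_integral; [exact: mD|exact: mEFin_norm..|].
by move: fg; apply: filterS => x fg Dx; rewrite fg.
Qed.

Lemma ae_integrable (f g : T -> R) : mu.-integrable D (EFin \o f) ->
  measurable_fun D g -> {ae mu, forall x, D x -> f x = g x} ->
  mu.-integrable D (EFin \o g).
Proof.
move=> fi mg fg; have mf := integrable_measurable fi.
apply/integrableP; split; first exact/measurable_EFinP.
rewrite -[X in (X < _)%E](ae_L1_eq mf mg fg).
by case/integrableP: fi.
Qed.

Lemma markov_level (f : T -> R) (a : R) : measurable_fun D f -> 0 < a ->
  (mu (D `&` [set x | (a <= `|f x|)%R]) <= (a^-1)%:E * \int[mu]_(x in D) `|f x|%:E)%E.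
Proof.
move=> mf a0.
have := @le_integral_comp_abse _ _ _ mu D mD (EFin \o f) a id (@measurable_id _ _ setT)
   (fun r h => h) (fun x y _ _ h => h).
move=> /(_ ((measurable_EFinP _ _).2 mf) a0) /= H.
have a0' : (0 <= (a^-1)%:E :> \bar R)%E by rewrite lee_fin invr_ge0 ltW.
rewrite -[leLHS]mul1e -(_ : ((a^-1)%:E * a%:E = 1 :> \bar R)%E).
  by rewrite -muleA lee_wpmul2l.
by rewrite -EFinM mulVf ?gt_eqF.
Qed.

End ae_tools.

Section chain_rule_spaces.
Context {R : realType} {n : nat}.
Local Notation V := 'rV[R]_n.
Local Notation mu := (@rV_lebesgue R n).
Variables (Om : set V) (oOm : open Om).
Let mOm : measurable Om := open_rV_measurable oOm.
Variables (g g' : R -> R).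
Hypotheses (Sg : flat_class g) (Sg' : flat_class g').
Hypotheses (Dg : forall s : R, is_derive s 1 g (g' s)) (g0 : g 0 = 0).
Variables (v : V -> R) (v0 : W11_0 Om v).

Let gv (x : V) := g (v x).
Let gi := comp_integrable oOm Sg g0 v0.
Let dgi := dcomp_integrable oOm Sg' v0.
Let part := chain_rule_partial oOm Sg Sg' Dg g0 v0.

Let aeD k : {ae mu, forall x, Om x -> g' (v x) * weakD Om k v x = weakD Om k gv x}.
Proof.
by have := chain_rule_weakD oOm Sg Sg' Dg g0 v0 k; apply: filterS => x H /H.
Qed.

Let mD k : measurable_fun Om (weakD Om k gv).
Proof. by have [[]] : is_weak_partial Om k gv (weakD Om k gv) by apply: weakD_spec; eexists; exact: part. Qed.

Lemma chain_rule_W11_0 : W11_0 Om gv.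
Proof.
split.
  split; first exact/(Lp1P mOm).
  move=> k; split; first by eexists; exact: part.
  by apply/(Lp1P mOm); exact: (ae_integrable mOm (dgi k) (mD k) (aeD k)).
have [psi [tpsi psiw psig]] := chain_rule_approx oOm Sg Sg' Dg g0 v0.
exists psi; split => // k.
have E : (fun j => \int[mu]_(x in Om) `|partial k (psi j) x - weakD Om k gv x|%:E)%E =
   (fun j => \int[mu]_(x in Om) `|partial k (psi j) x - g' (v x) * weakD Om k v x|%:E)%E.
  apply/funext => j; apply: (ae_L1_eq mOm).
  - by apply: measurable_funB; [exact: partial_measurable|exact: mD].
  - by apply: measurable_funB; [exact: partial_measurable|exact: (integrable_measurable (dgi k))].
  - by have := aeD k; apply: filterS => x H /H ->.
by rewrite E; exact: psig.
Qed.

Lemma chain_rule_W1_0 (p : R) : 0 < p -> (forall k, Lp Om p (weakD Om k v)) -> W1_0 Om p gv.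
Proof.
move=> p0 vp; split; first exact: chain_rule_W11_0.
have [M /ltW M0 g'M] := flat_class_bounded Sg'.
move=> k; apply/(LpP Om _ p0); split; first exact: mD.
have [mv vi] := (LpP Om _ p0).1 (vp k).
apply: (@ae_integrable _ _ _ mu _ mOm (fun x => `|g' (v x) * weakD Om k v x| `^ p)).
- have mdg := measurable_powR_norm p (integrable_measurable (dgi k)).
  apply: (le_integrable mOm _ _ (integrableZl mOm (M `^ p) vi)).
    exact/measurable_EFinP.
  move=> x Ox /=; rewrite lee_fin (ger0_norm (powR_ge0 _ _)) (ger0_norm (mulr_ge0 (powR_ge0 _ _) (powR_ge0 _ _))).
  rewrite normrM powRM//; rewrite ler_wpM2r ?powR_ge0//.
  by apply: ge0_ler_powR; rewrite ?nnegrE ?(ltW p0).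
- by apply: measurable_powR_norm; exact: mD.
- by have := aeD k; apply: filterS => x H /H ->.
Qed.

End chain_rule_spaces.

Section truncated_sobolev.
Context {R : realType} {n : nat}.
Local Notation V := 'rV[R]_n.+1.
Local Notation mu := (@rV_lebesgue R n.+1).
Variables (Om : set V) (oOm : open Om).
Let mOm : measurable Om := open_rV_measurable oOm.

Lemma le_of_root (A : \bar R) (Y : R) : (0 < n)%N -> 0 <= Y ->
  (forall c : R, 0 <= c -> (c%:E <= A)%E -> c ^+ n <= Y ^+ n) -> (A <= Y%:E)%E.
Proof.
move=> n0 Y0 H.
have key c : 0 <= c -> (c%:E <= A)%E -> c <= Y.
  by move=> c0 /(H _ c0); rewrite ler_pXn2r// nnegrE.
rewrite leNgt; apply/negP => YA.
case: A key YA {H} => [r| |]; last by [].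
- move=> key; rewrite lte_fin => Yr.
  have := key r (le_trans Y0 (ltW Yr)) (lexx _).
  by rewrite leNgt Yr.
- move=> key _; have := key (Y + 1) _ (leey _); rewrite addr_ge0// => /(_ isT).
  by rewrite gerDl ler10.
Qed.

Variables (v : V -> R) (v0 : W11_0 Om v).

(** A test function [psi] close to [excess L v] in [W^1,1] is chosen. Where [|v|
    >= 2 L], either [psi] is at least [lam], which [weak_sobolev] controls, or its
    distance from [excess L v] is, which the choice of [psi] and the Markov
    inequality control; both sets have measure at most [Y]. A weak-type inequality
    does not pass to limits without such a splitting, which costs the factor 2. *)
Lemma truncated_sobolev (L E : R) : (0 < n)%N -> 0 < L -> 0 < E ->
  (forall k, \int[mu]_(x in Om) `|dexcess L (v x) * weakD Om k v x|%:E <= E%:E)%E ->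
  (mu (Om `&` [set x | (2 * L <= `|v x|)%R]) <=
    (2 * (4 * expR 1 * E / L) `^ (n.+1%:R / n%:R))%:E)%E.
Proof.
move=> n0 L0 E0 HE.
have Ln0 : L != 0 by rewrite gt_eqF.
(* Half of the lower bound for [excess L v] in [excess_large]. *)
pose lam : R := L * expR (-1) / 2.
have lam0 : 0 < lam by rewrite divr_gt0// mulr_gt0// expR_gt0.
have lamE : 4 * expR 1 * E / L = 2 * E / lam.
  rewrite /lam expRN; field.
  by rewrite gt_eqF// expR_gt0.
set B := 4 * expR 1 * E / L in lamE *.
have B0 : 0 < B by rewrite lamE divr_gt0// mulr_gt0.
set Y := B `^ _.
have Y0 : 0 < Y by apply: powR_gt0.
have YB : Y ^+ n = B ^+ n.+1.
  rewrite -(powR_mulrn _ (powR_ge0 _ _)) /Y -powRrM divfK ?pnatr_eq0 -?lt0n//.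
  by rewrite powR_mulrn// ltW.
have St := excess_class L; have Sd := dexcess_class L.
have Dt s := is_derive_excess s Ln0.
have [psi [tpsi psiw psig]] := chain_rule_approx oOm St Sd Dt (excess0 L) v0.
have wi := comp_integrable oOm St (excess0 L) v0.
have gi k := dcomp_integrable oOm Sd v0 k.
have lamY : 0 < lam * Y by rewrite mulr_gt0.
have w0 j : (0 <= \int[mu]_(x in Om) `|psi j x - excess L (v x)|%:E)%E by exact: integral_ge0.
have d0 k j : (0 <= \int[mu]_(x in Om) `|partial k (psi j) x -
   dexcess L (v x) * weakD Om k v x|%:E)%E by exact: integral_ge0.
have [j [psiY psiE]] : exists j,
   (\int[mu]_(x in Om) `|psi j x - excess L (v x)|%:E <= (lam * Y)%:E)%E /\
   forall k, (\int[mu]_(x in Om) `|partial k (psi j) x -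
     dexcess L (v x) * weakD Om k v x|%:E <= E%:E)%E.
  have H1 := (cvge0P w0).1 psiw _ lamY.
  have H2 : \forall j \near \oo, forall k, (\int[mu]_(x in Om) `|partial k (psi j) x -
     dexcess L (v x) * weakD Om k v x|%:E <= E%:E)%E.
    by apply: filter_forall => k; exact: (cvge0P (d0 k)).1 (psig k) _ E0.
  have [N _ HN] := filterI H1 H2.
  by exists N; have [] := HN N (leqnn N).
have tj := tpsi j.
have mpsi : measurable_fun Om (psi j).
  by apply: continuous_rV_measurable; apply: smooth_cont; case: tj.
have mdiff : measurable_fun Om (fun x => psi j x - excess L (v x)).
  by apply: measurable_funB; [exact: mpsi|exact: (integrable_measurable wi)].
have psiJ k : (\int[mu]_x `|partial k (psi j) x|%:E <= (2 * E)%:E)%E.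
  have [_ _ KOm] := tj.
  rewrite -(@integral_supp _ _ _ mu Om); last first.
    by move=> x nx; rewrite partial_out ?normr0// => /KOm.
  have mp := partial_measurable k tj.
  have mg := integrable_measurable (gi k).
  have mpg : measurable_fun Om (fun x => partial k (psi j) x - dexcess L (v x) * weakD Om k v x).
    by apply: measurable_funB.
  apply: (le_trans (L1_le mu mOm mp mpg mg ler01 ler01 _)) => [x _|].
    by rewrite !mul1r -[X in `|X| <= _](subrK (dexcess L (v x) * weakD Om k v x)) ler_normD.
  by rewrite !mul1e mulr2n mulrDl mul1r EFinD; apply: leeD.
pose A1 := [set x | lam <= `|psi j x|].
have mA1 : measurable A1.
  rewrite -[X in measurable X]setTI; apply: measurable_level_le => //.
  by apply: continuous_rV_measurable; apply: smooth_cont; case: tj.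
have A1Y : (mu A1 <= Y%:E)%E.
  apply: (le_of_root n0 (ltW Y0)) => c c0 cA.
  have E20 (i : 'I_n.+1) : 0 < 2 * E by rewrite mulr_gt0.
  have := weak_sobolev n0 tj lam0 E20 psiJ c0 cA.
  by rewrite prodr_const card_ord YB lamE.
pose A2 := Om `&` [set x | lam <= `|psi j x - excess L (v x)|].
have mA2 : measurable A2 by apply: measurable_level_le.
have A2Y : (mu A2 <= Y%:E)%E.
  apply: (le_trans (markov_level mu mOm mdiff lam0)).
  apply: (@le_trans _ _ ((lam^-1)%:E * (lam * Y)%:E)%E).
    by apply: lee_wpmul2l => //; rewrite lee_fin invr_ge0 ltW.
  by rewrite -EFinM mulKf ?gt_eqF.
apply: (@le_trans _ _ (mu (A1 `|` A2))).
  apply: le_rV_lebesgue => x [Ox vx].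
  have [|] := leP lam `|psi j x|; first by left.
  move=> plam; right; split => //=.
  have := excess_large L0 vx.
  have := ler_normB (excess L (v x) - psi j x) (- psi j x); rewrite opprK subrK normrN distrC.
  by move: plam; rewrite /lam; lra.
apply: (le_trans (measureU2 mu mA1 mA2)).
by rewrite mulr2n mulrDl mul1r EFinD; apply: leeD.
Qed.

End truncated_sobolev.

(** * Superposition with a Caratheodory function *)

Section caratheodory.
Context {R : realType} {n : nat}.
Local Notation V := 'rV[R]_n.
Local Notation mu := (@rV_lebesgue R n).
Variables (Om : set V) (mOm : measurable Om).

(** Rounding down to the grid of mesh [1 / (m + 1)]: the values form a countable
    set and converge to the given point. *)
Definition grid (m : nat) (z : 'rV[int]_n) : V := \row_j ((z 0 j)%:~R / m.+1%:R).

Definition grid_floor (m : nat) (y : V) : 'rV[int]_n :=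
  \row_j Num.floor (m.+1%:R * y 0 j).

Lemma grid_floor_cvg (y : V) : grid m (grid_floor m y) @[m --> \oo] --> y.
Proof.
apply/cvg_ballP => e e0; near=> m; rewrite rV_ball; split => // i; rewrite !mxE.
have m0 : 0 < m.+1%:R :> R by rewrite ltr0n.
have me : (m.+1%:R : R)^-1 < e.
  by near: m; have := near_infty_natSinv_lt (PosNum e0).
apply: le_lt_trans me.
have /andP[] := floor_itv (m.+1%:R * y 0 i).
set f := (_%:~R); rewrite intrD => h1 h2.
rewrite ger0_norm; last by rewrite subr_ge0 ler_pdivrMr// mulrC.
rewrite -(ler_pM2l m0) mulrBr (mulrC _ (f / _)) divfK ?mulfV ?gt_eqF//.
by move: h2; rewrite /=; lra.
Unshelve. all: by end_near. Qed.

Lemma measurable_grid_floor (G : V -> V) m (z : 'rV[int]_n) :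
  (forall j, measurable_fun Om (fun x => G x 0 j)) ->
  measurable (Om `&` [set x | grid_floor m (G x) = z]).
Proof.
move=> mG.
rewrite (_ : _ `&` _ = Om `&` \bigcap_(j in [set: 'I_n])
   (Om `&` (fun x => m.+1%:R * G x 0 j) @^-1` `[(z 0 j)%:~R, (z 0 j + 1)%:~R[%classic)).
  apply: measurableI => //; apply: fin_bigcap_measurable => // j _.
  have : measurable_fun Om (fun x => m.+1%:R * G x 0 j) by exact: measurable_funM.
  by apply => //.
apply/seteqP; split => [x [Ox /= <-]|x [Ox H]].
  split => // j _; split => //=; rewrite in_itv /= mxE.
  exact: floor_itv.
split => //=; apply/rowP => j; rewrite mxE.
have [_ /=] := H j I; rewrite in_itv /= => /andP[h1 h2].
by apply: floor_def; rewrite h1 h2.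
Qed.

Lemma measurable_comp_grid (b : V -> V -> R) (G : V -> V) m :
  (forall z, measurable_fun Om (b ^~ z)) ->
  (forall j, measurable_fun Om (fun x => G x 0 j)) ->
  measurable_fun Om (fun x => b x (grid m (grid_floor m (G x)))).
Proof.
move=> mb mG _ B mB.
rewrite (_ : _ `&` _ = \bigcup_(z in [set: 'rV[int]_n])
   ((Om `&` [set x | grid_floor m (G x) = z]) `&` (Om `&` (b ^~ (grid m z)) @^-1` B))).
  apply: countable_bigcupT_measurable => [|z]; first exact: countableP.
  by apply: measurableI; [exact: measurable_grid_floor|exact: mb].
apply/seteqP; split => [x [Ox Bx]|x [z _ [[Ox /= <-] [_ Bx]]]] //.
by exists (grid_floor m (G x)).
Qed.

(** Off a null set [b x (G x)] is the limit of its values at the rounded points,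
    and these are measurable as countably many measurable pieces are patched
    together. The null set is harmless because the measure is complete. *)
Lemma caratheodory_comp_measurable (b : V -> V -> R) (G : V -> V) :
  caratheodory_fun Om b -> (forall j, measurable_fun Om (fun x => G x 0 j)) ->
  measurable_fun Om (fun x => b x (G x)).
Proof.
move=> [mb [N [mN N0 cbN]]] mG.
have mOmN : measurable (Om `\` N) by exact: measurableD.
have mf : measurable_fun (Om `\` N) (fun x => b x (G x)).
  apply: (@measurable_fun_cvg _ _ _ _ (fun m x => b x (grid m (grid_floor m (G x))))).
  - by move=> m; apply: measurable_funS (measurable_comp_grid m mb mG) => // x [].
  - move=> x [Ox xN].
    have cb : continuous (b x).
      by apply: contrapT => nc; apply: xN; apply: cbN => /(_ Ox).
    apply: cvg_comp; [exact: grid_floor_cvg|exact: cb].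
move=> _ B mB.
rewrite (_ : _ `&` _ = ((Om `\` N) `&` (fun x => b x (G x)) @^-1` B) `|`
   (N `&` Om `&` (fun x => b x (G x)) @^-1` B)).
  apply: measurableU; first exact: mf.
  by apply: rV_lebesgue_complete; exists N; split => // x [[]].
apply/seteqP; split => [x [Ox Bx]|x [[[Ox _] Bx]|[[_ Ox] Bx]]] //.
by have [xN|xN] := pselect (N x); [right|left].
Qed.

End caratheodory.

(** * Power inequalities *)

Section power_inequalities.
Context {R : realType}.
Implicit Types (x y z p q K X Y : R).

(** Young's inequality without sharp constants, by comparing [d * Y] with
    [X ^ (1/p)]: one of the two terms on the right dominates. *)
Lemma young_powR p X Y (d : R) : 1 < p -> 0 <= X -> 0 <= Y -> 0 < d ->
  X `^ (1 - p^-1) * Y <= d `^ (p - 1) * Y `^ p + d^-1 * X.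
Proof.
move=> p1 X0 Y0 d0; have p0 : 0 < p by rewrite (lt_trans ltr01).
have ip1 : p^-1 < 1 by rewrite invf_lt1.
have [X00|Xn0] := eqVneq X 0.
  by rewrite X00 powR0 ?mul0r ?mulr0 ?addr0 ?mulr_ge0 ?powR_ge0// gt_eqF// subr_gt0.
have Xp : 0 < X by rewrite lt_def Xn0.
have [dY|dY] := leP (d * Y) (X `^ p^-1).
  rewrite -[leLHS]add0r lerD ?mulr_ge0 ?powR_ge0//.
  rewrite ler_pdivlMl// mulrCA (le_trans (ler_wpM2l (powR_ge0 _ _) dY))//.
  by rewrite -powRD ?subrK ?powRr1// implybE Xn0 orbT.
rewrite -[leLHS]addr0 lerD ?mulr_ge0 ?invr_ge0 ?(ltW d0)//.
have -> : 1 - p^-1 = p^-1 * (p - 1) by rewrite mulrBr mulVf ?gt_eqF// mulr1.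
have Yn0 : 0 < Y.
  rewrite lt_def Y0 andbT; apply: contraTneq dY => ->.
  by rewrite mulr0 -leNgt powR_ge0.
rewrite powRrM.
have -> : Y `^ p = Y `^ (p - 1) * Y.
  rewrite -[X in _ = _ * X]powRr1// -powRD ?subrK// implybE (gt_eqF Yn0) orbT//.
rewrite mulrA ler_wpM2r// -powRM// ?(ltW d0)//.
by apply: ge0_ler_powR; rewrite ?nnegrE ?subr_ge0 ?powR_ge0 ?mulr_ge0 ?(ltW d0) ?(ltW p1) ?(ltW dY).
Qed.

(** This replaces Hölder's inequality: with [K] chosen as a power of the measure of
    the set on which one integrates, integrating the right-hand side gives the same
    bound up to a constant. *)
Lemma powR_split p X K : 1 < p -> 0 <= X -> 0 < K -> X <= K + K `^ (1 - p) * X `^ p.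
Proof.
move=> p1 X0 K0; have [XK|KX] := leP X K.
  by rewrite (le_trans XK)// lerDl mulr_ge0// powR_ge0.
have Xp : 0 < X by rewrite (lt_trans K0).
rewrite -[leLHS]add0r lerD ?(ltW K0)//.
have -> : X `^ p = X `^ (p - 1) * X.
  rewrite -[X in _ = _ * X]powRr1// -powRD ?subrK// implybE (gt_eqF Xp) orbT//.
rewrite mulrA ler_peMl//.
rewrite -opprB powRN mulrC ler_pdivlMr ?powR_gt0// mul1r.
by apply: ge0_ler_powR; rewrite ?nnegrE ?subr_ge0 ?(ltW p1) ?(ltW K0) ?(ltW KX).
Qed.

Lemma powR_le1D p q X : 0 < p -> p <= q -> 0 <= X -> X `^ p <= 1 + X `^ q.
Proof.
move=> p0 pq X0; have q0 := lt_le_trans p0 pq.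
have [X1|X1] := leP X 1.
  have P1 : 1 `^ p = 1 :> R by rewrite powR1.
  rewrite -[leLHS]addr0 lerD ?powR_ge0// -[leRHS]P1.
  by apply: ge0_ler_powR; rewrite ?nnegrE ?(ltW p0).
by rewrite -[leLHS]add0r lerD// ler_powR// ltW.
Qed.

Lemma powRD_le p x y : 0 < p -> `|x + y| `^ p <= 2 `^ p * (`|x| `^ p + `|y| `^ p).
Proof.
move=> p0.
wlog : x y / `|x| <= `|y| => [H|xy].
  have [/H//|/ltW/H] := leP `|x| `|y|.
  by rewrite (addrC y) (addrC (`|y| `^ p)).
have : `|x + y| <= 2 * `|y|.
  by rewrite (le_trans (ler_normD _ _))// mulr2n mulrDl mul1r lerD.
have h2 : 0 <= 2 * `|y| by rewrite mulr_ge0.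
move=> h; apply: (@le_trans _ _ ((2 * `|y|) `^ p)).
  by apply: ge0_ler_powR; rewrite ?nnegrE ?(ltW p0).
by rewrite powRM// ler_wpM2l ?powR_ge0// lerDr powR_ge0.
Qed.

Lemma conj_powR p X : 1 < p -> 0 <= X -> (X `^ (p / (p - 1))) `^ (1 - p^-1) = X.
Proof.
move=> p1 X0; rewrite -powRrM.
have -> : p / (p - 1) * (1 - p^-1) = 1.
  by field; rewrite !gt_eqF ?subr_gt0// (lt_trans ltr01).
exact: powRr1.
Qed.

Lemma powR_conj_le p a X : 1 < p -> 0 <= a -> a `^ (p / (p - 1)) <= X -> a <= X `^ (1 - p^-1).
Proof.
move=> p1 a0 aX; rewrite -[leLHS](conj_powR p1 a0).
have p0 : 0 < p by rewrite (lt_trans ltr01).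
have ip1 : p^-1 <= 1 by rewrite invf_le1// ltW.
by apply: ge0_ler_powR; rewrite ?nnegrE ?subr_ge0 ?powR_ge0 ?(le_trans (powR_ge0 _ _) aX).
Qed.

(** The constant which results from [young_powR] when [d] is chosen such that half
    of the coercivity absorbs the term with [Y ^ p]. *)
Definition energy_const (N : nat) (p c nu : R) : R :=
  N%:R * ((1 + c) * ((nu / 2 / (1 + c)) `^ (p - 1)^-1)^-1).

Lemma energy_const_ge0 N p c nu : 0 < c -> 0 <= energy_const N p c nu.
Proof.
by move=> c0; rewrite !mulr_ge0// ?invr_ge0 ?powR_ge0// addr_ge0// ltW.
Qed.

(** With [z = Du - D theta] and [gam = dexcess L v], the first two sums on the
    right are the integrands of the equation tested with [excess L v], and [X]
    collects the data. Monotonicity is used with [D theta] as second argument; the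
    terms with [a(x, D theta)] and [f] which this produces are absorbed by
    [young_powR]. *)
Lemma energy_pointwise N p (c nu gam X : R) (au at_ f z : 'I_N -> R) :
  1 < p -> 0 < c -> 0 < nu -> 0 <= gam -> 0 <= X ->
  nu * (\sum_i `|z i| `^ p) <= \sum_i (au i - at_ i) * z i ->
  (forall i, `|f i| <= X `^ (1 - p^-1)) ->
  (forall i, `|at_ i| <= c * X `^ (1 - p^-1)) ->
  nu / 2 * (gam * \sum_i `|z i| `^ p) <=
  \sum_i au i * (gam * z i) - \sum_i f i * (gam * z i) +
    energy_const N p c nu * (gam * X).
Proof.
move=> p1 c0 nu0 gam0 X0 mono fX aX.
have c1 : 0 < 1 + c by rewrite addr_gt0.
pose d := (nu / 2 / (1 + c)) `^ (p - 1)^-1.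
have d0 : 0 < d by rewrite powR_gt0// !divr_gt0.
have dE : d `^ (p - 1) = nu / 2 / (1 + c).
  rewrite /d -powRrM mulVf ?powRr1// ?gt_eqF ?subr_gt0// ltW// !divr_gt0//.
have term i : (f i - at_ i) * z i <= nu / 2 * `|z i| `^ p + (1 + c) / d * X.
  apply: (le_trans (ler_norm _)); rewrite normrM.
  apply: (@le_trans _ _ ((1 + c) * (X `^ (1 - p^-1) * `|z i|))).
    rewrite mulrA ler_wpM2r// (le_trans (ler_normB _ _))// mulrDl mul1r lerD//.
  apply: (le_trans (ler_wpM2l (ltW c1) (young_powR p1 X0 (normr_ge0 (z i)) d0))).
  rewrite dE mulrDr le_eqVlt; apply/orP; left; apply/eqP; congr (_ + _).
    by rewrite !mulrA; congr (_ * _); field; rewrite gt_eqF.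
  by rewrite mulrA.
have tot : nu * (\sum_i `|z i| `^ p) <= \sum_i au i * z i - \sum_i f i * z i +
    (nu / 2 * (\sum_i `|z i| `^ p) + N%:R * ((1 + c) / d * X)).
  apply: (le_trans mono).
  have -> : \sum_i (au i - at_ i) * z i = \sum_i au i * z i - \sum_i f i * z i +
     \sum_i (f i - at_ i) * z i.
    rewrite -sumrB -big_split/=; apply: eq_bigr => i _; ring.
  have -> : N%:R * ((1 + c) / d * X) = \sum_(i < N) (1 + c) / d * X.
    by rewrite sumr_const card_ord mulr_natl.
  rewrite lerD2l mulr_sumr -big_split/=.
  exact: ler_sum.
have tot' : nu / 2 * (\sum_i `|z i| `^ p) <= \sum_i au i * z i - \sum_i f i * z i +
    energy_const N p c nu * X.
  rewrite /energy_const -/d; move: tot.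
  have -> : N%:R * ((1 + c) * d^-1) * X = N%:R * ((1 + c) / d * X) by ring.
  set S := \sum_i `|z i| `^ p; lra.
have := ler_wpM2l gam0 tot'.
have sE (g : 'I_N -> R) : \sum_i g i * (gam * z i) = gam * \sum_i g i * z i.
  by rewrite mulr_sumr; apply: eq_bigr => i _; ring.
rewrite !sE; set S := \sum_i `|z i| `^ p.
set S1 := \sum_i au i * z i; set S2 := \sum_i f i * z i; set C := energy_const _ _ _ _.
have -> : nu / 2 * (gam * S) = gam * (nu / 2 * S) by ring.
by have -> : gam * S1 - gam * S2 + C * (gam * X) = gam * (S1 - S2 + C * X) by ring.
Qed.

End power_inequalities.

(** * Iteration over dyadic levels *)

Section stampacchia.
Context {R : realType}.

(** The quantity [s ^ t * alpha s] passes from [s] to [2 s] by the map sending [y] to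
    [D * y ^ b], up to inequality, because [t * (1 - b) = r].  The interval below the
    fixed point [B] of this map is invariant, and it contains the value at every
    small [s] since [alpha] is bounded; each [L] is reached from such an [s] by
    doubling. *)
Lemma stampacchia (alpha : R -> R) (m C b r t : R) :
  (forall L, 0 < L -> 0 <= alpha L <= m) -> 0 < C -> 0 < b -> b < 1 -> 0 < t ->
  t * (1 - b) = r ->
  (forall L, 0 < L -> alpha (2 * L) <= C * (alpha L `^ b / L `^ r)) ->
  exists2 B : R, 0 < B & forall L, 0 < L -> alpha L <= B / L `^ t.
Proof.
move=> alpham C0 b0 b1 t0 tr rec.
pose D := 2 `^ t * C; have D0 : 0 < D by rewrite mulr_gt0// powR_gt0.
pose B := D `^ (1 - b)^-1; have B0 : 0 < B by apply: powR_gt0.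
have b10 : 1 - b != 0 by rewrite gt_eqF// subr_gt0.
have BD : D * B `^ b = B.
  rewrite -{1}(_ : B `^ (1 - b) = D); last first.
    by rewrite /B -powRrM mulVf// powRr1// ltW.
  by rewrite -powRD ?subrK ?powRr1 ?(ltW B0)// implybE (gt_eqF B0) orbT.
exists B => // L L0.
have step s : 0 < s -> s `^ t * alpha s <= B -> (2 * s) `^ t * alpha (2 * s) <= B.
  move=> s0 sB; have /andP[as0 _] := alpham s s0.
  have st0 : 0 < s `^ t by apply: powR_gt0.
  rewrite -[leRHS]BD powRM ?(ltW s0)//.
  apply: (@le_trans _ _ (2 `^ t * s `^ t * (C * (alpha s `^ b / s `^ r)))).
    by rewrite ler_wpM2l ?rec// mulr_ge0 ?powR_ge0.
  rewrite /D -!mulrA ler_wpM2l ?powR_ge0// mulrCA ler_wpM2l ?(ltW C0)//.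
  apply: (@le_trans _ _ ((s `^ t * alpha s) `^ b)).
    rewrite powRM ?powR_ge0// -powRrM mulrCA [leRHS]mulrC ler_wpM2l ?powR_ge0//.
    rewrite -powRN -powRD; last by rewrite implybE (gt_eqF s0) orbT.
    by rewrite -tr (_ : t + - (t * (1 - b)) = t * b)//; ring.
  apply: ge0_ler_powR; rewrite ?nnegrE ?(ltW b0) ?(ltW B0)//.
  by rewrite mulr_ge0// powR_ge0.
have all k s : 0 < s -> s `^ t * alpha s <= B -> (2 ^+ k * s) `^ t * alpha (2 ^+ k * s) <= B.
  move=> s0 sB; elim: k => [|k IH]; first by rewrite expr0 mul1r.
  by rewrite exprS -mulrA; apply: step => //; rewrite mulr_gt0// exprn_gt0.
have m0 : 0 <= m by have /andP[h1 h2] := alpham L L0; exact: le_trans h2.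
(* Up to [s0], the bound [alpha s <= m] alone gives [s ^ t * alpha s <= B]. *)
pose s0 := (B / (m + 1)) `^ t^-1.
have Bm : 0 < B / (m + 1) by rewrite divr_gt0// ltr_wpDl.
have s00 : 0 < s0 by apply: powR_gt0.
have small s : 0 < s -> s <= s0 -> s `^ t * alpha s <= B.
  move=> sp ss0; have /andP[as0 asm] := alpham s sp.
  apply: (@le_trans _ _ (B / (m + 1) * m)).
    apply: ler_pM => //; first exact: powR_ge0.
    rewrite -[leRHS](_ : s0 `^ t = _); last by rewrite /s0 -powRrM mulVf ?powRr1 ?(ltW Bm)// gt_eqF.
    by apply: ge0_ler_powR; rewrite ?nnegrE ?(ltW t0) ?(ltW sp) ?(ltW s00).
  by rewrite -mulrA ler_piMr ?(ltW B0)// mulrC ler_pdivrMr ?ltr_wpDl// mul1r lerDl.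
have [k kL] : exists k : nat, L / s0 <= 2 ^+ k.
  exists (Num.bound (L / s0)); apply: ltW.
  have Ls0 : 0 <= L / s0 by rewrite divr_ge0// ltW.
  apply: lt_trans (archi_boundP Ls0) _.
  by rewrite -natrX ltr_nat ltn_expl.
have k0 : 0 < 2 ^+ k :> R by rewrite exprn_gt0.
have E : 2 ^+ k * (L / 2 ^+ k) = L by rewrite mulrC divfK// gt_eqF.
have := all k (L / 2 ^+ k) (divr_gt0 L0 k0); rewrite E => H.
rewrite ler_pdivlMr ?powR_gt0// mulrC; apply: H; apply: small; first exact: divr_gt0.
by rewrite ler_pdivrMr// mulrC -ler_pdivrMr.
Qed.

End stampacchia.

(** * The energy estimate *)

Section ae_domination.
Context d (T : measurableType d) (R : realType) (mu : {measure set T -> \bar R}).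
Variables (D : set T) (mD : measurable D).

Lemma integral_ae_le (f g : T -> R) : mu.-integrable D (EFin \o f) ->
  mu.-integrable D (EFin \o g) -> {ae mu, forall x, D x -> f x <= g x} ->
  (\int[mu]_(x in D) (f x)%:E <= \int[mu]_(x in D) (g x)%:E)%E.
Proof.
move=> fi gi [N [mN N0 fgN]].
rewrite (negligible_integral mN mD fi N0) (negligible_integral mN mD gi N0).
have mDN : measurable (D `\` N) by exact: measurableD.
apply: le_integral => //.
- by apply: (integrableS mD) => // x [].
- by apply: (integrableS mD) => // x [].
move=> x; rewrite inE => -[Dx Nx]; rewrite lee_fin.
by apply: contrapT => nfg; apply: Nx; apply: fgN => /(_ Dx).
Qed.

Lemma ae_dominated_integrable (f g : T -> R) : measurable_fun D f ->
  mu.-integrable D (EFin \o g) -> {ae mu, forall x, D x -> `|f x| <= g x} ->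
  mu.-integrable D (EFin \o f).
Proof.
move=> mf gi fg; have mg := integrable_measurable gi.
apply/integrableP; split; first exact/measurable_EFinP.
have : (\int[mu]_(x in D) `|g x|%:E < +oo)%E by case/integrableP: gi.
apply: le_lt_trans; apply: ae_ge0_le_integral => //; [exact: mEFin_norm..|].
by move: fg; apply: filterS => x fg Dx; rewrite lee_fin (le_trans (fg Dx))// ler_norm.
Qed.

Lemma integrable_sumR (I : finType) (f : I -> T -> R) :
  (forall i, mu.-integrable D (EFin \o f i)) ->
  mu.-integrable D (EFin \o (fun x => \sum_i f i x)).
Proof.
move=> fi; have := integrable_sum mD (index_enum I) (fun i _ => fi i).
rewrite (_ : (EFin \o _) = (fun x => \sum_(i <- index_enum I) (EFin \o f i) x)%E)//.
by apply/funext => x; rewrite /= sumEFin.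
Qed.

Lemma integrableDR (f g : T -> R) : mu.-integrable D (EFin \o f) ->
  mu.-integrable D (EFin \o g) -> mu.-integrable D (EFin \o (fun x => f x + g x)).
Proof. by move=> fi gi; have := integrableD mD fi gi; exact. Qed.

Lemma integrableZR (f : T -> R) (c : R) : mu.-integrable D (EFin \o f) ->
  mu.-integrable D (EFin \o (fun x => c * f x)).
Proof. by move=> fi; have := integrableZl mD c fi; exact. Qed.

(** The integrands [P] and [Q] of the two sides of the equation have no sign and no
    separate bounds in terms of [A]; only their difference enters, and it
    integrates to 0. *)
Lemma flux_balance_bound (A : set T) (P Q W z : T -> R) (a b c : R) :
  measurable A -> A `<=` D -> (mu A < +oo)%E -> measurable_fun D z ->
  mu.-integrable D (EFin \o P) -> mu.-integrable D (EFin \o Q) ->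
  mu.-integrable D (EFin \o W) ->
  \int[mu]_(x in D) P x = \int[mu]_(x in D) Q x ->
  {ae mu, forall x, D x -> `|z x| <= a * \1_A x + b * (P x - Q x) + c * W x} ->
  (\int[mu]_(x in D) `|z x|%:E <= (a * fine (mu A) + c * \int[mu]_(x in D) W x)%:E)%E.
Proof.
move=> mA AD Aoo mz Pi Qi Wi PQ zle.
have Ai : mu.-integrable D (EFin \o (\1_A : T -> R)).
  apply/integrableP; split; first by apply/measurable_EFinP; exact: measurable_indic.
  under eq_integral do rewrite /= ger0_norm//.
  by rewrite integral_indic// setIidl.
have PQi : mu.-integrable D (EFin \o (fun x => P x - Q x)) by exact: integrableB_fun.
have aAi := integrableZR a Ai; have bPQi := integrableZR b PQi; have cWi := integrableZR c Wi.
have Si := integrableDR (integrableDR aAi bPQi) cWi.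
have zi := ae_dominated_integrable mz Si zle.
have nzi : mu.-integrable D (EFin \o (fun x => `|z x|)) by have := integrable_abse zi; exact.
apply: (le_trans (integral_ae_le nzi Si zle)).
rewrite le_eqVlt; apply/orP; left; apply/eqP.
rewrite -[LHS]fineK; last exact: integrable_fin_num.
congr (_%:E).
rewrite -[LHS]/(\int[mu]_(x in D) (a * \1_A x + b * (P x - Q x) + c * W x)).
rewrite (RintegralD mD (integrableDR aAi bPQi) cWi) (RintegralD mD aAi bPQi).
rewrite !RintegralZl// RintegralB// PQ subrr mulr0 addr0; congr (a * _ + _).
by rewrite /Rintegral integral_indic// setIidl.
Qed.

End ae_domination.

Section pointwise_decay.
Context {R : realType}.

(** From the [p]-th power of the gradient, as in [energy_pointwise], to the first
    power, by [powR_split] at the height [K]. The indicator [ind] of the bound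
    [gam <= M * ind] is kept only in the terms without [W]: integrated, these
    produce the measure of the set where [gam] lives, whereas [W] is integrated
    over the whole domain. *)
Lemma flux_pointwise N (p nu gam M K ind m W X C1 b : R) (z : 'I_N -> R) (B : R) k :
  1 < p -> 0 < nu -> 0 <= gam -> 0 <= M -> 0 < K -> 0 <= ind <= 1 -> gam <= M * ind ->
  0 <= W -> 0 <= C1 -> 0 <= X -> X <= m * K `^ p + b * W -> 0 <= b ->
  nu / 2 * (gam * \sum_i `|z i| `^ p) <= B + C1 * (gam * X) ->
  `|gam * z k| <= (M * K + K `^ (1 - p) * (2 / nu) * C1 * M * m * K `^ p) * ind +
    (K `^ (1 - p) * (2 / nu)) * B + (K `^ (1 - p) * (2 / nu) * C1 * M * b) * W.
Proof.
move=> p1 nu0 gam0 M0 K0 /andP[i0 i1] gM W0 C10 X0 XW b0 en.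
set S := \sum_i `|z i| `^ p in en.
have zS : `|z k| `^ p <= S.
  by rewrite /S (bigD1 k)//= lerDl sumr_ge0// => i _; exact: powR_ge0.
have S0 : 0 <= S by apply: sumr_ge0 => i _; exact: powR_ge0.
have Kp0 : 0 <= K `^ (1 - p) by exact: powR_ge0.
have Mi0 : 0 <= M * ind by rewrite mulr_ge0.
have gX : gam * X <= M * m * K `^ p * ind + M * b * W.
  apply: (@le_trans _ _ (M * ind * (m * K `^ p + b * W))).
    by apply: ler_pM.
  rewrite mulrDr; apply: lerD; first by rewrite le_eqVlt; apply/orP; left; apply/eqP; ring.
  rewrite mulrA ler_wpM2r// mulrAC -[leRHS]mulr1 ler_wpM2l// mulr_ge0//.
have enS : gam * S <= 2 / nu * (B + C1 * (M * m * K `^ p * ind + M * b * W)).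
  have h : nu / 2 * (gam * S) <= B + C1 * (M * m * K `^ p * ind + M * b * W).
    by rewrite (le_trans en)// lerD2l ler_wpM2l.
  have n2 : 0 <= 2 / nu by rewrite divr_ge0// ltW.
  have := ler_wpM2l n2 h; rewrite (_ : 2 / nu * (nu / 2 * (gam * S)) = gam * S)//.
  by field; rewrite gt_eqF.
rewrite normrM (ger0_norm gam0).
apply: (@le_trans _ _ (gam * (K + K `^ (1 - p) * `|z k| `^ p))).
  by rewrite ler_wpM2l// powR_split.
apply: (@le_trans _ _ (M * ind * K + K `^ (1 - p) * (gam * S))).
  rewrite mulrDr lerD//; first by rewrite ler_wpM2r// ltW.
  by rewrite mulrCA ler_wpM2l// ler_wpM2l.
apply: (le_trans (lerD (lexx _) (ler_wpM2l Kp0 enS))).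
by rewrite le_eqVlt; apply/orP; left; apply/eqP; ring.
Qed.

(** [powR_split] at the height [K ^ p] with the exponent [q / p], for each of the
    data. *)
Lemma data_split N (p q K h : R) (th f : 'I_N -> R) : 1 < p -> p < q -> 0 < K ->
  `|h| + \sum_i `|th i| `^ p + \sum_i `|f i| `^ (p / (p - 1)) <=
  (1 + N%:R + N%:R) * K `^ p + K `^ (p - q) *
   (`|h| `^ (q / p) + \sum_i `|th i| `^ q + \sum_i `|f i| `^ (q / (p - 1))).
Proof.
move=> p1 pq K0; have p0 : 0 < p by rewrite (lt_trans ltr01).
have q0 : 0 < q by rewrite (lt_trans p0).
have qp : 1 < q / p by rewrite ltr_pdivlMr// mul1r.
have Kp0 : 0 < K `^ p by apply: powR_gt0.
have key Y : 0 <= Y -> Y <= K `^ p + K `^ (p - q) * Y `^ (q / p).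
  move=> Y0; have := powR_split qp Y0 Kp0; rewrite -powRrM.
  by rewrite (_ : p * (1 - q / p) = p - q)//; field; rewrite gt_eqF.
have keyth i : `|th i| `^ p <= K `^ p + K `^ (p - q) * `|th i| `^ q.
  have := key _ (powR_ge0 `|th i| p); rewrite -powRrM.
  by rewrite (_ : p * (q / p) = q)//; field; rewrite gt_eqF.
have keyf i : `|f i| `^ (p / (p - 1)) <= K `^ p + K `^ (p - q) * `|f i| `^ (q / (p - 1)).
  have := key _ (powR_ge0 `|f i| (p / (p - 1))); rewrite -powRrM.
  rewrite (_ : p / (p - 1) * (q / p) = q / (p - 1))//; field.
  by rewrite !gt_eqF ?subr_gt0.
have sN (c : R) : N%:R * c = \sum_(i < N) c by rewrite sumr_const card_ord mulr_natl.
rewrite !mulrDl mul1r !sN !mulrDr !mulr_sumr.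
have := key _ (normr_ge0 h).
have : \sum_i `|th i| `^ p <= \sum_(i < N) K `^ p + \sum_i K `^ (p - q) * `|th i| `^ q.
  by rewrite -big_split/=; apply: ler_sum => i _; exact: keyth.
have : \sum_i `|f i| `^ (p / (p - 1)) <=
    \sum_(i < N) K `^ p + \sum_i K `^ (p - q) * `|f i| `^ (q / (p - 1)).
  by rewrite -big_split/=; apply: ler_sum => i _; exact: keyf.
lra.
Qed.

(** The choice [K = al ^ (-1/q)] balances the two groups of terms: both are
    multiples of [al ^ (1 - 1/q)]. *)
Lemma scaling_const (p q al M m c1 I nu : R) : 1 < p -> p < q -> 0 < al ->
  let K := al `^ (- q^-1) in
  (M * K + K `^ (1 - p) * (2 / nu) * c1 * M * m * K `^ p) * al +
   (K `^ (1 - p) * (2 / nu) * c1 * M * K `^ (p - q)) * I =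
  (M + 2 / nu * c1 * M * (m + I)) * al `^ (1 - q^-1).
Proof.
move=> p1 pq al0 K; have p0 : 0 < p by rewrite (lt_trans ltr01).
have q0 : 0 < q by rewrite (lt_trans p0).
have K0 : 0 < K by apply: powR_gt0.
have KD (s t : R) : K `^ s * K `^ t = K `^ (s + t).
  by rewrite -powRD// implybE (gt_eqF K0) orbT.
have Kal : K * al = al `^ (1 - q^-1).
  rewrite -[X in K * X](powRr1 (ltW al0)) /K -powRD; last by rewrite implybE (gt_eqF al0) orbT.
  by rewrite addrC.
have K1 : K `^ (1 - p) * K `^ p = K by rewrite KD subrK powRr1// ltW.
have K2 : K `^ (1 - p) * K `^ (p - q) = al `^ (1 - q^-1).
  rewrite KD /K -powRrM; congr (_ `^ _).
  by field; rewrite gt_eqF.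
transitivity (M * (K * al) + 2 / nu * c1 * M * m * ((K `^ (1 - p) * K `^ p) * al) +
   2 / nu * c1 * M * I * (K `^ (1 - p) * K `^ (p - q))); first ring.
by rewrite K1 K2 Kal; ring.
Qed.

End pointwise_decay.

Lemma integrable_finite_cst d (T : measurableType d) (R : realType)
    (mu : {measure set T -> \bar R}) (D : set T) (c : R) : measurable D ->
  (mu D < +oo)%E -> mu.-integrable D (EFin \o (fun=> c)).
Proof.
move=> mD Doo; apply/integrableP; split.
  by apply/measurable_EFinP; exact: measurable_cst.
rewrite (_ : (fun x => _) = cst `|c|%:E)//.
by rewrite integral_cst// lte_mul_pinfty// ?lee_fin.
Qed.

Lemma ae_and d (T : measurableType d) (R : realType)
    (mu : {measure set T -> \bar R}) (P Q : T -> Prop) :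
  {ae mu, forall x, P x} -> {ae mu, forall x, Q x} -> {ae mu, forall x, P x /\ Q x}.
Proof. by apply: filterS2 => x. Qed.

Section integrability.
Context {R : realType} {n : nat}.
Local Notation V := 'rV[R]_n.
Local Notation mu := (@rV_lebesgue R n).
Variables (Om : set V) (oOm : open Om).
Let mOm : measurable Om := open_rV_measurable oOm.

Lemma Lp_powR_integrable (r s : R) (f : V -> R) : (mu Om < +oo)%E -> 0 < s -> s <= r ->
  Lp Om r f -> mu.-integrable Om (EFin \o (fun x => `|f x| `^ s)).
Proof.
move=> Omoo s0 sr; have r0 := lt_le_trans s0 sr.
move=> /(LpP Om _ r0)[mf fi].
have ci := integrable_finite_cst 1 mOm Omoo.
apply: (ae_dominated_integrable mOm (measurable_powR_norm s mf) (integrableDR mOm ci fi)).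
apply: aeW => x _; rewrite (ger0_norm (powR_ge0 _ _)); exact: powR_le1D.
Qed.

(** Weak differentiability of [u] itself follows from that of [u - theta] and
    [theta]; without it [weakD Om k u] would be a mere default value. *)
Lemma weak_grad_decomp (u theta : V -> R) : W11 Om (u \- theta) -> W11 Om theta ->
  (forall k, measurable_fun Om (weakD Om k u)) /\
  {ae mu, forall x, Om x -> forall k,
    weakD Om k u x = weakD Om k (u \- theta) x + weakD Om k theta x}.
Proof.
move=> [/(Lp1P mOm) vi vD] [/(Lp1P mOm) ti tD].
have uE : u = (fun x => (u \- theta) x + theta x) by apply/funext => x; rewrite /= subrK.
have part k : is_weak_partial Om k u
    (fun x => weakD Om k (u \- theta) x + weakD Om k theta x).
  have [ev /(Lp1P mOm) Dvi] := vD k; have [et /(Lp1P mOm) Dti] := tD k.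
  rewrite {1}uE.
  exact: (is_weak_partialD oOm vi ti Dvi Dti (weakD_spec ev) (weakD_spec et)).
have spec k : is_weak_partial Om k u (weakD Om k u) by apply: weakD_spec; eexists; exact: part.
split=> [k|]; first by have [[]] := spec k.
have : {ae mu, forall x, forall k, Om x ->
    weakD Om k u x = weakD Om k (u \- theta) x + weakD Om k theta x}.
  by apply: filter_forall => k; exact: (weak_partial_unique oOm (spec k) (part k)).
by apply: filterS => x H Ox k; exact: H.
Qed.

(** The Young inequality bounds the product by the sum of [|phi|^p] and the growth
    bound of the flux. *)
Lemma flux_integrable (p c1 : R) (h : V -> R) (a : 'I_n -> V -> V -> R) (G : V -> V)
    (phi : 'I_n -> V -> R) :
  1 < p -> 0 < c1 -> {ae mu, forall x, Om x -> 0 <= h x} ->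
  mu.-integrable Om (EFin \o (fun x => `|h x|)) ->
  (forall i, caratheodory_fun Om (a i)) ->
  {ae mu, forall x, Om x -> forall (z : V) i,
     `|a i x z| <= c1 * (h x + \sum_j `|z ord0 j| `^ p) `^ (1 - p^-1)} ->
  (forall j, measurable_fun Om (fun x => G x 0 j)) ->
  (forall j, mu.-integrable Om (EFin \o (fun x => `|G x 0 j| `^ p))) ->
  (forall i, measurable_fun Om (phi i)) ->
  (forall i, mu.-integrable Om (EFin \o (fun x => `|phi i x| `^ p))) ->
  mu.-integrable Om (EFin \o (fun x => \sum_i a i x (G x) * phi i x)).
Proof.
move=> p1 c10 h0 hi aC aG mG Gi mphi phii.
apply: (integrable_sumR mOm) => i.
have Si := integrableDR mOm hi (integrable_sumR mOm Gi).
have gi := integrableZR mOm c1 (integrableDR mOm (phii i) Si).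
apply: (ae_dominated_integrable mOm _ gi).
  apply: measurable_funM; last exact: mphi.
  exact: (caratheodory_comp_measurable mOm (aC i) mG).
move: h0 aG; apply: filterS2 => x h0 aG Ox.
have hx := h0 Ox; have ax := aG Ox (G x) i.
have S0 : 0 <= h x + \sum_j `|G x 0 j| `^ p.
  by rewrite addr_ge0// sumr_ge0// => j _; exact: powR_ge0.
rewrite normrM (ger0_norm hx).
apply: (le_trans (ler_wpM2r (normr_ge0 _) ax)); rewrite -mulrA ler_wpM2l ?(ltW c10)//.
have := young_powR p1 S0 (normr_ge0 (phi i x)) ltr01.
by rewrite powR1 mul1r invr1 mul1r.
Qed.

Lemma source_integrable (p : R) (f phi : 'I_n -> V -> R) : 1 < p ->
  (forall i, measurable_fun Om (f i)) ->
  (forall i, mu.-integrable Om (EFin \o (fun x => `|f i x| `^ (p / (p - 1))))) ->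
  (forall i, measurable_fun Om (phi i)) ->
  (forall i, mu.-integrable Om (EFin \o (fun x => `|phi i x| `^ p))) ->
  mu.-integrable Om (EFin \o (fun x => \sum_i f i x * phi i x)).
Proof.
move=> p1 mf fi mphi phii; apply: (integrable_sumR mOm) => i.
apply: (ae_dominated_integrable mOm _ (integrableDR mOm (phii i) (fi i))).
  exact: measurable_funM.
apply: aeW => x _; rewrite normrM.
have := young_powR p1 (powR_ge0 `|f i x| (p / (p - 1))) (normr_ge0 (phi i x)) ltr01.
by rewrite conj_powR// powR1 mul1r invr1 mul1r.
Qed.

(** The constant does not depend on the level [L]: neither [energy_const] nor the
    bound [M] of [dexcess] does, and the data enter through the integral of [W] over
    all of [Om]. *)
Lemma excess_energy (p q : R) (h : V -> R) (a : 'I_n -> V -> V -> R) (c1 nu : R)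
    (theta : V -> R) (f : 'I_n -> V -> R) (u : V -> R) :
  bounded_set Om -> 1 < p -> p < q ->
  {ae mu, forall x, Om x -> 0 <= h x} -> Lp Om (q / p) h ->
  (forall i, caratheodory_fun Om (a i)) -> 0 < c1 -> 0 < nu ->
  {ae mu, forall x, Om x -> forall (z : V) i,
     `|a i x z| <= c1 * (h x + \sum_j `|z ord0 j| `^ p) `^ (1 - p^-1)} ->
  {ae mu, forall x, Om x -> forall z z' : V,
     nu * (\sum_i `|z ord0 i - z' ord0 i| `^ p) <=
     \sum_i (a i x z - a i x z') * (z ord0 i - z' ord0 i)} ->
  W1 Om q theta -> (forall i, Lp Om (q / (p - 1)) (f i)) ->
  is_solution Om p a f theta u ->
  exists2 C : R, 0 < C & forall L, 0 < L ->
    let al := fine (mu (Om `&` [set x | L < `|(u \- theta) x|])) in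
    0 < al -> forall k,
    (\int[mu]_(x in Om) `|dexcess L ((u \- theta) x) * weakD Om k (u \- theta) x|%:E <=
      (C * al `^ (1 - q^-1))%:E)%E.
Proof.
move=> bOm p1 pq h0 hL aC c10 nu0 aG aM thW fL [v0 u_eq].
have p0 : 0 < p by rewrite (lt_trans ltr01).
have q0 : 0 < q by rewrite (lt_trans p0).
have pm0 : 0 < p - 1 by rewrite subr_gt0.
have Omoo : (mu Om < +oo)%E by exact: rV_lebesgue_bounded.
have [thW11 thD] := thW; have [v011 vD] := v0; have [vW11 _] := v011.
have [mDu Du] := weak_grad_decomp vW11 thW11.
have qp0 : 0 < q / p by rewrite divr_gt0.
have h1 : 1 <= q / p by rewrite ler_pdivlMr// mul1r ltW.
have hi : mu.-integrable Om (EFin \o (fun x => `|h x|)).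
  have := Lp_powR_integrable Omoo ltr01 h1 hL.
  by congr (is_true (integrable _ _ _)); apply/funext => x /=; rewrite powRr1.
have hqi := Lp_powR_integrable Omoo qp0 (lexx _) hL.
have thpi k := Lp_powR_integrable Omoo p0 (ltW pq) (thD k).
have thqi k := Lp_powR_integrable Omoo q0 (lexx _) (thD k).
have vpi k := Lp_powR_integrable Omoo p0 (lexx _) (vD k).
have fpi k : mu.-integrable Om (EFin \o (fun x => `|f k x| `^ (p / (p - 1)))).
  apply: (Lp_powR_integrable Omoo _ _ (fL k)); first by rewrite divr_gt0.
  by rewrite ler_pM2r ?invr_gt0// ltW.
have fqi k : mu.-integrable Om (EFin \o (fun x => `|f k x| `^ (q / (p - 1)))).
  by apply: (Lp_powR_integrable Omoo _ (lexx _) (fL k)); rewrite divr_gt0.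
have mf k : measurable_fun Om (f k) by case: (fL k).
have Dupi k : mu.-integrable Om (EFin \o (fun x => `|weak_grad Om u x 0 k| `^ p)).
  have gi := integrableZR mOm (2 `^ p) (integrableDR mOm (vpi k) (thpi k)).
  have mDuk : measurable_fun Om (fun x => weak_grad Om u x 0 k).
    by under eq_fun do rewrite mxE; exact: mDu.
  apply: (ae_dominated_integrable mOm (measurable_powR_norm p mDuk) gi).
  move: Du; apply: filterS => x Du Ox; rewrite (ger0_norm (powR_ge0 _ _)) mxE Du//.
  exact: powRD_le.
pose W x := `|h x| `^ (q / p) + \sum_i `|weakD Om i theta x| `^ q +
   \sum_i `|f i x| `^ (q / (p - 1)).
have Wi : mu.-integrable Om (EFin \o W) :=
  integrableDR mOm (integrableDR mOm hqi (integrable_sumR mOm thqi))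
    (integrable_sumR mOm fqi).
have W0 x : 0 <= W x.
  by rewrite /W !addr_ge0 ?powR_ge0// sumr_ge0// => i _; exact: powR_ge0.
have [M M0 gM] := @dexcess_bounded R.
pose I := \int[mu]_(x in Om) W x.
have I0 : 0 <= I by apply: Rintegral_ge0.
pose c2 := energy_const n p c1 nu.
have c20 : 0 <= c2 by exact: energy_const_ge0.
pose m : R := 1 + n%:R + n%:R.
have m0 : 0 <= m by rewrite /m !addr_ge0.
(* The constant is read off from [scaling_const], [m] from [data_split]. *)
exists (M + 2 / nu * c2 * M * (m + I)).
  apply: ltr_wpDr; last exact: M0.
  apply: mulr_ge0; last exact: addr_ge0.
  apply: mulr_ge0; last exact: ltW.
  by apply: mulr_ge0 => //; apply: divr_ge0 => //; exact: ltW.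
move=> L L0 al al0 k.
set v := u \- theta in v0 v011 vD vW11 vpi Du al al0 *.
have Ln0 : L != 0 by rewrite gt_eqF.
have St := excess_class L; have Sd := dexcess_class L.
have Dt s := is_derive_excess s Ln0.
have w0 := chain_rule_W1_0 oOm St Sd Dt (excess0 L) v011 p0 vD.
have eqn := u_eq _ w0.
have [w011 wD] := w0; have [wW11 _] := w011.
have wpi i := Lp_powR_integrable Omoo p0 (lexx _) (wD i).
have mDw i : measurable_fun Om (weakD Om i (fun x => excess L (v x))) by case: (wD i).
have mDu' j : measurable_fun Om (fun x => weak_grad Om u x 0 j).
  by under eq_fun do rewrite mxE; exact: mDu.
have Pi := flux_integrable p1 c10 h0 hi aC aG mDu' Dupi mDw wpi.
have Qi := source_integrable p1 mf fpi mDw wpi.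
have mv : measurable_fun Om v by case: vW11 => -[].
have mA := measurable_level_lt mOm L mv.
have mz := integrable_measurable (dcomp_integrable oOm Sd v011 k).
have Aoo : (mu (Om `&` [set x | (L < `|v x|)%R]) < +oo)%E.
  by apply: le_lt_trans Omoo; apply: le_rV_lebesgue => x [].
have AOm : Om `&` [set x | L < `|v x|] `<=` Om by move=> x [].
have chain : {ae mu, forall x, forall i, Om x -> weakD Om i (fun x => excess L (v x)) x =
    dexcess L (v x) * weakD Om i v x}.
  by apply: filter_forall => i; exact: (chain_rule_weakD oOm St Sd Dt (excess0 L) v011 i).
rewrite -(@scaling_const _ p q al M m c2 I nu p1 pq al0).
apply: (flux_balance_bound mOm mA AOm Aoo mz Pi Qi Wi eqn (b := (al `^ (- q^-1)) `^ (1 - p) * (2 / nu))).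
have H := ae_and (ae_and h0 aG) (ae_and aM (ae_and Du chain)).
move: H; apply: filterS => x [[h0x aGx] [aMx [Dux chainx]]] Ox.
have K0 : 0 < al `^ (- q^-1) by apply: powR_gt0.
set K := al `^ (- q^-1) in K0 *.
pose X := `|h x| + \sum_i `|weakD Om i theta x| `^ p + \sum_i `|f i x| `^ (p / (p - 1)).
have sum0 (r : R) (g : 'I_n -> R) : 0 <= \sum_i `|g i| `^ r.
  by apply: sumr_ge0 => i _; exact: powR_ge0.
have hx := h0x Ox.
have X0 : 0 <= X by rewrite !addr_ge0.
have ip1 : 0 <= 1 - p^-1 by rewrite subr_ge0 invf_le1// ltW.
have en := @energy_pointwise R n p c1 nu (dexcess L (v x)) X
  (fun i => a i x (weak_grad Om u x)) (fun i => a i x (weak_grad Om theta x)) (f ^~ x)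
  (fun i => weakD Om i v x) p1 c10 nu0 (dexcess_ge0 _ _) X0.
have ind01 : 0 <= (\1_(Om `&` [set x | L < `|v x|]) x : R) <= 1.
  by rewrite indicE; case: (_ \in _); rewrite ?lexx ?ler01.
have gind : dexcess L (v x) <= M * \1_(Om `&` [set x | L < `|v x|]) x.
  rewrite indicE; have [vL|vL] := ltP L `|v x|.
    by rewrite mem_set// mulr1.
  by rewrite dexcess_small// mulr_ge0// ltW.
have XW : X <= m * K `^ p + K `^ (p - q) * W x :=
  data_split (h x) (fun i => weakD Om i theta x) (f ^~ x) p1 pq K0.
have Wx : 0 <= W x := W0 x.
have b0 : 0 <= K `^ (p - q) by exact: powR_ge0.
apply: (flux_pointwise (z := fun i => weakD Om i v x) k p1 nu0 (dexcess_ge0 _ _)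
  (ltW M0) K0 ind01 gind Wx c20 X0 XW b0).
have -> : \sum_i a i x (weak_grad Om u x) * weakD Om i (fun x => excess L (v x)) x =
    \sum_i a i x (weak_grad Om u x) * (dexcess L (v x) * weakD Om i v x).
  by apply: eq_bigr => i _; rewrite chainx.
have -> : \sum_i f i x * weakD Om i (fun x => excess L (v x)) x =
    \sum_i f i x * (dexcess L (v x) * weakD Om i v x).
  by apply: eq_bigr => i _; rewrite chainx.
apply: en.
  - have := aMx Ox (weak_grad Om u x) (weak_grad Om theta x).
  have E i : weak_grad Om u x ord0 i - weak_grad Om theta x ord0 i = weakD Om i v x.
    by rewrite !mxE Dux// addrK.
    by under eq_bigr do rewrite E; under [in X in _ <= X -> _]eq_bigr do rewrite E.
- move=> i; apply: powR_conj_le => //.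
    rewrite /X (bigD1 i (P := xpredT) (F := fun i => `|f i x| `^ _))//=.
    by rewrite addrCA lerDl !addr_ge0// sumr_ge0// => j _; exact: powR_ge0.
- move=> i; have axi := aGx Ox (weak_grad Om theta x) i.
  apply: (le_trans axi); apply: ler_wpM2l; first exact: ltW.
  have -> : \sum_j `|weak_grad Om theta x ord0 j| `^ p =
      \sum_j `|weakD Om j theta x| `^ p.
    by apply: eq_bigr => j _; rewrite mxE.
  have hXx : h x + \sum_j `|weakD Om j theta x| `^ p <= X.
    by rewrite /X (ger0_norm hx) lerDl sum0.
  have hs0 : 0 <= h x + \sum_j `|weakD Om j theta x| `^ p by rewrite addr_ge0// sum0.
  by apply: ge0_ler_powR; rewrite ?nnegrE.
Qed.

End integrability.

(** [truncated_sobolev] and [excess_energy] brought into the form of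
    [stampacchia]. At levels where [alpha] vanishes the step holds by
    monotonicity; the energy estimate is void there. *)
Lemma weak_type_iteration (R : realType) (n : nat) (q C m : R) (alpha : R -> R) : (0 < n)%N ->
  1 < q -> q < n.+1%:R -> 0 < C ->
  (forall L, 0 < L -> 0 <= alpha L <= m) ->
  (forall L, 0 < L -> 0 < alpha L ->
    alpha (2 * L) <= 2 * (4 * expR 1 * (C * alpha L `^ (1 - q^-1)) / L) `^ (n.+1%:R / n%:R)) ->
  (forall L, 0 < L -> alpha (2 * L) <= alpha L) ->
  exists2 B, 0 < B & forall L, 0 < L ->
    alpha L <= B / L `^ (n.+1%:R * q / (n.+1%:R - q)).
Proof.
move=> n0 q1 qn C0 am step mono.
have q0 : 0 < q by rewrite (lt_trans ltr01).
have n0' : 0 < n%:R :> R by rewrite ltr0n.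
have nE : n.+1%:R = n%:R + 1 :> R by rewrite -natr1.
have nq0 : 0 < n%:R + 1 - q by rewrite subr_gt0 -nE.
pose r : R := n.+1%:R / n%:R.
have r0 : 0 < r by rewrite divr_gt0// ltr0Sn.
have iq : 0 < 1 - q^-1 by rewrite subr_gt0 invf_lt1.
have b1E : 1 - (1 - q^-1) * r = (n%:R + 1 - q) / (n%:R * q).
  by rewrite /r nE; field; rewrite !gt_eqF.
have D0 : 0 < 2 * (4 * expR 1 * C) `^ r :> R.
  by rewrite mulr_gt0// powR_gt0// !mulr_gt0// expR_gt0.
apply: (@stampacchia R alpha m (2 * (4 * expR 1 * C) `^ r) ((1 - q^-1) * r) r
  (n.+1%:R * q / (n.+1%:R - q)) am D0).
- exact: mulr_gt0.
- by rewrite -subr_gt0 b1E divr_gt0// mulr_gt0.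
- by rewrite nE divr_gt0// mulr_gt0// addr_gt0.
- by rewrite b1E /r nE; field; rewrite !gt_eqF.
move=> L L0; have /andP[a0 _] := am _ L0.
have := a0; rewrite le_eqVlt => /predU1P[aL0|aLgt0].
  rewrite -aL0 in step mono *.
  have := mono _ L0; rewrite -aL0 => /le_trans; apply.
  rewrite !mulr_ge0 ?invr_ge0 ?powR_ge0//.
apply: (le_trans (step _ L0 aLgt0)); rewrite le_eqVlt; apply/orP; left; apply/eqP.
have p4 : 0 <= 4 * expR 1 * C by rewrite ltW// !mulr_gt0// expR_gt0.
rewrite !mulrA powRM ?invr_ge0 ?(ltW L0)//; last by rewrite mulr_ge0// powR_ge0.
rewrite powRM// ?powR_ge0// -powRrM.
have -> : L^-1 `^ r = (L `^ r)^-1.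
  by rewrite -[L^-1]powR_inv1 ?(ltW L0)// -powRrM mulN1r powRN.
by rewrite !mulrA.
Qed.

Theorem corollary1p2 (R : realType) (n : nat) (n_ge2 : (2 <= n)%N)
  (Om : set 'rV[R]_n) (Om_open : open Om) (Om_bounded : bounded_set Om)
  (p q : R) (p_gt1 : 1 < p) (pq : p < q) (qn : q < n%:R)
  (h : 'rV[R]_n -> R)
  (h_ge0 : {ae rV_lebesgue, forall x, Om x -> 0 <= h x})
  (hL : Lp Om (q / p) h)
  (a : 'I_n -> 'rV[R]_n -> 'rV[R]_n -> R)
  (a_car : forall i, caratheodory_fun Om (a i))
  (c1 nu : R) (c1_gt0 : 0 < c1) (nu_gt0 : 0 < nu)
  (a_growth : {ae rV_lebesgue, forall x, Om x -> forall (z : 'rV[R]_n) i,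
     `|a i x z| <= c1 * (h x + \sum_j `|z ord0 j| `^ p) `^ (1 - p^-1)})
  (a_mono : {ae rV_lebesgue, forall x, Om x -> forall z z' : 'rV[R]_n,
     nu * (\sum_i `|z ord0 i - z' ord0 i| `^ p) <=
     \sum_i (a i x z - a i x z') * (z ord0 i - z' ord0 i)})
  (theta : 'rV[R]_n -> R) (theta_W : W1 Om q theta)
  (f : 'I_n -> 'rV[R]_n -> R)
  (f_L : forall i, Lp Om (q / (p - 1)) (f i))
  (u : 'rV[R]_n -> R) (u_sol : is_solution Om p a f theta u) :
  weakLp Om (n%:R * q / (n%:R - q)) (u \- theta).
Proof.
case: n n_ge2 Om Om_open Om_bounded qn h h_ge0 hL a a_car a_growth a_mono theta theta_W
  f f_L u u_sol => // n' n0 {}Om oOm bOm {}qn {}h h0 {}hL {}a aC aG aM {}theta thW {}f fL {}u us.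
have mOm := open_rV_measurable oOm.
have Omoo : (rV_lebesgue Om < +oo)%E by exact: rV_lebesgue_bounded.
have q1 : 1 < q := lt_trans p_gt1 pq.
have [C C0 en] := excess_energy oOm bOm p_gt1 pq h0 hL aC c1_gt0 nu_gt0 aG aM thW fL us.
have [[v0 _] _] := us; set v := u \- theta in v0 en *.
have [[[mv _] _] _] := v0.
pose S L := Om `&` [set x | L < `|v x|].
have mS L : measurable (S L) by exact: measurable_level_lt.
have SOm L : (rV_lebesgue (S L) <= rV_lebesgue Om)%E.
  by apply: le_rV_lebesgue => x [].
have Soo L : rV_lebesgue (S L) \is a fin_num.
  by rewrite ge0_fin_numE ?measure_ge0// (le_lt_trans (SOm L)).
pose alpha L := fine (rV_lebesgue (S L)).
have [| | |B B0 HB] := @weak_type_iteration R n' q C (fine (rV_lebesgue Om)) alpha n0 q1 qn C0.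
- move=> L L0; apply/andP; split; first exact/fine_ge0/measure_ge0.
  apply: fine_le => //; rewrite ge0_fin_numE ?measure_ge0//.
- move=> L L0 aL0.
  have E0 : 0 < C * alpha L `^ (1 - q^-1) by rewrite mulr_gt0// powR_gt0.
  have key := truncated_sobolev oOm v0 n0 L0 E0 (en L L0 aL0).
  rewrite -lee_fin fineK//; apply: le_trans key.
  by apply: le_rV_lebesgue => x [Ox /ltW].
- move=> L L0; apply: fine_le => //; apply: le_rV_lebesgue => x [Ox /= H].
  by split => //=; apply: le_lt_trans H; rewrite ler_peMl ?ler1n// ltW.
split=> //; exists B => // tau tau0.
by have := HB _ tau0; rewrite -lee_fin fineK.
Qed.
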